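(* Let $n\ge2$, $1<p<\infty$, let $\Omega\subset\mathbb{R}^n$ be a bounded John domain, and let $\beta\in\mathbb{R}$ satisfy $$\beta p>-(n-\dim_A(\partial\Omega)).$$ Then there is a constant $C$ such that for every $\sigma\ge1$ and every $f\in L^p(\Omega,d^{\beta p})$ with $\int_\Omega f\,d^{\beta p}\,dx=0$, $$\|f\|_{L^p(\Omega,d^{\beta p})}\le C\sigma^n\|M^\sharp_{\mathrm{res},\Omega,\sigma}f\|_{L^p(\Omega,d^{\beta p})}.$$ The constant $C$ is independent of $\sigma$ and $f$.
   Context: Notation: $d(x)=\mathrm{dist}(x,\partial\Omega)$. For a weight $\omega$ (measurable, a.e. positive), $\|f\|_{L^p(\Omega,\omega)}=(\int_\Omega|f|^p\omega\,dx)^{1/p}$. Cubes have edges parallel to the coordinate axes; $\sigma Q$ is the cube with the same center as $Q$ and edge length multiplied by $\sigma$; $f_Q=\frac1{|Q|}\int_Q f$. Restricted sharp maximal function: for $x\in\Omega$, $$M^\sharp_{\mathrm{res},\Omega,\sigma}f(x)=\sup_{Q\ni x:\ \sigma Q\subseteq\Omega}\frac1{|Q|}\int_Q|f(y)-f_Q|\,dy,$$ the supremum being over all cubes $Q\subset\mathbb{R}^n$ containing $x$ with $\sigma Q\subseteq\Omega$; it is extended by zero outside $\Omega$. If $f$ is not integrable on such a $Q$, the corresponding mean oscillation is taken to be $+\infty$. John domain: a bounded domain $\Omega\subset\mathbb{R}^n$ is a John domain if there are constants $0<a_0\le b_0<\infty$ and a point $x_0\in\Omega$ such that for each $x\in\Omega\setminus\{x_0\}$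 there is a rectifiable curve $\gamma_x$ in $\Omega$ from $x$ to $x_0$, parametrized by arc length on $[0,L_x]$, $L_x=\mathrm{length}(\gamma_x)$, $\gamma_x(0)=x$, with $L_x\le b_0$ and $\mathrm{dist}(\gamma_x(\tau),\partial\Omega)\ge \frac{a_0}{L_x}\tau$ for all $\tau\in[0,L_x]$. Assouad dimension: for $E\subset\mathbb{R}^n$ and $r>0$, $N_r(E)$ is the least number of open balls of radius $r$ needed to cover $E$; $\dim_A(E)$ is the infimum of all $\lambda\ge0$ for which there is $C>0$ such that $\sup_{x\in E}N_r(B_R(x)\cap E)\le C(R/r)^\lambda$ for all $0<r<R$. *)

(* Defs.v *)
From HB Require Import structures.
From mathcomp Require Import all_boot all_order all_algebra.
From mathcomp Require Import all_classical all_reals all_analysis.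

Set Implicit Arguments.
Unset Strict Implicit.
Unset Printing Implicit Defensive.

Import Order.TTheory GRing.Theory Num.Theory.
Import numFieldNormedType.Exports.

Local Open Scope classical_set_scope.
Local Open Scope ring_scope.

(* The library norm of ['rV[R]_n] is the sup norm, hence [enorm]; the two norms
   have the same open, closed, connected and bounded sets. *)
Section euclidean.
Context {R : realType} {n : nat}.
Implicit Types (x : 'rV[R]_n) (E : set 'rV[R]_n).

Definition enorm x : R := Num.sqrt (\sum_(i < n) x 0 i ^+ 2).

Definition eball x (r : R) : set 'rV[R]_n := [set y | enorm (y - x) < r].

Definition set_dist x E : R := inf [set enorm (x - y) | y in E].

Definition boundary E : set 'rV[R]_n := closure E `\` interior E.

(* The open cube with center [c] and edge length [2 * h]; its dilation by [s]
   about its center is [cube c (s * h)]. *)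
Definition cube (c : 'rV[R]_n) (h : R) : set 'rV[R]_n :=
  [set x : 'rV[R]_n | forall i, `|x 0 i - c 0 i| < h].

End euclidean.

Section lebesgue_outer.
Context (R : realType) (n : nat).
Local Open Scope ereal_scope.
Implicit Types (A : set 'rV[R]_n) (B : option ('rV[R]_n * 'rV[R]_n)).

(* [None] is the empty box: for n = 0 no pair of corners describes it. *)
Definition box B : set 'rV[R]_n :=
  if B is Some (a, b)
  then [set x : 'rV[R]_n | forall i, (a 0 i < x 0 i <= b 0 i)%R]
  else set0.

Definition box_vol B : \bar R :=
  if B is Some (a, b) then (\prod_(i < n) Num.max (b 0 i - a 0 i)%R 0%R)%:E
  else 0.

Definition box_cover A : set (nat -> option ('rV[R]_n * 'rV[R]_n)) :=
  [set F | A `<=` \bigcup_k box (F k)].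

Definition lebesgue_outer A : \bar R :=
  ereal_inf [set \sum_(k <oo) box_vol (F k) | F in box_cover A].

Lemma box_vol_ge0 B : 0 <= box_vol B.
Proof.
case: B => [[a b]|]//=.
by rewrite lee_fin prodr_ge0// => i _; rewrite le_max lexx orbT.
Qed.

Lemma lebesgue_outer_ge0 A : 0 <= lebesgue_outer A.
Proof.
apply: le_ereal_inf_tmp => _ [F _ <-]; apply: nneseries_ge0 => k _ _.
exact: box_vol_ge0.
Qed.

Lemma lebesgue_outer0 : lebesgue_outer set0 = 0.
Proof.
apply/eqP; rewrite eq_le lebesgue_outer_ge0 andbT.
apply: ereal_inf_lbound; exists (fun=> None) => //.
by rewrite eseries0.
Qed.

Lemma le_lebesgue_outer :
  {homo lebesgue_outer : A A' / A `<=` A' >-> A <= A'}.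
Proof.
move=> A A' AA'; apply/ereal_inf_le_tmp => x [F AF <-].
by exists F => //; exact: subset_trans AA' AF.
Qed.

Lemma lebesgue_outer_sigma_subadditive : sigma_subadditive lebesgue_outer.
Proof.
move=> A; have [[i ioo]|] := pselect (exists i, lebesgue_outer (A i) = +oo).
  rewrite (eseries_pinfty _ _ ioo) ?leey// => k _.
  by rewrite -ltNye (lt_le_trans _ (lebesgue_outer_ge0 _)).
rewrite -forallNE => Aoo.
suff add2e (e : {posnum R}) : lebesgue_outer (\bigcup_k A k) <=
    \sum_(i <oo) lebesgue_outer (A i) + e%:num%:E.
  by apply/lee_addgt0Pr => _/posnumP[].
rewrite (le_trans _ (epsilon_trick _ _ _))//; last first.
  by move=> k; exact: lebesgue_outer_ge0.
pose P k F := box_cover (A k) F /\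
  \sum_(j <oo) box_vol (F j) <=
    lebesgue_outer (A k) + (e%:num / (2 ^ k.+1)%:R)%:E.
have [G PG] : {G & forall k, P k (G k)}.
  apply: (@choice _ _ P) => k; rewrite /P.
  have Afin : lebesgue_outer (A k) \is a fin_num.
    by rewrite ge0_fin_numE ?lebesgue_outer_ge0// ltey; apply/eqP/Aoo.
  have ek : (0 < e%:num / (2 ^ k.+1)%:R :> R)%R by [].
  have [_ [F AF <-] Flt] := lb_ereal_inf_adherent ek Afin.
  by exists F; split => //; exact/ltW.
have vG_ge0 x : 0 <= (box_vol \o uncurry G) x by exact: box_vol_ge0.
apply: (@le_trans _ _ (\esum_(i in setT) (box_vol \o uncurry G) i)).
  apply: ereal_inf_lbound => /=.
  have /card_esym/ppcard_eqP[f] := card_nat2.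
  exists (uncurry G \o f).
    move=> t [i _ Ait]; have [j _ Bijt] := (PG i).1 _ Ait.
    by exists (f^-1%FUN (i, j)) => //=; rewrite invK ?inE.
  rewrite -(esum_pred_image (box_vol \o uncurry G) _ xpredT) ?[fun=> _]set_true//.
  by rewrite image_eq.
rewrite (_ : esum _ _ = \sum_(i <oo) \sum_(j <oo) box_vol (G i j)); last first.
  pose J : nat -> set (nat * nat) := fun i => [set (i, j) | j in setT].
  rewrite (_ : setT = \bigcup_k J k); last first.
    by rewrite predeqE => -[a b]; split => // _; exists a => //; exists b.
  rewrite esum_bigcupT /=; last 2 first.
    - apply/trivIsetP => i j _ _ ij.
      rewrite predeqE => -[k m] /=; split => //= -[] [_] _ [<-{k} _].
      by move=> [m' _] [] /esym/eqP; rewrite (negbTE ij).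
    - by move=> /= [k m]; exact: (vG_ge0 (k, m)).
  rewrite -(image_id [set: nat]) -fun_true esum_pred_image//; last first.
    by move=> k _; apply: esum_ge0 => ij _; exact: vG_ge0.
  apply: eq_eseriesr => /= j _.
  rewrite -(esum_pred_image (box_vol \o uncurry G) (pair j) predT)//=; last first.
    by move=> ? ? _ _; exact: (@can_inj _ _ _ snd).
    by move=> m _; exact: (vG_ge0 (j, m)).
  by congr esum; rewrite predeqE => -[a b]; split; move=> [i _ <-]; exists i.
apply: lee_lim.
- apply: is_cvg_nneseries => k *.
  by apply: nneseries_ge0 => m *; exact: (vG_ge0 (k, m)).
- by apply: is_cvg_nneseries => k *; apply: adde_ge0 => //; exact: lebesgue_outer_ge0.
- by near=> k; apply: lee_sum => i _; exact: (PG i).2.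
Unshelve. all: by end_near. Qed.

HB.instance Definition _ := isOuterMeasure.Build R 'rV[R]_n lebesgue_outer
  lebesgue_outer0 lebesgue_outer_ge0 le_lebesgue_outer
  lebesgue_outer_sigma_subadditive.

End lebesgue_outer.

(* R^n with the sigma-algebra of Lebesgue measurable sets (Caratheodory's
   criterion), on which [mu_rV] is the complete Lebesgue measure *)
Notation lebesgue_rV R n := (caratheodory_type (@lebesgue_outer R n)).

Section lebesgue.
Context (R : realType) (n : nat).

Let outer : {outer_measure set 'rV[R]_n -> \bar R} := @lebesgue_outer R n.

Definition mu_rV : {measure set (lebesgue_rV R n) -> \bar R} :=
  (OuterMeasure.sort outer : set (caratheodory_type outer) -> \bar R).

End lebesgue.
Arguments mu_rV : clear implicits.

Section weighted.
Context {R : realType} {n : nat}.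
Implicit Types (Omega : set 'rV[R]_n) (w : 'rV[R]_n -> R) (p : R).
Local Open Scope ereal_scope.

Definition wLnorm Omega w p (g : 'rV[R]_n -> \bar R) : \bar R :=
  (\int[mu_rV R n]_(x in Omega) (`|g x| `^ p * (w x)%:E)) `^ p^-1.

Definition in_wLp Omega w p (f : 'rV[R]_n -> R) : Prop :=
  measurable_fun (Omega : set (lebesgue_rV R n)) (f : lebesgue_rV R n -> R) /\
  wLnorm Omega w p (EFin \o f) < +oo.

(* [d ^ gamma] with [d] the distance to the boundary of [Omega] *)
Definition dist_weight Omega (gamma : R) : 'rV[R]_n -> R :=
  fun x => (set_dist x (boundary Omega) `^ gamma)%R.

Definition average (Q : set 'rV[R]_n) (f : 'rV[R]_n -> R) : R :=
  ((fine (mu_rV R n Q))^-1 * \int[mu_rV R n]_(y in Q) f y)%R.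

Definition mean_osc (Q : set 'rV[R]_n) (f : 'rV[R]_n -> R) : \bar R :=
  if `[< (mu_rV R n).-integrable Q (EFin \o f) >] then
    ((fine (mu_rV R n Q))^-1)%:E *
      \int[mu_rV R n]_(y in Q) `|f y - average Q f|%:E
  else +oo.

(* Open and closed cubes give the same value when [f] is measurable and [Omega]
   open: mean oscillations are limits along concentric cubes. *)
Definition sharp_max_res Omega (sigma : R) (f : 'rV[R]_n -> R)
    (x : 'rV[R]_n) : \bar R :=
  if x \in Omega then
    ereal_sup [set mean_osc (cube B.1 B.2) f | B in
      [set B : 'rV[R]_n * R | [/\ (0 < B.2)%R, cube B.1 B.2 x &
                                  cube B.1 (sigma * B.2)%R `<=` Omega]]]
  else 0.

End weighted.

Section john.
Context {R : realType} {n : nat}.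

(* Euclidean analogues of the library's [variation] and [total_variation] *)
Definition evariation (a b : R) (g : R -> 'rV[R]_n) (s : seq R) : R :=
  let F := g \o nth b (a :: s) in
  \sum_(0 <= k < size s) enorm (F k.+1 - F k).

Definition curve_length (a b : R) (g : R -> 'rV[R]_n) : \bar R :=
  ereal_sup [set (evariation a b g s)%:E | s in itv_partition a b].

(* parametrized by arc length on [0, L]: every initial piece [0, t] has
   length t *)
Definition arc_length_curve (L : R) (g : R -> 'rV[R]_n) : Prop :=
  {within `[0, L], continuous g} /\
  forall t, 0 <= t <= L -> curve_length 0 t g = t%:E.

Definition bounded_domain (Omega : set 'rV[R]_n) : Prop :=
  [/\ open Omega, connected Omega, Omega !=set0 & bounded_set Omega].

Definition john_domain (Omega : set 'rV[R]_n) : Prop :=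
  bounded_domain Omega /\
  exists a0 b0 : R, [/\ 0 < a0, a0 <= b0 &
    exists2 x0, Omega x0 &
      forall x, Omega x -> x != x0 ->
      exists L : R, exists g : R -> 'rV[R]_n,
        [/\ 0 <= L <= b0, arc_length_curve L g, g 0 = x /\ g L = x0,
            (forall t, 0 <= t <= L -> Omega (g t)) &
            forall t, 0 <= t <= L ->
              a0 / L * t <= set_dist (g t) (boundary Omega)]].

End john.

Section assouad.
Context {R : realType} {n : nat}.
Implicit Types E : set 'rV[R]_n.

Definition covering_number (r : R) E : \bar R :=
  ereal_inf [set (size s)%:R%:E | s in
    [set s : seq 'rV[R]_n | E `<=` \bigcup_(c in [set` s]) eball c r]].

Definition assouad_exponent E (lambda : R) : Prop :=
  0 <= lambda /\ exists2 C : R, 0 < C &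
    forall r rho : R, 0 < r < rho ->
      (ereal_sup [set covering_number r (eball x rho `&` E) | x in E] <=
       (C * (rho / r) `^ lambda)%:E)%E.

(* Every subset of R^n has the exponent n, so this [inf] is a true infimum. *)
Definition assouad_dim E : R := inf (assouad_exponent E).

End assouad.

(* Main.v *)
(* Write d for the distance to the boundary, w = d^(beta p), and M for the
   restricted sharp function, and consider the cubes of side comparable to
   d / sigma.  Let x0 be the center of the John domain and c the mean of f over
   the cube at x0.

   Cut Omega into maximal dyadic cubes of that size.  On such a cube D the
   dyadic Fefferman-Stein inequality bounds the L^p norm of f - f_D by that of
   M, and w is nearly constant on D.

   To compare f_D with c, follow the John curve from x in D to x0 along a
   minimal chain of points spaced by d / sigma.  Consecutive averages differ by
   at most C M; by minimality the chain visits disjoint small cubes of volume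
   (d / sigma)^n, so the sum of the jumps is at most sigma^n times
   T M (x) = int d(z)^(-n) M(z) dz over the z in Omega with
   |x - z| <= A d(z).

   The operator T is bounded on L^p(w) by Schur's test with a small power of d.
   The Assouad dimension enters there: covering the layers
   {2^-(j+1) < d <= 2^-j} by balls shows that d^s is integrable over Omega, with
   the right scaling on balls, for s > dim_A - n.

   Finally int f w = 0 gives |c|^p w(Omega) <= int |f - c|^p w by Hoelder. *)

Require Import Defs.
From HB Require Import structures.
From mathcomp Require Import all_boot all_order all_algebra.
From mathcomp Require Import all_classical all_reals all_analysis.
From mathcomp Require Import measurable_realfun ring lra zify.

Set Implicit Arguments.
Unset Strict Implicit.
Unset Printing Implicit Defensive.

Import Order.TTheory GRing.Theory Num.Theory.
Import numFieldNormedType.Exports.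

Local Open Scope classical_set_scope.
Local Open Scope ring_scope.

(** * Lebesgue measure and dyadic cubes *)

(** The parameter sigma enters only through the size d / sigma of the cubes; neither the kernel of T
    nor the aperture A depends on it. The John condition gives A: a curve point at arc length t from
    x is within t of x and has d >= a0 t / L, hence lies within (b0 / a0) d of x. Minimality of the
    chain is what controls overlaps, since a John curve may come back to the same place many times.

    Finiteness of M is never assumed. Where f is not integrable on a cube, M is +oo on that cube and
    the local estimates are trivial; for this reason the inequalities are stated in the extended
    reals, and Hoelder's inequality and Schur's test allow functions with the value +oo.

    As the hypothesis on the dimension is strict, some Assouad exponent l satisfies l < n + beta p.
    Half of the gap n + beta p - l pays for the test function in Schur's test, and the other half
    makes the sums over boundary layers geometric.

    Lebesgue measure starts as an outer measure built on half-open boxes. Half-open dyadic cubes are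
    such boxes, and outer regularity gives the only form of Lebesgue differentiation that is
    used. *)

Section box_measure.
Context {R : realType}.

Let I (a b : R) : R -> R := \1_(`]a, b] : set R).

Lemma integral_indic_oc (c a b : R) : 0 <= c ->
  (\int[lebesgue_measure]_t (c * \1_(`]a, b] : set R) t)%:E = (c * Num.max (b - a) 0)%:E)%E.
Proof.
move=> c0; under eq_integral do rewrite EFinM.
rewrite ge0_integralZl//; last by exact/measurable_EFinP/measurable_indic.
rewrite integral_indic// setIT; have := lebesgue_measure_itv `]a, b]; rewrite /= => ->.
rewrite EFinM; congr (_ * _)%E.
rewrite lte_fin; case: ltP => ab; first by rewrite -EFinB max_l// subr_ge0 ltW.
by rewrite max_r// subr_le0.
Qed.

(* Integrating out one coordinate at a time turns a pointwise inequality between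
   indicators of boxes into one between their volumes. *)
Lemma tensor_le n (c : R) (c_ : nat -> R) (a b : nat -> R) (a_ b_ : nat -> nat -> R) :
  0 <= c -> (forall k, 0 <= c_ k) ->
  (forall x : nat -> R,
    (c * \prod_(i < n) \1_(`]a i, b i] : set R) (x i))%:E <=
    \sum_(k <oo) (c_ k * \prod_(i < n) \1_(`]a_ k i, b_ k i] : set R) (x i))%:E)%E ->
  ((c * \prod_(i < n) Num.max (b i - a i) 0)%:E <=
    \sum_(k <oo) (c_ k * \prod_(i < n) Num.max (b_ k i - a_ k i) 0)%:E)%E.
Proof.
elim: n c c_ => [|n IH] c c_ c0 ck0 H.
  have := H (fun=> 0); rewrite !big_ord0 => /le_trans; apply.
  by apply: lee_nneseries => // k _; rewrite ?lee_fin !big_ord0// mulr1.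
have P0 (u v : nat -> R) : 0 <= \prod_(i < n) Num.max (v i - u i) 0.
  by apply: prodr_ge0 => i _; rewrite le_max lexx orbT.
(* With the last coordinate fixed at [t], its indicators are constants that join the coefficients,
   and the induction hypothesis applies. *)
have Ht (t : R) : ((c * \prod_(i < n) Num.max (b i - a i) 0 * \1_(`]a n, b n] : set R) t)%:E <=
    \sum_(k <oo) (c_ k * \prod_(i < n) Num.max (b_ k i - a_ k i) 0 * \1_(`]a_ k n, b_ k n] : set R) t)%:E)%E.
  rewrite mulrAC.
  apply: (@le_trans _ _ (\sum_(k <oo) (c_ k * I (a_ k n) (b_ k n) t * \prod_(i < n) Num.max (b_ k i - a_ k i) 0)%:E)%E); last first.
    by apply: lee_nneseries => [k _|k _]; rewrite lee_fin ?mulr_ge0// mulrAC.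
  apply: IH.
  - by rewrite mulr_ge0.
  - by move=> k; rewrite mulr_ge0.
  - move=> x; have := H (fun i => if i == n then t else x i).
    rewrite big_ord_recr/= eqxx.
    have E (u v : nat -> R) : \prod_(i < n) \1_(`]u i, v i] : set R) (if i == n :> nat then t else x i)
        = \prod_(i < n) \1_(`]u i, v i] : set R) (x i).
      by apply: eq_bigr => i _; rewrite ltn_eqF.
    rewrite E mulrA mulrAC => /le_trans; apply.
    by apply: lee_nneseries => [k _|k _]; rewrite lee_fin ?mulr_ge0 ?prodr_ge0// big_ord_recr/= eqxx E mulrA mulrAC.
rewrite big_ord_recr/= mulrA -integral_indic_oc ?mulr_ge0//.
apply: (@le_trans _ _ (\int[lebesgue_measure]_t \sum_(k <oo) (c_ k * \prod_(i < n) Num.max (b_ k i - a_ k i) 0 * \1_(`]a_ k n, b_ k n] : set R) t)%:E)%E).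
  apply: ge0_le_integral => //.
  - by move=> x _; rewrite lee_fin !mulr_ge0.
  - by apply/measurable_EFinP/measurable_funM => //; exact: measurable_indic.
  - by apply: ge0_emeasurable_sum => [k x _ _|k _]; rewrite ?lee_fin ?mulr_ge0//; apply/measurable_EFinP/measurable_funM => //; exact: measurable_indic.
rewrite integral_nneseries//; last 2 first.
- by move=> k; apply/measurable_EFinP/measurable_funM => //; exact: measurable_indic.
- by move=> k x _; rewrite lee_fin !mulr_ge0.
apply: lee_nneseries => [k _|k _]; rewrite integral_indic_oc ?mulr_ge0//.
- by rewrite lee_fin !mulr_ge0// le_max lexx orbT.
- by rewrite big_ord_recr/= mulrA.
Qed.

End box_measure.

Section lebesgue_space.
Context {R : realType} {n : nat}.
Local Notation T := (lebesgue_rV R n).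
Local Notation mu := (mu_rV R n).
Implicit Types (a b c x y : 'rV[R]_n) (A U : set T).

(** [tensor_le] inducts on the dimension, so its coordinates are indexed by [nat]; a corner is
    padded with 0 beyond [n]. *)
Let ext a (i : nat) : R := oapp (fun j => a 0 j) 0 (insub i).

Let extE a (i : 'I_n) : ext a i = a 0 i.
Proof. by rewrite /ext valK. Qed.

(** The box covers itself. Conversely, a cover bounds the indicator of the box by the sum of the
    indicators of the covering boxes, and [tensor_le] integrates this; no compactness argument is
    involved. *)
Lemma mu_box a b : mu (box (Some (a, b))) = box_vol (Some (a, b)).
Proof.
apply/eqP; rewrite eq_le; apply/andP; split.
  apply: ereal_inf_lbound; exists (fun k => if k == 0%N then Some (a, b) else None).
    by move=> x abx; exists 0%N.
  rewrite (@nneseriesD1 _ _ 0%N)//=; last by move=> k _; exact: box_vol_ge0.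
  by rewrite eseries0 ?adde0// => k _ /=; case: k.
apply: le_ereal_inf_tmp => _ [F covF <-].
(* Empty boxes of the cover get the coefficient 0 and dummy corners. *)
pose lo k := if F k is Some ab then ext ab.1 else ext a.
pose hi k := if F k is Some ab then ext ab.2 else ext a.
pose ck k : R := (isSome (F k))%:R.
have volE k : box_vol (F k) = (ck k * \prod_(i < n) Num.max (hi k i - lo k i) 0)%:E.
  rewrite /ck /hi /lo; case: (F k) => [[u v]|]/=; rewrite ?mul0r// mul1r.
  by congr EFin; apply: eq_bigr => i _; rewrite !extE.
under eq_eseriesr do rewrite volE.
rewrite [leLHS](_ : _ = (1 * \prod_(i < n) Num.max (ext b i - ext a i) 0)%:E); last first.
  by rewrite mul1r/=; congr EFin; apply: eq_bigr => i _; rewrite !extE.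
apply: tensor_le => // x.
pose z : 'rV[R]_n := \row_i x i.
have indE (u v : nat -> R) : \prod_(i < n) \1_(`]u i, v i] : set R) (x i) =
    [forall i : 'I_n, u i < x i <= v i]%:R :> R.
  case: (boolP [forall i : 'I_n, _]) => [/forallP H|/forallPn[i Hi]].
    by apply: big1 => i _; rewrite indicE mem_set//= in_itv/=; exact: H.
  rewrite (bigD1 i)//= indicE memNset ?mul0r//= in_itv/=; exact/negP.
have [zab|zNab] := pselect (box (Some (a, b)) z); last first.
  rewrite indE (_ : [forall _, _] = false); last first.
    apply/negbTE/negP => /forallP H; apply: zNab => i; rewrite mxE.
    by have := H i; rewrite !extE.
  rewrite mulr0; apply: nneseries_ge0 => k _ _.
  by rewrite lee_fin indE mulr_ge0// ler0n.
have [k _ Fkz] := covF z zab.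
apply: le_trans (nneseries_lim_ge k.+1 _); last first.
  by move=> j _; rewrite lee_fin indE mulr_ge0// ler0n.
rewrite big_nat_recr//=; apply: le_trans (leeDr _ _); last first.
  by apply: sume_ge0 => j _; rewrite lee_fin indE mulr_ge0// ler0n.
rewrite lee_fin !indE /ck /lo /hi; move: Fkz; case: (F k) => [[u v]|]//= zuv.
rewrite [X in _ <= _ * X%:R](_ : _ = 1%N); last first.
  by apply/eqP; rewrite eqb1; apply/forallP => i; have := zuv i; rewrite !extE mxE.
by rewrite ler_pM// ?ler0n// lern1 leq_b1.
Qed.

(** Caratheodory's criterion: each box of a cover is cut along the hyperplane into two boxes whose
    volumes add up. *)
Lemma measurable_halfspace (i : 'I_n) (t : R) : measurable ([set x | x 0 i <= t] : set T).
Proof.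
apply: le_caratheodory_measurable => X /=.
apply: le_ereal_inf_tmp => _ [F covF <-].
pose set_at (a : 'rV[R]_n) s : 'rV[R]_n := \row_j (if j == i then s else a 0 j).
pose F1 k := if F k is Some ab then Some (ab.1, set_at ab.2 (Num.min (ab.2 0 i) t)) else None.
pose F2 k := if F k is Some ab then Some (set_at ab.1 (Num.max (ab.1 0 i) t), ab.2) else None.
rewrite (_ : \sum_(k <oo) box_vol (F k) = \sum_(k <oo) (box_vol (F1 k) + box_vol (F2 k)))%E; last first.
  apply: eq_eseriesr => k _; rewrite /F1 /F2; case: (F k) => [[u v]|]/=; last by rewrite adde0.
  rewrite -EFinD; congr EFin.
  rewrite (bigD1 i)//= [in RHS](bigD1 i)//= [X in _ = _ + X](bigD1 i)//=.
  rewrite !mxE eqxx.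
  rewrite [in RHS](eq_bigr (fun j => Num.max (v 0 j - u 0 j) 0)); last first.
    by move=> j ji; rewrite mxE (negbTE ji).
  rewrite [X in _ = _ + _ * X](eq_bigr (fun j => Num.max (v 0 j - u 0 j) 0)); last first.
    by move=> j ji; rewrite mxE (negbTE ji).
  rewrite -mulrDl; congr (_ * _).
  rewrite /Num.max /Num.min; repeat case: ifPn; rewrite -?leNgt; lra.
rewrite nneseriesD; last 2 first.
- by move=> k _ _; exact: box_vol_ge0.
- by move=> k _ _; exact: box_vol_ge0.
apply: leeD; apply: ereal_inf_lbound.
  exists F1 => // x [Xx /= xt]; have [k _ Fkx] := covF _ Xx; exists k => //.
  rewrite /F1; move: Fkx; case: (F k) => [[u v]|]//= uvx j.
  by rewrite mxE; case: eqP => [->|_]; rewrite ?le_min ?xt ?andbT; exact: uvx.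
exists F2 => // x [Xx /= /negP]; rewrite -ltNge => xt; have [k _ Fkx] := covF _ Xx; exists k => //.
rewrite /F2; move: Fkx; case: (F k) => [[u v]|]//= uvx j.
by rewrite mxE; case: eqP => [->|_]; rewrite ?gt_max ?xt ?andbT; exact: uvx.
Qed.

Lemma measurable_coord (i : 'I_n) : measurable_fun (setT : set T) (fun x : T => x 0 i : R).
Proof.
apply: (measurability _ (RGenOInfty.measurableE R)) => //= _ [_ [t ->] <-].
rewrite setTI.
suff -> : ((fun x : T => x 0 i) @^-1` `]t, +oo[) = ~` ([set x | x 0 i <= t] : set T).
  by apply: measurableC; exact: measurable_halfspace.
by apply/seteqP; split => x /=; rewrite in_itv/= andbT ltNge => /negP.
Qed.

Lemma measurable_forall (P : 'I_n -> set T) : (forall i, measurable (P i)) ->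
  measurable ([set x | forall i, P i x] : set T).
Proof.
move=> mP; rewrite (_ : [set x | _] = \bigcap_(i in [set: 'I_n]) P i).
  by apply: fin_bigcap_measurable.
by apply/seteqP; split => x H i //=; exact: H.
Qed.

End lebesgue_space.

Section dyadic.
Context {R : realType} {n : nat}.
Local Notation T := (lebesgue_rV R n).
Local Notation mu := (mu_rV R n).
Implicit Types (a b c x y : 'rV[R]_n) (A U : set T).

(* [Num.ceil] makes the dyadic cubes left-open and right-closed, as [box] is. *)
Definition dyad_idx (k : nat) x : 'rV[int]_n := \row_i Num.ceil (2 ^+ k * x 0 i).

Definition dyad k x : set T := [set y | dyad_idx k y = dyad_idx k x].

Lemma dyad_refl k x : dyad k x x. Proof. by []. Qed.

Lemma dyad_eq k x y : dyad k x y -> dyad k y = dyad k x.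
Proof. by rewrite /dyad /= => ->. Qed.

(** [ceil (2^k s) <= m] is equivalent to [ceil (2^(k+1) s) <= 2 m], so the index at level [k.+1]
    determines the index at level [k]. *)
Lemma dyadS k x : dyad k.+1 x `<=` dyad k x.
Proof.
move=> y /= /matrixP H; apply/matrixP => i j; have := H i j; rewrite !mxE => {}H.
suff P m : (Num.ceil (2 ^+ k * y 0 j) <= m) = (Num.ceil (2 ^+ k * x 0 j) <= m).
  by apply/eqP; rewrite eq_le P lexx/= -P.
have Q (s : R) : (Num.ceil (2 ^+ k * s) <= m) = (Num.ceil (2 ^+ k.+1 * s) <= 2 * m).
  by rewrite !ceil_le_int exprS -mulrA rmorphM/= ler_pM2l.
by rewrite !Q H.
Qed.

Lemma dyad_le j k x : (j <= k)%N -> dyad k x `<=` dyad j x.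
Proof.
move=> /subnK <-; elim: (k - j)%N => [|i IH]//.
by rewrite addSn; exact: subset_trans (@dyadS _ _) IH.
Qed.

Let lo k x : 'rV[R]_n := \row_i (((dyad_idx k x 0 i)%:~R - 1) / 2 ^+ k).
Let hi k x : 'rV[R]_n := \row_i ((dyad_idx k x 0 i)%:~R / 2 ^+ k).

Lemma dyad_box k x : dyad k x = box (Some (lo k x, hi k x)).
Proof.
apply/seteqP; split => y /=.
  move=> /matrixP H i; rewrite !mxE; have := H 0 i; rewrite !mxE => <-.
  rewrite ltr_pdivrMr ?ler_pdivlMr ?exprn_gt0// ![y 0 i * _]mulrC.
  by have := ceil_itv (2 ^+ k * y 0 i); rewrite intrD.
move=> H; apply/matrixP => j i; have := H i; rewrite !mxE.
rewrite ltr_pdivrMr ?ler_pdivlMr ?exprn_gt0// ![y 0 i * _]mulrC => h.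
by apply/eqP; rewrite ceil_eq intrD.
Qed.

Lemma measurable_box B : measurable (box B : set T).
Proof.
case: B => [[a b]|]//=.
apply: (@measurable_forall _ _ (fun i => [set x : T | a 0 i < x 0 i <= b 0 i])) => i.
rewrite (_ : [set _ | _] = (fun x : T => x 0 i) @^-1` `]a 0 i, b 0 i]).
  by rewrite -[X in measurable X]setTI; apply: measurable_coord.
by apply/seteqP; split => x /=; rewrite in_itv.
Qed.

Lemma measurable_dyad k x : measurable (dyad k x).
Proof. by rewrite dyad_box; exact: measurable_box. Qed.

Lemma mu_dyad k x : mu (dyad k x) = ((2 ^- k) ^+ n)%:E.
Proof.
rewrite dyad_box mu_box/=; congr EFin.
rewrite -[X in _ ^+ X]card_ord -prodr_const; apply: eq_bigr => i _.
by rewrite !mxE -mulrBl opprB addrC subrK mul1r max_l.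
Qed.

Lemma dyad_dist k x y i : dyad k x y -> `|y 0 i - x 0 i| < 2 ^- k.
Proof.
move=> xy; have := dyad_refl k x; move: xy; rewrite {1 2}dyad_box => /(_ i) + /(_ i).
rewrite !mxE; set m := (_%:~R : R).
have -> : (m - 1) / 2 ^+ k = m / 2 ^+ k - 2 ^- k by rewrite mulrBl mul1r.
move: (m / _) => z; rewrite ltr_norml; lra.
Qed.

Lemma open_cube (U : set 'rV[R]_n) x : open U -> U x ->
  exists2 h, 0 < h & cube x h `<=` U.
Proof.
move=> oU Ux; have : nbhs x U by apply: open_nbhs_nbhs.
move=> /nbhs_ballP[h /= h0 hU]; exists h => // y xy; apply: hU; split => // i j.
by rewrite ord1 /ball/= distrC; exact: xy.
Qed.

Lemma cube_open (U : set 'rV[R]_n) :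
  (forall x, U x -> exists2 h, 0 < h & cube x h `<=` U) -> open U.
Proof.
move=> H; rewrite openE => x /H[h h0 hU]; apply/nbhs_ballP; exists h => //=.
move=> y [_ xy]; apply: hU => i; have := xy 0 i; rewrite /ball/= distrC; exact.
Qed.

Lemma open_dyad (U : set 'rV[R]_n) x k : open U -> U x ->
  exists2 j, (k <= j)%N & dyad j x `<=` U.
Proof.
move=> oU /(open_cube oU)[h h0 hU].
have [j jh] : exists j, 2 ^- j < h.
  exists (Num.bound h^-1); rewrite invf_plt ?posrE ?exprn_gt0//.
  apply: (lt_trans (archi_boundP _)); first by rewrite invr_ge0 ltW.
  by rewrite -natrX ltr_nat ltn_expl.
exists (maxn k j); first exact: leq_maxl.
move=> y /(dyad_le (leq_maxr k j)) xy; apply: hU => i.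
exact: lt_trans (dyad_dist i xy) jh.
Qed.

(** An open set is the union of the dyadic cubes inside it, and the pairs of a level and an index
    are countable. *)
Lemma measurable_open (U : set 'rV[R]_n) : open U -> measurable (U : set T).
Proof.
move=> oU.
rewrite (_ : (U : set T) = \bigcup_(i : nat * 'rV[int]_n)
    [set x : T | dyad_idx i.1 x = i.2 /\ dyad i.1 x `<=` U]).
  apply: countable_bigcupT_measurable => //= -[k m]/=.
  have [[x [<- xU]]|h] := pselect (exists x, dyad_idx k x = m /\ dyad k x `<=` U).
    rewrite (_ : [set _ | _] = dyad k x); first exact: measurable_dyad.
    by apply/seteqP; split => [y [//]|y xy]/=; rewrite (dyad_eq xy).
  rewrite (_ : [set _ | _] = set0)//; apply/seteqP; split => // y yP.
  by apply: h; exists y.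
apply/seteqP; split => [x Ux|x [i _ [_ ]]]; last by apply.
have [j _ jU] := open_dyad 0 oU Ux.
by exists (j, dyad_idx j x).
Qed.

Lemma cube_is_open c h : open (cube c h).
Proof.
apply: cube_open => x xc.
(* The minimum below needs a coordinate to start from; for [n = 0] the cube is the whole space. *)
case: (posnP n) => [n0|n0].
  by exists 1 => // y _ i; have := ltn_ord i; rewrite [X in (_ < X)%N]n0.
pose i0 := Ordinal n0.
exists (\big[Num.min/(h - `|x 0 i0 - c 0 i0|)]_(i < n) (h - `|x 0 i - c 0 i|)).
  by apply: lt_bigmin => [|i _]; rewrite subr_gt0.
move=> y yx i; have yi := lt_le_trans (yx i) (bigmin_le _ i _); rewrite (_ : y 0 i - c 0 i = (y 0 i - x 0 i) + (x 0 i - c 0 i)); last by ring.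
by apply: le_lt_trans (ler_normD _ _) _; rewrite -ltrBrDr.
Qed.

Lemma measurable_cube c h : measurable (cube c h : set T).
Proof. exact/measurable_open/cube_is_open. Qed.

(** Lower semicontinuity is enough, since open upper rays generate the Borel sets. *)
Lemma measurable_continuous (f : 'rV[R]_n -> R) : (forall t : R, open [set x | t < f x]) ->
  measurable_fun (setT : set T) (f : T -> R).
Proof.
move=> cf; apply: (measurability _ (RGenOInfty.measurableE R)) => //= _ [_ [t ->] <-].
rewrite setTI; suff -> : f @^-1` `]t, +oo[ = [set x | t < f x] by exact: measurable_open.
by apply/seteqP; split => x /=; rewrite in_itv/= andbT.
Qed.

(** The open cube lies between half-open boxes of half-sides [e * h] and [h], with [e < 1] as close
    to 1 as desired. *)
Lemma mu_cube c h : 0 < h -> mu (cube c h) = ((2 * h) ^+ n)%:E.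
Proof.
move=> h0.
have boxE (e : R) : 0 < e ->
    mu (box (Some (c - const_mx e, c + const_mx e))) = ((2 * e) ^+ n)%:E.
  move=> e0; rewrite mu_box/=; congr EFin.
  rewrite -[X in _ ^+ X]card_ord -prodr_const; apply: eq_bigr => i _.
  by rewrite !mxE max_l; [ring|lra].
apply/eqP; rewrite eq_le; apply/andP; split.
  rewrite -boxE//; apply: le_measure; rewrite ?inE.
  - exact: measurable_cube.
  - exact: measurable_box.
  by move=> x H i; have := H i; rewrite !mxE ltr_norml; lra.
apply/lee_mul01Pr; first by rewrite lee_fin exprn_ge0 ?mulr_ge0 ?ltW.
move=> r /andP[r0 r1].
have [e /andP[e0 e1] eB] : exists2 e : R, 0 < e < 1 & r <= e ^+ n.
  (* Bernoulli's inequality; for the [t] chosen below, [(1 - t)^n >= 1 - n t >= r]. *)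
  have B m (t : R) : 0 <= t <= 1 -> 1 - m%:R * t <= (1 - t) ^+ m.
    move=> t01; elim: m => [|m IH]; first by rewrite mul0r subr0 expr0.
    have t1 : 0 <= 1 - t by lra.
    rewrite exprS; apply: le_trans (ler_wpM2l t1 IH).
    have : 0 <= m%:R * (t * t) by rewrite mulr_ge0// mulr_ge0//; lra.
    rewrite -natr1; lra.
  pose t := (1 - r) / n.+1%:R.
  have t0 : 0 < t by rewrite divr_gt0// subr_gt0.
  have nt : n.+1%:R * t = 1 - r by rewrite mulrC divfK.
  have t1 : t < 1 by rewrite ltr_pdivrMr// mul1r -natr1; have := ler0n R n; lra.
  exists (1 - t); first lra.
  apply: le_trans (B n t _); last lra.
  by move: nt; rewrite -natr1; lra.
rewrite -EFinM; apply: (@le_trans _ _ ((2 * (e * h)) ^+ n)%:E).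
  by rewrite lee_fin [2 * (e * h)]mulrCA [(e * _) ^+ n]exprMn ler_wpM2r// exprn_ge0//; lra.
rewrite -boxE ?mulr_gt0//; apply: le_measure; rewrite ?inE.
- exact: measurable_box.
- exact: measurable_cube.
move=> x H i; have := H i; rewrite !mxE ltr_norml.
suff : e * h < h by lra.
by rewrite gtr_pMl.
Qed.

End dyadic.

(** * Outer regularity of Lebesgue measure *)

Section outer_regularity.
Context {R : realType} {n : nat}.
Local Notation T := (lebesgue_rV R n).
Local Notation mu := (mu_rV R n).
Implicit Types (a b c x y : 'rV[R]_n) (A U : set T) (Q : nat -> set T -> Prop).

Lemma open_forall (P : 'I_n -> set 'rV[R]_n) : (forall i, open (P i)) ->
  open [set x | forall i, P i x].
Proof.
move=> oP; rewrite openE => x /= Px.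
have /filter_forall : forall i, nbhs x (P i) by move=> i; apply: open_nbhs_nbhs.
by apply.
Qed.

(** The half-open box is the decreasing intersection of the boxes whose upper corner is raised by
    [1 / (m + 1)]; continuity from above makes one of them small enough, and the corresponding open
    box fits in between. *)
Lemma open_box_cover B (e : R) : 0 < e ->
  exists U : set 'rV[R]_n, [/\ open U, box B `<=` U & (mu U <= box_vol B + e%:E)%E].
Proof.
move=> e0; case: B => [[a b]|]; last first.
  exists set0; split; [exact: open0|by []|].
  by rewrite measure0/= add0e lee_fin ltW.
pose F m : set T := box (Some (a, b + const_mx m.+1%:R^-1)).
have FE : \bigcap_m F m = box (Some (a, b)).
  apply/seteqP; split => x /= xF i.
    have := xF 0%N I i; rewrite !mxE => /andP[-> _]/=.
    apply/ler_addgt0Pr => d d0.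
    have := xF (Num.bound d^-1) I i; rewrite !mxE => /andP[_] /le_trans; apply.
    rewrite lerD2l invf_ple ?posrE//; apply: (le_trans (ltW (archi_boundP _))).
      by rewrite invr_ge0 ltW.
    by rewrite ler_nat.
  by move=> _ j; have /andP[H1 H2] := xF j; rewrite !mxE H1/= ler_wpDr.
have cv : mu \o F @ \oo --> mu (\bigcap_m F m).
  apply: nonincreasing_cvg_mu.
  - by rewrite /F mu_box ltry.
  - by move=> i; exact: measurable_box.
  - by rewrite FE; exact: measurable_box.
  - move=> i j ij; apply/subsetPset => x xF k.
    have /andP[-> H]/= := xF k; apply: le_trans H _.
    by rewrite !mxE lerD2l lef_pV2 ?posrE// ler_nat.
rewrite FE mu_box in cv.
have [m Fm] : exists m, (mu (F m) <= box_vol (Some (a, b)) + e%:E)%E.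
  apply: contrapT => /forallNP H.
  have /(lime_ge (cvgP _ cv)) :
      \forall m \near \oo, (box_vol (Some (a, b)) + e%:E <= (mu \o F) m)%E.
    by exists 0%N => // m _; apply/ltW; rewrite ltNge; apply/negP; exact: H.
  rewrite (cvg_lim _ cv)//=.
  by rewrite -EFinD lee_fin gerDl leNgt e0.
exists [set x | forall i, a 0 i < x 0 i < b 0 i + m.+1%:R^-1]; split.
- apply: (@open_forall (fun i => [set x : 'rV[R]_n | a 0 i < x 0 i < b 0 i + m.+1%:R^-1])) => i.
  rewrite (_ : [set x | _] = (fun x : 'rV[R]_n => x 0 i) @^-1` `]a 0 i, b 0 i + m.+1%:R^-1[).
    by apply: open_comp; [move=> x _; exact: coord_continuous|exact: interval_open].
  by apply/seteqP; split => x /=; rewrite in_itv.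
- move=> x xB i; have /andP[-> /le_lt_trans] := xB i; apply.
  by rewrite ltrDl.
- apply: le_trans Fm; apply: le_outer_measure => x xB i.
  by have /andP[-> /ltW] := xB i; rewrite !mxE.
Qed.

(** As [mu] is the outer measure itself, [A] can be an arbitrary set. Half of [e] goes to a nearly
    optimal box cover, the other half to opening its boxes by a geometric series of errors. *)
Lemma outer_open A (e : R) : 0 < e ->
  exists U : set 'rV[R]_n, [/\ open U, A `<=` U & (mu U <= mu A + e%:E)%E].
Proof.
move=> e0; have [Aoo|Afin] := eqVneq (mu A) +oo%E.
  by exists setT; split => //; [exact: openT|rewrite Aoo addye// leey].
have e20 : 0 < e / 2 by rewrite divr_gt0.
have Af : mu A \is a fin_num by rewrite ge0_fin_numE ?lebesgue_outer_ge0// ltey.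
have [_ [F AF <-] Flt] := lb_ereal_inf_adherent e20 Af.
have [G PG] : {G : nat -> set 'rV[R]_n & forall k, [/\ open (G k), box (F k) `<=` G k &
    (mu (G k) <= box_vol (F k) + (e / 2 / (2 ^ k.+1)%:R)%:E)%E]}.
  apply: (@choice _ _ (fun k (G : set 'rV[R]_n) => [/\ open G, box (F k) `<=` G &
    (mu G <= box_vol (F k) + (e / 2 / (2 ^ k.+1)%:R)%:E)%E])) => k.
  by apply: open_box_cover; rewrite !divr_gt0// ltr0n expn_gt0.
exists (\bigcup_k G k); split.
- by apply: bigcup_open => k _; case: (PG k).
- move=> x /AF[k _ Fx]; exists k => //; case: (PG k) => _ + _; exact.
- apply: le_trans (outer_measure_sigma_subadditive _ _) _ => /=.
  apply: (@le_trans _ _ (\sum_(k <oo) (box_vol (F k) + (e / 2 / (2 ^ k.+1)%:R)%:E))%E).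
    apply: lee_nneseries => [k *|k *]; first exact: outer_measure_ge0.
    by case: (PG k).
  apply: le_trans (epsilon_trick _ _ _) _; [by move=> k; exact: box_vol_ge0|exact: ltW|].
  have -> : (e%:E = (e / 2)%:E + (e / 2)%:E)%E by rewrite -EFinD -splitr.
  by rewrite addeA leeD2r// ltW.
Qed.

Lemma mu_sigma_finite : sigma_finite setT (mu : set T -> \bar R).
Proof.
exists (fun k => cube 0 k.+1%:R).
  apply/seteqP; split => // x _; exists (\max_(i < n) Num.bound `|x 0%R i|%R) => // i.
  rewrite mxE subr0; apply: (@le_lt_trans _ _ (\max_(i < n) Num.bound `|x 0%R i|%R)%N%:R); last by rewrite ltr_nat.
  apply: le_trans (ltW (archi_boundP (normr_ge0 _))) _.
  by rewrite ler_nat; exact: leq_bigmax.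
move=> k; split; first exact: measurable_cube.
by rewrite mu_cube ?ltr0n// ltry.
Qed.

(* Tonelli's theorem needs a measure that carries a sigma-finite structure. *)
HB.instance Definition _ := Measure.on (mu : set T -> \bar R).
HB.instance Definition _ := Measure_isSigmaFinite.Build _ _ _ (mu : set T -> \bar R) mu_sigma_finite.

Definition leb_rV : {sigma_finite_measure set T -> \bar R} := (mu : set T -> \bar R).

Lemma integral_leb_rV A f : (\int[leb_rV]_(x in A) f x = \int[mu]_(x in A) f x)%E.
Proof. by []. Qed.

End outer_regularity.

(** * Stopping rules on dyadic cubes *)

Section stopping_cubes.
Context {R : realType} {n : nat}.
Local Notation T := (lebesgue_rV R n).
Local Notation mu := (mu_rV R n).
Implicit Types (a b c x y : 'rV[R]_n) (A U : set T) (Q : nat -> set T -> Prop).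

(* [Q j D] is a stopping rule for the dyadic cubes [D] of side [2 ^- j]; the
   cubes [dyad j x] with [first_stop Q j x] are the maximal ones satisfying it,
   and they partition [stops Q]. *)
Definition stops Q : set T := [set x | exists j, Q j (dyad j x)].

Definition first_stop Q j x :=
  Q j (dyad j x) /\ forall i, (i < j)%N -> ~ Q i (dyad i x).

Lemma first_stopP Q x : stops Q x -> exists j, first_stop Q j x.
Proof.
move=> [j Qj]; have ex : exists j, `[< Q j (dyad j x) >] by exists j; apply/asboolP.
exists (ex_minn ex); case: ex_minnP => m /asboolP Qm min_m; split => // i im Qi.
by have := min_m i (introT (asboolP _) Qi); rewrite leqNgt im.
Qed.

Lemma first_stop_uniq Q x i j : first_stop Q i x -> first_stop Q j x -> i = j.
Proof.
move=> [Qi Ni] [Qj Nj]; case: (ltngtP i j) => // [ij|ji].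
  by case: (Nj _ ij).
by case: (Ni _ ji).
Qed.

Lemma first_stop_dyad Q x y j : first_stop Q j x -> dyad j x y -> first_stop Q j y.
Proof.
move=> [Qj Nj] xy; split => [|i ij]; first by rewrite (dyad_eq xy).
by rewrite (dyad_eq (dyad_le (ltnW ij) xy)); exact: Nj.
Qed.

(** Numbers the maximal cubes through the codes of the pairs of a level and an index; the other
    numbers get the empty set. *)
Let piece Q (i : nat) : set T :=
  if pickle_inv i is Some (j, m)
  then [set x | first_stop Q j x /\ dyad_idx j x = m :> 'rV[int]_n] else set0.

Let pieceE Q i x : piece Q i x -> exists j, first_stop Q j x /\ piece Q i = dyad j x.
Proof.
rewrite /piece; case: pickle_inv => [[j m]|]//= [Qx <-]; exists j; split => //.
apply/seteqP; split => [y [_]//|y xy]; split => //.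
exact: first_stop_dyad Qx xy.
Qed.

Let bigcup_piece Q : stops Q = \bigcup_i piece Q i.
Proof.
apply/seteqP; split => [x /first_stopP[j Qx]|x [i _ /pieceE[j [[Qx _] _]]]]; last by exists j.
by exists (pickle (j, dyad_idx j x)) => //; rewrite /piece pickleK_inv.
Qed.

Let trivIset_piece Q : trivIset setT (piece Q).
Proof.
move=> i1 i2 _ _ [x []]; rewrite /piece.
have := @pickle_invK (nat * 'rV[int]_n)%type i1.
have := @pickle_invK (nat * 'rV[int]_n)%type i2.
case: (pickle_inv i1) => [[j1 m1]|]//=; case: (pickle_inv i2) => [[j2 m2]|]//=.
by move=> <- <- [/first_stop_uniq E <-] [/E -> <-].
Qed.

Let measurable_piece Q i : measurable (piece Q i).
Proof.
have [[x /pieceE[j [_ ->]]]|H] := pselect (exists x, piece Q i x); first exact: measurable_dyad.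
rewrite (_ : piece Q i = set0)//; apply/seteqP; split => // x xQ; by apply: H; exists x.
Qed.

Lemma measurable_stops Q : measurable (stops Q).
Proof. by rewrite bigcup_piece; exact: bigcup_measurable. Qed.

(** The maximal cubes form a countable measurable partition, so an inequality between integrals on
    each of them sums up. This is the passage from local to global in the density lemma, in the
    good-lambda inequality and for Whitney cubes. *)
Lemma stops_compare Q (g1 g2 : T -> \bar R) :
  measurable_fun (stops Q) g1 -> measurable_fun (stops Q) g2 ->
  (forall x, stops Q x -> 0 <= g1 x)%E -> (forall x, stops Q x -> 0 <= g2 x)%E ->
  (forall j x, first_stop Q j x ->
    \int[mu]_(y in dyad j x) g1 y <= \int[mu]_(y in dyad j x) g2 y)%E ->
  (\int[mu]_(x in stops Q) g1 x <= \int[mu]_(x in stops Q) g2 x)%E.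
Proof.
rewrite bigcup_piece => m1 m2 p1 p2 H.
rewrite !ge0_integral_bigcup//.
apply: lee_nneseries => [i *|i *].
  by apply: integral_ge0 => x ix; apply: p1; exists i.
have [[x /pieceE[j [Qx ->]]]|h] := pselect (exists x, piece Q i x); first exact: H.
rewrite (_ : piece Q i = set0) ?integral_set0//; apply/seteqP; split => // x xQ; by apply: h; exists x.
Qed.

(* Lebesgue density in dyadic form: outside the cubes on which the mean of [u]
   exceeds [lam], [u] itself is at most [lam] up to a null set. *)
Lemma dyadic_density (P A : set T) k (u : T -> \bar R) (lam : R) :
  measurable P -> measurable A -> A `<=` P ->
  measurable_fun P u -> (forall x, P x -> 0 <= u x)%E -> 0 <= lam ->
  (mu P < +oo)%E ->
  (forall x, A x -> dyad k x `<=` P) ->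
  (forall x, A x -> lam%:E < u x)%E ->
  (forall x j, A x -> (k <= j)%N -> \int[mu]_(y in dyad j x) u y <= lam%:E * mu (dyad j x))%E ->
  mu A = 0%E.
Proof.
move=> mP mA AP mu_ u0 lam0 Pfin AkP Au Aavg.
(* It suffices to treat the points where [u] exceeds [lam] by a fixed amount. *)
pose N m := A `&` [set x | ((lam + m.+1%:R^-1)%:E <= u x)%E].
have mN m : measurable (N m).
  rewrite /N -(setIidl AP) -setIA; apply: measurableI => //.
  exact: emeasurable_fun_c_infty.
suff N0 m : mu (N m) = 0%E.
  apply/eqP; rewrite eq_le measure_ge0 andbT.
  have AN : A `<=` \bigcup_m N m.
    move=> x Ax; have := Au x Ax.
    have : (0 <= u x)%E by apply/u0/AP.
    case ux : (u x) => [r| |]// _; last by exists 0%N => //; split => //=; rewrite ux leey.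
    rewrite lte_fin => lr; exists (Num.bound (r - lam)^-1) => //; split => //=.
    rewrite ux lee_fin -lerBrDl invf_ple ?posrE ?subr_gt0//.
    apply: (le_trans (ltW (archi_boundP _))); first by rewrite invr_ge0 subr_ge0 ltW.
    by rewrite ler_nat.
  apply: le_trans (measure_sigma_subadditive _ mN mA AN) _.
  by rewrite eseries0// => i *; exact: N0.
have Nfin : (mu (N m) < +oo)%E.
  apply: le_lt_trans Pfin; apply: le_measure; rewrite ?inE//.
  by move=> x [/AP].
have Nf : mu (N m) \is a fin_num by rewrite ge0_fin_numE.
set e : R := m.+1%:R^-1; have e0 : 0 < e by rewrite invr_gt0.
have key (d : R) : 0 < d -> ((lam + e)%:E * mu (N m) <= lam%:E * (mu (N m) + d%:E))%E.
  move=> d0; have [U [oU NU muU]] := outer_open (N m) d0.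
  (* [N m] is covered by the maximal cubes inside [U] that meet it. Each contains a point of [A], so
     the mean of [u] on it is at most [lam], and together they have measure at most [mu U]. *)
  pose Q j (D : set T) := [/\ (k <= j)%N, D `<=` U & exists y, N m y /\ D y].
  have QP : stops Q `<=` P.
    move=> x [j [kj DU [y [[Ay _] xy]]]]; apply: (AkP _ Ay).
    by rewrite (dyad_eq (dyad_le kj xy)); exact: dyad_refl.
  have NQ : N m `<=` stops Q.
    move=> x Nx; have [j kj DU] := open_dyad k oU (NU _ Nx).
    by exists j; split => //; exists x.
  have QU : stops Q `<=` U by move=> x [j [_ DU _]]; exact: DU.
  have mQ := measurable_stops Q.
  apply: (@le_trans _ _ (\int[mu]_(x in N m) u x)%E).
    rewrite -integral_cst//; apply: ge0_le_integral => //.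
    - by move=> x _; rewrite lee_fin addr_ge0// ltW.
    - by apply: measurable_funS mu_ => // x [/AP].
    - by move=> x [].
  apply: (@le_trans _ _ (\int[mu]_(x in stops Q) u x)%E).
    apply: ge0_subset_integral => //.
    - exact: measurable_funS mu_.
    - by move=> x /QP; exact: u0.
  apply: (@le_trans _ _ (\int[mu]_(x in stops Q) (cst lam%:E) x)%E).
    apply: stops_compare => //.
    - exact: measurable_funS mu_.
    - by move=> x /QP; exact: u0.
    - move=> j x [[kj _ [y [[Ay _] xy]]] _].
      rewrite -(dyad_eq xy) integral_cst ?Aavg//; exact: measurable_dyad.
  rewrite integral_cst//; apply: lee_wpmul2l; first by rewrite lee_fin.
  apply: le_trans muU; apply: le_outer_measure; exact: QU.
have [r rE] : exists r, mu (N m) = r%:E by exists (fine (mu (N m))); rewrite fineK.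
have r0 : 0 <= r by rewrite -lee_fin -rE.
rewrite rE; congr EFin; apply/eqP; rewrite eq_le r0 andbT leNgt; apply/negP => r1.
(* With this [d], [key] would say [e * r <= lam * d = e * r - d]. *)
set d := e * r / (lam + 1).
have dE : d * (lam + 1) = e * r by rewrite divfK// gt_eqF// ltr_wpDl.
have d0 : 0 < d by rewrite divr_gt0 ?mulr_gt0// ltr_wpDl.
have := key d d0; rewrite rE -EFinD -!EFinM lee_fin; lra.
Qed.

End stopping_cubes.

(** * The dyadic Fefferman-Stein inequality *)

Section deviation.
Context d (T : measurableType d) (R : realType) (mu : {measure set T -> \bar R}).
Implicit Types (D E : set T) (f : T -> R) (c : R).
Local Open Scope ereal_scope.

(** Not divided by the measure of [D], so that it is monotone in [D]. *)
Definition dev D f c : \bar R := \int[mu]_(y in D) `|f y - c|%:E.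

Lemma dev_ge0 D f c : 0 <= dev D f c.
Proof. by apply: integral_ge0 => y _; rewrite lee_fin. Qed.

Lemma measurable_dev D f c : measurable_fun D f ->
  measurable_fun D (fun y => `|f y - c|%:E).
Proof.
by move=> mf; apply/measurable_EFinP; apply: measurableT_comp => //; apply: measurable_funB.
Qed.

Lemma le_dev_sub D E f c : measurable D -> measurable E -> measurable_fun E f ->
  D `<=` E -> dev D f c <= dev E f c.
Proof.
move=> mD mE mf DE; apply: ge0_subset_integral => //.
exact: measurable_dev.
Qed.

Lemma dev_shift D f c c' : measurable D -> measurable_fun D f ->
  dev D f c <= dev D f c' + `|c - c'|%:E * mu D.
Proof.
move=> mD mf; rewrite -integral_cst// -ge0_integralD//; [|exact: measurable_dev|by move=> x _; rewrite lee_fin].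
apply: ge0_le_integral => //.
- exact: measurable_dev.
- by apply: emeasurable_funD; [exact: measurable_dev|exact: measurable_cst].
- move=> x _; rewrite -EFinD lee_fin.
  have -> : (f x - c = (f x - c') - (c - c'))%R by ring.
  exact: ler_normB.
Qed.

Lemma integrable_shift D f c : measurable D -> mu D < +oo ->
  mu.-integrable D (EFin \o f) -> mu.-integrable D (fun x => (f x - c)%:E).
Proof.
move=> mD muD If.
have Ic : mu.-integrable D (EFin \o cst c).
  apply/integrableP; split; first by apply/measurable_EFinP.
  by rewrite [X in X < _](integral_cst _ mD `|c|%:E) lte_mul_pinfty.
exact: (integrableB mD If Ic).
Qed.

Lemma mean_dev D f c (v : R) : measurable D -> mu D = v%:E -> (0 < v)%R ->
  mu.-integrable D (EFin \o f) ->
  (`|v^-1 * \int[mu]_(y in D) f y - c| * v)%:E <= dev D f c.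
Proof.
move=> mD muD v0 If.
have muDoo : mu D < +oo by rewrite muD ltry.
have Ic : mu.-integrable D (EFin \o cst c).
  apply/integrableP; split; first by apply/measurable_EFinP.
  by rewrite [X in X < _](integral_cst _ mD `|c|%:E) lte_mul_pinfty.
have Ifc := integrable_shift c mD muDoo If.
rewrite /dev (_ : (`|v^-1 * _ - c| * v)%R = `|\int[mu]_(y in D) (f y - c)|%R)%R.
  by rewrite EFin_normr_Rintegral// le_abse_integral//; exact: measurable_int Ifc.
rewrite (RintegralB mD If Ic) Rintegral_cst// muD/=.
by rewrite -{2}(gtr0_norm v0) -normrM mulrBl mulrAC mulVf ?mul1r// gt_eqF.
Qed.

End deviation.

Section mean_oscillation.
Context {R : realType} {n : nat}.
Local Notation T := (lebesgue_rV R n).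
Local Notation mu := (mu_rV R n).
Implicit Types (D E : set T) (f : T -> R) (c : R).
Local Open Scope ereal_scope.

Lemma average_dev D f c (v : R) : measurable D -> mu D = v%:E -> (0 < v)%R ->
  mu.-integrable D (EFin \o f) -> (`|average D f - c| * v)%:E <= dev mu D f c.
Proof.
move=> mD muD v0 If; rewrite /average muD; exact: mean_dev.
Qed.

Lemma mean_osc_dev D f (v : R) : mu D = v%:E -> (0 < v)%R ->
  mu.-integrable D (EFin \o f) -> v%:E * mean_osc D f = dev mu D f (average D f).
Proof.
move=> muD v0 If; rewrite /mean_osc asboolT// muD muleA -EFinM mulfV ?gt_eqF//.
exact: mul1e.
Qed.

End mean_oscillation.

Section layers.
Context {R : realType}.

(** Weighted by [q ^+ i], the recursion bounds the sum by terms in [v] and [m] plus [q * g] times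
    the sum itself. As [q * g <= 1/2] and the sum is finite, the last term moves to the left
    side. *)
Lemma absorbed_geometric_sum (q g v : R) (e m : nat -> R) N :
  0 <= q -> 0 <= g -> q * g <= 2^-1 -> (forall i, 0 <= e i) -> e 0%N <= v ->
  (forall i, e i.+1 <= m i + g * e i) ->
  \sum_(i < N.+1) q ^+ i * e i <= 2 * v + 2 * q * \sum_(i < N) q ^+ i * m i.
Proof.
move=> q0 g0 qg e0 ev H.
set S := \sum_(i < N.+1) _; set S' := \sum_(i < N) _.
have SN : \sum_(i < N) q ^+ i * e i <= S.
  by rewrite /S big_ord_recr/= lerDl mulr_ge0// exprn_ge0.
have : S <= v + q * S' + q * g * S.
  rewrite {1}/S big_ord_recl expr0 mul1r -addrA; apply: lerD => //.
  apply: (@le_trans _ _ (q * S' + q * g * \sum_(i < N) q ^+ i * e i)); last first.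
    by rewrite lerD2l ler_wpM2l// mulr_ge0.
  rewrite !mulr_sumr -big_split/=; apply: ler_sum => i _.
  rewrite /bump leq0n add1n exprS.
  have -> : q * (q ^+ i * m i) + q * g * (q ^+ i * e i) = q * q ^+ i * (m i + g * e i) by ring.
  by rewrite ler_wpM2l// mulr_ge0// exprn_ge0.
have S0 : 0 <= S by apply: sumr_ge0 => i _; rewrite mulr_ge0// exprn_ge0.
have : q * g * S <= 2^-1 * S by rewrite ler_wpM2r.
lra.
Qed.

Lemma le_powR (p x y : R) : 0 <= p -> 0 <= x -> x <= y -> x `^ p <= y `^ p.
Proof.
by move=> p0 x0 xy; apply: ge0_ler_powR; rewrite ?nnegrE// (le_trans x0).
Qed.

Lemma powR_expr (A p : R) i : 0 <= A -> (A ^+ i) `^ p = (A `^ p) ^+ i.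
Proof.
by move=> A0; rewrite -powR_mulrn// -powRrM mulrC powRrM powR_mulrn// powR_ge0.
Qed.

Lemma powR_gt1 (A p : R) : 0 < p -> 1 < A -> 1 < A `^ p.
Proof.
move=> p0 A1; have := gt0_ltr_powR p0 (_ : 1 \in Num.nneg) (_ : A \in Num.nneg) A1.
by rewrite powR1 !nnegrE ler01 ltW ?(lt_trans ltr01 A1)//; apply.
Qed.

(** The nonzero terms are those with [A ^+ i * t < x], and a geometric sum is at most [q / (q - 1)]
    times its last term. *)
Lemma geometric_layers (A t p : R) (x : \bar R) N :
  0 < p -> 1 < A -> 0 < t -> (0 <= x)%E ->
  ((\sum_(i < N) (A `^ p) ^+ i * ((A ^+ i * t)%:E < x)%E%:R)%:E <=
    (A `^ p / (A `^ p - 1) / t `^ p)%:E * x `^ p)%E.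
Proof.
move=> p0 A1 t0 x0; have q1 := powR_gt1 p0 A1; set q := A `^ p in q1 *.
have qq : 0 < q / (q - 1) by rewrite divr_gt0//; lra.
have A0 : 0 < A by lra.
have K0 : 0 < q / (q - 1) / t `^ p by rewrite divr_gt0// powR_gt0.
case: x x0 => [x| |]// x0; last by rewrite poweRyr ?gt_eqF// gt0_muley ?lte_fin// leey.
rewrite lee_fin in x0; rewrite poweR_EFin -EFinM lee_fin.
elim: N => [|N IH]; first by rewrite big_ord0 mulr_ge0 ?powR_ge0// ltW.
rewrite big_ord_recr/= lte_fin; case: ltP => [tx|_]; last by rewrite mulr0 addr0.
apply: (@le_trans _ _ (\sum_(i < N.+1) q ^+ i)).
  rewrite big_ord_recr/= mulr1 lerD2r; apply: ler_sum => i _.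
  by rewrite ler_piMr ?exprn_ge0 ?lern1 ?leq_b1//; lra.
have -> : \sum_(i < N.+1) q ^+ i = (q ^+ N.+1 - 1) / (q - 1).
  by rewrite subrX1 mulrAC mulfV ?mul1r// subr_eq0 gt_eqF.
rewrite -[X in _ <= X]mulrA [q / _ * _]mulrAC; apply: ler_pM => //.
- by rewrite subr_ge0 exprn_ege1// ltW.
- by rewrite invr_ge0; lra.
rewrite exprS; apply: (@le_trans _ _ (q * q ^+ N)); first lra.
rewrite ler_wpM2l//; first lra.
have AN0 : 0 <= A ^+ N by rewrite exprn_ge0// ltW.
rewrite mulrC ler_pdivlMr ?powR_gt0// /q -powR_expr ?(ltW A0)// -powRM ?(ltW t0)//.
by rewrite le_powR ?(ltW p0)// ?mulr_ge0 ?exprn_ge0 ?(ltW A0) ?(ltW t0)// ltW.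
Qed.

(** Discrete layer-cake formula: for [x > t], the last [m] with [A ^+ m * t < x] satisfies
    [x <= A ^+ m.+1 * t], and the term of index [m] alone is large enough. *)
Lemma layer_le (A t p x : R) : 0 < p -> 1 < A -> 0 < t -> 0 <= x ->
  ((x `^ p)%:E <= (t `^ p)%:E + \sum_(i <oo)
     (A `^ p * t `^ p * ((A `^ p) ^+ i * (A ^+ i * t < x)%R%:R))%:E)%E.
Proof.
move=> p0 A1 t0 x0; have A0 : 0 < A by lra.
have S0 i : (0 <= (A `^ p * t `^ p * ((A `^ p) ^+ i * (A ^+ i * t < x)%R%:R))%:E)%E.
  by rewrite lee_fin !mulr_ge0 ?exprn_ge0 ?powR_ge0.
have [xt|tx] := leP x t.
  apply: (@le_trans _ _ (t `^ p)%:E); last by rewrite leeDl// nneseries_ge0.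
  by rewrite lee_fin le_powR// ltW.
have ex : exists i, x <= A ^+ i * t.
  exists (Num.bound (x / t / (A - 1))).
  rewrite -ler_pdivrMr//; set b := Num.bound _.
  have B m : m%:R * (A - 1) <= A ^+ m.
    elim: m => [|m IH]; first by rewrite mul0r expr0.
    rewrite exprS -natr1 mulrDl mul1r.
    have : 1 <= A ^+ m by rewrite exprn_ege1// ltW.
    nra.
  apply: le_trans (B b); rewrite -ler_pdivrMr ?subr_gt0//.
  by apply/ltW/archi_boundP; rewrite !divr_ge0//; lra.
have [m xm min_m] := ex_minnP ex.
case: m xm min_m => [|m] xm min_m; first by move: xm; rewrite expr0 mul1r leNgt tx.
have mx : A ^+ m * t < x by rewrite ltNge; apply/negP => /min_m; rewrite ltnn.
apply: (@le_trans _ _ (A `^ p * t `^ p * ((A `^ p) ^+ m * 1))%:E).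
  rewrite mulr1 lee_fin mulrAC -exprS -powR_expr ?(ltW A0)// -powRM ?exprn_ge0 ?(ltW A0) ?(ltW t0)//.
  by rewrite le_powR ?(ltW p0)// ?mulr_ge0 ?exprn_ge0 ?(ltW A0) ?(ltW t0)// ltW.
apply: (@le_trans _ _ (\sum_(i <oo)
     (A `^ p * t `^ p * ((A `^ p) ^+ i * (A ^+ i * t < x)%R%:R))%:E)%E); last first.
  by rewrite leeDr// lee_fin powR_ge0.
apply: le_trans (nneseries_lim_ge m.+1 _); last by [].
by rewrite big_nat_recr//= mx leeDr// sume_ge0.
Qed.

End layers.

(** * From a good-lambda inequality to integrals of powers *)

Section good_lambda.
Context d (T : measurableType d) (R : realType) (mu : {measure set T -> \bar R}).
Local Open Scope ereal_scope.

(** [E l] plays the role of the set where a maximal function of [g] exceeds [l]. Only the levels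
    [A ^+ i * t] are used: the bound on [A ^p * c] absorbs the terms in [E], and the part of [g]
    below [t] gives the term with [mu P]. *)
Lemma good_lambda_integral (P : set T) (g : T -> R) (M : T -> \bar R) (E : R -> set T)
    (A c t v p : R) :
  measurable P -> mu P = v%:E ->
  measurable_fun P g -> (forall x, P x -> (0 <= g x)%R) ->
  measurable_fun P M -> (forall x, P x -> 0 <= M x) ->
  (forall l, measurable (E l)) -> (forall l, E l `<=` P) ->
  (0 < p)%R -> (1 < A)%R -> (0 < c)%R -> (A `^ p * c <= 2^-1)%R -> (0 < t)%R ->
  (forall l, (t <= l)%R -> mu (P `&` [set x | (l < g x)%R]) <= mu (E l)) ->
  (forall l, (t <= l)%R ->
    mu (E (A * l)%R) <= mu (P `&` [set x | (c * l)%R%:E < M x]) + c%:E * mu (E l)) ->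
  \int[mu]_(x in P) (g x `^ p)%:E <=
    ((1 + 2 * A `^ p) * t `^ p)%:E * mu P +
    (2 * A `^ p * A `^ p * (A `^ p / (A `^ p - 1) / c `^ p))%:E *
      \int[mu]_(x in P) (M x `^ p).
Proof.
move=> mP muP mg g0 mM M0 mE EP p0 A1 c0 Ac t0 Hg HM.
have q1 := powR_gt1 p0 A1; set q := (A `^ p)%R in q1 Ac *.
have A0 : (0 < A)%R by lra.
have At i : (t <= A ^+ i * t)%R by rewrite ler_peMl ?exprn_ege1 ?ltW.
have fin B : measurable B -> B `<=` P -> mu B \is a fin_num.
  move=> mB BP; rewrite ge0_fin_numE//; apply: (@le_lt_trans _ _ (mu P)).
    by apply: le_measure; rewrite ?inE.
  by rewrite muP ltry.
pose L l := P `&` [set x | (l < g x)%R].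
pose S l := P `&` [set x | (c * l)%R%:E < M x].
have mL l : measurable (L l).
  have := mg mP `]l, +oo[%classic (measurable_itv _).
  by congr (measurable (_ `&` _)); apply/seteqP; split => x /=; rewrite in_itv/= andbT.
have mS l : measurable (S l) by exact: emeasurable_fun_o_infty.
pose e i := fine (mu (E (A ^+ i * t)%R)).
pose m i := fine (mu (S (A ^+ i * t)%R)).
have eE i : mu (E (A ^+ i * t)%R) = (e i)%:E by rewrite fineK ?fin.
have mE' i : mu (S (A ^+ i * t)%R) = (m i)%:E by rewrite fineK ?fin// => x [].
have e0 i : (0 <= e i)%R by rewrite fine_ge0.
have step i : (e i.+1 <= m i + c * e i)%R.
  by rewrite -lee_fin EFinD EFinM -mE' -!eE exprS -mulrA; exact: HM.
have ev : (e 0%N <= v)%R.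
  by rewrite -lee_fin -eE -muP; apply: le_measure; rewrite ?inE.
have q0 : (0 <= q)%R by lra.
have abs N := absorbed_geometric_sum N q0 (ltW c0) Ac e0 ev step.
set K : R := (q / (q - 1) / c `^ p)%R.
have mMp : measurable_fun P (fun x => M x `^ p).
  by apply: (measurableT_comp (measurable_poweR p) mM).
(* Chebyshev's inequality for all levels at once: the levels [c * A ^+ i * t] below [M x] contribute
   a geometric sum of the order of the p-th power of [M x]. *)
have SN N : (\sum_(i < N) q ^+ i * m i)%:E * (t `^ p)%:E <= K%:E * \int[mu]_(x in P) M x `^ p.
  rewrite -ge0_integralZl//; last 2 first.
  - by move=> x _; exact: poweR_ge0.
  - by rewrite lee_fin !mulr_ge0 ?invr_ge0 ?powR_ge0//; lra.
  apply: (@le_trans _ _ (\int[mu]_(x in P) \sum_(i < N)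
      (t `^ p * q ^+ i * \1_(S (A ^+ i * t)%R) x)%:E)).
    rewrite ge0_integral_sum//; last 2 first.
    - move=> i; apply/measurable_EFinP.
      by apply: measurable_funM; [exact: measurable_cst|exact: measurable_indic].
    - by move=> i x _; rewrite lee_fin !mulr_ge0 ?powR_ge0 ?exprn_ge0.
    rewrite -EFinM mulr_suml -sumEFin; apply: lee_sum => i _.
    under eq_integral do rewrite EFinM.
    rewrite ge0_integralZl_EFin//; last 2 first.
    - exact/measurable_EFinP/measurable_indic.
    - by rewrite mulr_ge0 ?powR_ge0 ?exprn_ge0.
    rewrite integral_indic// setIidl; last by move=> x [].
    by rewrite mE' -EFinM lee_fin mulrAC [(t `^ p * _)%R]mulrC.
  apply: ge0_le_integral => //.
  - by move=> x _; apply: sume_ge0 => i _; rewrite lee_fin !mulr_ge0 ?powR_ge0 ?exprn_ge0.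
  - apply: emeasurable_sum => i; apply/measurable_EFinP.
    by apply: measurable_funM; [exact: measurable_cst|exact: measurable_indic].
  - exact: measurable_funeM.
  move=> x Px; rewrite sumEFin.
  have := @geometric_layers R A (c * t) p (M x) N p0 A1 (mulr_gt0 c0 t0) (M0 x Px).
  have tp0 : (0 <= (t `^ p)%:E)%E by rewrite lee_fin powR_ge0.
  move=> /(lee_wpmul2l tp0); rewrite muleA -!EFinM => H; apply: le_trans (le_trans H _).
    rewrite lee_fin mulr_sumr; apply: ler_sum => i _.
    rewrite -mulrA ler_wpM2l ?powR_ge0// ler_wpM2l ?exprn_ge0//.
    rewrite indicE; case: (boolP (x \in _)) => [|_]; last by rewrite ler0n.
    by move=> /set_mem[_ /=]; rewrite mulrCA => ->.
  rewrite powRM ?(ltW c0) ?(ltW t0)// (_ : t `^ p * _ = K)%R//.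
  have cp0 := powR_gt0 p c0; have tp1 := powR_gt0 p t0.
  by rewrite /K -/q; field; rewrite !gt_eqF//; lra.
have Lsum N : (\sum_(i < N) q ^+ i * fine (mu (L (A ^+ i * t)%R)) <= 2 * v + 2 * q * \sum_(i < N) q ^+ i * m i)%R.
  case: N => [|N].
    by rewrite !big_ord0 mulr0 addr0 mulr_ge0// -lee_fin -muP.
  apply: (@le_trans _ _ (\sum_(i < N.+1) q ^+ i * e i)%R).
    apply: ler_sum => i _; rewrite ler_wpM2l ?exprn_ge0//.
    by rewrite fine_le ?fin//; [move=> x []|exact: Hg].
  apply: le_trans (abs N) _; rewrite lerD2l ler_wpM2l ?mulr_ge0//.
  by rewrite big_ord_recr/= lerDl mulr_ge0 ?exprn_ge0// fine_ge0.
have q_ge0 : (0 <= q * t `^ p)%R by rewrite mulr_ge0 ?powR_ge0.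
have ind0 i x : 0 <= (q * t `^ p * (q ^+ i * \1_(L (A ^+ i * t)%R) x))%:E.
  by rewrite lee_fin mulr_ge0// mulr_ge0 ?exprn_ge0.
have mind i : measurable_fun P (fun x => (q * t `^ p * (q ^+ i * \1_(L (A ^+ i * t)%R) x))%:E).
  apply/measurable_EFinP; apply: measurable_funM; first exact: measurable_cst.
  by apply: measurable_funM; [exact: measurable_cst|exact: measurable_indic].
apply: (@le_trans _ _ (\int[mu]_(x in P) ((t `^ p)%:E + \sum_(i <oo)
     (q * t `^ p * (q ^+ i * \1_(L (A ^+ i * t)%R) x))%:E))).
  apply: ge0_le_integral => //.
  - by move=> x _; rewrite lee_fin powR_ge0.
  - apply/measurable_EFinP; exact: (measurableT_comp (measurable_powR p) mg).
  - by apply: emeasurable_funD; [exact: measurable_cst|exact: ge0_emeasurable_sum].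
  move=> x Px; apply: le_trans (layer_le p0 A1 t0 (g0 x Px)) _.
  rewrite leeD2l//; apply: lee_nneseries => [i *|i *].
    by rewrite lee_fin !mulr_ge0 ?exprn_ge0 ?powR_ge0.
  rewrite lee_fin -/q ler_wpM2l// ler_wpM2l ?exprn_ge0//.
  rewrite indicE; case: ltP => // tg; rewrite (_ : _ \in _) ?ler01// mem_set//.
rewrite ge0_integralD//; last 3 first.
- by move=> x _; rewrite lee_fin powR_ge0.
- by move=> x _; exact: nneseries_ge0.
- exact: ge0_emeasurable_sum.
rewrite integral_cst// integral_nneseries//.
rewrite mulrDl mul1r EFinD ge0_muleDl ?lee_fin ?mulr_ge0 ?powR_ge0// -addeA leeD2l//.
have intL i : \int[mu]_(x in P) (q * t `^ p * (q ^+ i * \1_(L (A ^+ i * t)%R) x))%:E =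
   (q * t `^ p * (q ^+ i * fine (mu (L (A ^+ i * t)%R))))%:E.
  under eq_integral do rewrite mulrA EFinM.
  rewrite ge0_integralZl_EFin//; last 2 first.
  - exact/measurable_EFinP/measurable_indic.
  - by rewrite mulr_ge0 ?exprn_ge0.
  rewrite integral_indic// setIidl; last by move=> x [].
  by rewrite mulrA [in RHS]EFinM fineK// fin// => x [].
under eq_eseriesr do rewrite intL.
apply: lime_le; first by apply: is_cvg_nneseries => i _ _; rewrite -intL; exact: integral_ge0.
apply: nearW => N; rewrite big_mkord sumEFin -mulr_sumr.
apply: (@le_trans _ _ (q * t `^ p * (2 * v + 2 * q * \sum_(i < N) q ^+ i * m i))%:E).
  by rewrite lee_fin ler_wpM2l.
rewrite muP mulrDr EFinD -EFinM; apply: leeD; first by rewrite lee_fin; lra.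
have qq0 : 0 <= (2 * q * q)%:E by rewrite lee_fin !mulr_ge0.
have := lee_wpmul2l qq0 (SN N).
rewrite !muleA -!EFinM => /(le_trans _); apply.
by rewrite lee_fin; lra.
Qed.

End good_lambda.

Section powers_integral.
Context d (T : measurableType d) (R : realType) (mu : {measure set T -> \bar R}).

Lemma integral_indicD_cst (A S : set T) (c : R) : measurable A -> measurable S -> 0 <= c ->
  (\int[mu]_(x in A) ((\1_S x)%:E + c%:E) = mu (S `&` A) + c%:E * mu A)%E.
Proof.
move=> mA mS c0; rewrite ge0_integralD//; last first.
  exact/measurable_EFinP/measurable_indic.
by rewrite integral_indic// integral_cst.
Qed.

Lemma measurable_indicE (A S : set T) : measurable S ->
  measurable_fun A (fun x => (\1_S x)%:E : \bar R).
Proof. by move=> mS; exact/measurable_EFinP/measurable_indic. Qed.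

Lemma measurable_indicD_cst (A S : set T) (c : R) : measurable S ->
  measurable_fun A (fun x => (\1_S x)%:E + c%:E : \bar R)%E.
Proof.
move=> mS; apply: emeasurable_funD; last exact: measurable_cst.
exact/measurable_EFinP/measurable_indic.
Qed.

Lemma integral_powR_eq0 (P : set T) (g : T -> R) (p : R) : 0 < p ->
  measurable P -> measurable_fun P g -> (\int[mu]_(x in P) `|g x|%:E = 0)%E ->
  (\int[mu]_(x in P) (`|g x| `^ p)%:E = 0)%E.
Proof.
move=> p0 mP mg g0; have mg' : measurable_fun P (EFin \o g) by exact/measurable_EFinP.
have /(ae_eq_integral_abs mu mP mg').1 ae : (\int[mu]_(x in P) `|(EFin \o g) x| = 0)%E by [].
rewrite (ge0_ae_eq_integral (g := cst 0%E))//.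
- by rewrite integral0.
- apply/measurable_EFinP; apply: (measurableT_comp (measurable_powR p)).
  exact: measurableT_comp.
- apply: filterS ae => x H Px; have [->] := H Px.
  by rewrite normr0 powR0// gt_eqF.
Qed.

Lemma le_measure_null (A B : set T) : measurable A -> measurable B ->
  (mu (A `\` B) = 0 -> mu A <= mu B)%E.
Proof.
move=> mA mB AB0; rewrite -(adde0 (mu B)) -AB0.
apply: le_trans (measureU2 mu mB (measurableD mA mB)).
apply: le_measure; rewrite ?inE//; first by apply: measurableU => //; exact: measurableD.
by move=> x Ax; have [Bx|nBx] := pselect (B x); [left|right].
Qed.

Lemma le_poweR (p : R) (x y : \bar R) : 0 <= p -> (0 <= x -> x <= y -> x `^ p <= y `^ p)%E.
Proof.
move=> p0 x0 xy; apply: gt0_ler_poweR => //; rewrite in_itv/= leey andbT//.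
exact: le_trans xy.
Qed.

Lemma integral_ge_cst (P : set T) (c : \bar R) (g : T -> \bar R) : measurable P -> (0 <= c)%E ->
  measurable_fun P g -> (forall x, P x -> c <= g x)%E ->
  (c * mu P <= \int[mu]_(x in P) g x)%E.
Proof.
move=> mP c0 mg cg; rewrite -(integral_cst mu mP); by apply: ge0_le_integral.
Qed.

End powers_integral.

Section local_sharp.
Context {R : realType} {n : nat}.
Local Notation T := (lebesgue_rV R n).
Local Notation mu := (mu_rV R n).

Let vol j : R := (2 ^- j) ^+ n.

Let vol_gt0 j : 0 < vol j.
Proof. by rewrite exprn_gt0// invr_gt0 exprn_gt0. Qed.

Let volS j : vol j = 2 ^+ n * vol j.+1.
Proof. by rewrite /vol exprS invfM exprMn mulrA -exprMn mulfV// expr1n mul1r. Qed.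

(* The good-lambda inequality for the dyadic maximal function of
   [|f - f_P|] against the sharp function [M]. *)
Lemma good_lambda (k : nat) (x0 : 'rV[R]_n) (f : T -> R) (M : T -> \bar R) (c l : R) :
  let P := dyad k x0 in
  let a := average P f in
  let E l := stops (fun j D => [/\ (k <= j)%N, D `<=` P & (l%:E * mu D < dev mu D f a)%E]) in
  mu.-integrable P (EFin \o f) -> measurable_fun P M ->
  (forall j x y, (k <= j)%N -> P x -> dyad j x y ->
    (dev mu (dyad j x) f (average (dyad j x) f) <= M y * mu (dyad j x))%E) ->
  0 < l -> 0 < c -> (dev mu P f a <= l%:E * mu P)%E ->
  (mu (E ((2 ^+ n + 1) * l)%R) <= mu (P `&` [set x | (c * l)%R%:E < M x]) + c%:E * mu (E l))%E.
Proof.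
move=> P a E If mM HM l0 c0 al.
set A := 2 ^+ n + 1 : R; set S := P `&` _.
have mP : measurable P by exact: measurable_dyad.
have mf : measurable_fun P f by have /measurable_EFinP := measurable_int _ If.
have mS : measurable S by exact: emeasurable_fun_o_infty.
have A1 : 1 <= A by rewrite lerDr exprn_ge0.
have mE b : measurable (E b) by exact: measurable_stops.
have EAE : E (A * l) `<=` E l.
  move=> x [j [kj DP H]]; exists j; split => //; apply: le_lt_trans H.
  by rewrite mu_dyad -!EFinM lee_fin ler_wpM2r// ?ler_peMl// ltW.
have EP b : E b `<=` P by move=> x [j [kj DP H]]; exact/DP/dyad_refl.
have mfS D : measurable D -> D `<=` P -> measurable_fun D f.
  by move=> mD DP; exact: measurable_funS mf.
apply: (@le_trans _ _ (\int[mu]_(x in E l) (\1_(E (A * l)%R) x)%:E)%E).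
  by rewrite integral_indic// setIidl.
apply: (@le_trans _ _ (\int[mu]_(x in E l) ((\1_S x)%:E + c%:E))%E); last first.
  rewrite (integral_indicD_cst mu (mE l) mS (ltW c0)) leeD2r//.
  by apply: le_measure; rewrite ?inE//; exact: measurableI.
apply: stops_compare.
- exact: measurable_indicE.
- exact: measurable_indicD_cst.
- by move=> x _; rewrite lee_fin.
- by move=> x _; rewrite adde_ge0// lee_fin// ltW.
move=> j x [[kj DP Hj] Nj]; set D := dyad j x in DP Hj *.
have Px : P x by exact/DP/dyad_refl.
have mD : measurable D by exact: measurable_dyad.
have muD : mu D = (vol j)%:E by rewrite mu_dyad.
rewrite (integral_indicD_cst mu mD mS (ltW c0)) integral_indic//.
have cD0 : (0 <= c%:E * mu D)%E.
  by rewrite muD -EFinM lee_fin mulr_ge0 ?(ltW c0) ?(ltW (vol_gt0 _)).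
(* Either [D] lies in the level set of [M] entirely, or a single point [y] with [M y <= c * l]
   bounds the oscillation of [f] on all of [D]. *)
have [MD|] := pselect (forall y, D y -> ((c * l)%R%:E < M y)%E).
  apply: (@le_trans _ _ (mu (S `&` D))); last by rewrite leeDl.
  apply: le_measure; rewrite ?inE; [exact: measurableI|exact: measurableI|].
  by move=> y [_ Dy]; split => //; split; [exact: DP|exact: MD].
move=> /existsNP[y /not_implyP[Dy /negP]]; rewrite -leNgt => Myl.
have osc : (dev mu D f (average D f) <= (c * l)%R%:E * mu D)%E.
  by apply: le_trans (HM j x y kj Px Dy) _; rewrite -/D lee_wpmul2r// muD lee_fin ltW.
apply: (@le_trans _ _ (c%:E * mu D)%E); last by rewrite leeDr.
(* [P] itself does not stop at level [l], so [D] has a parent inside [P]. *)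
have kltj : (k < j)%N.
  rewrite ltn_neqAle kj andbT; apply/eqP => kE.
  move: Hj; apply/negP; rewrite -leNgt.
  have -> : D = P by rewrite /D /P -kE; apply: dyad_eq.
  exact: al.
have jE : j.-1.+1 = j by rewrite prednK// (leq_ltn_trans _ kltj).
have kj' : (k <= j.-1)%N by rewrite -ltnS jE.
set D' := dyad j.-1 x.
have D'P : D' `<=` P.
  by rewrite /P -(dyad_eq Px); exact: dyad_le.
have muD' : mu D' = (2 ^+ n * vol j)%:E by rewrite mu_dyad -[in vol j]jE -volS.
have mD' : measurable D' by exact: measurable_dyad.
have devD' : (dev mu D' f a <= l%:E * mu D')%E.
  by rewrite leNgt; apply/negP => H; by apply: (Nj j.-1); rewrite ?jE.
have DD' : D `<=` D' by rewrite /D -jE; exact: dyadS.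
have avgD : `|average D f - a| <= 2 ^+ n * l.
  have IfD : mu.-integrable D (EFin \o f).
    exact: integrableS If.
  have := average_dev a mD muD (vol_gt0 _) IfD.
  move=> /le_trans/(_ (le_dev_sub mu a mD mD' (mfS _ mD' D'P) DD'))/le_trans/(_ devD').
  by rewrite muD' -EFinM lee_fin mulrA ler_pM2r// mulrC.
(* A cube witnessing [E (A * l)] at a point of [D] is not larger than [D], by the maximality of [D];
   inside [D] it still deviates by more than [l] from the mean on [D]. *)
have EAD : E (A * l) `&` D `<=` stops (fun i D0 => D0 `<=` D /\
    (l%:E * mu D0 < dev mu D0 f (average D f))%E).
  move=> z [[i [ki iP Hi]] Dz]; have [ij|ji] := ltnP i j.
    exfalso; apply: (Nj i ij); rewrite -(dyad_eq (dyad_le (ltnW ij) Dz)); split => //.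
    apply: le_lt_trans Hi.
    by rewrite mu_dyad -!EFinM lee_fin ler_wpM2r// ?ler_peMl// ltW.
  exists i; split.
    by rewrite /D -(dyad_eq Dz); exact: dyad_le.
  have mi : measurable (dyad i z) by exact: measurable_dyad.
  have := lt_le_trans Hi (dev_shift mu a (average D f) mi (mfS _ mi iP)).
  rewrite mu_dyad -/(vol i) -!EFinM => H.
  have : ((A * l * vol i)%:E < dev mu (dyad i z) f (average D f) + (2 ^+ n * l * vol i)%:E)%E.
    apply: lt_le_trans H _; rewrite leeD2l// lee_fin distrC.
    by rewrite ler_wpM2r// ltW.
  have : (dev mu (dyad i z) f (average D f) >= 0)%E by exact: dev_ge0.
  case: (dev _ _ _ _) => [r _|_ _|//].
    rewrite -EFinD !lte_fin /A; lra.
  exact: ltry.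
set F := stops _ in EAD.
have FD : F `<=` D by move=> z [i [iD _]]; exact/iD/dyad_refl.
have mF : measurable F by exact: measurable_stops.
(* Weak-type bound: the maximal cubes of [F] are disjoint subsets of [D]. *)
have lF : (l%:E * mu F <= dev mu D f (average D f))%E.
  apply: le_trans (le_dev_sub mu _ mF mD (mfS _ mD DP) FD).
  rewrite -(integral_cst mu mF l%:E); apply: stops_compare.
  - exact: measurable_cst.
  - by apply: measurable_dev; apply: mfS => //; exact: subset_trans DP.
  - by move=> z _; rewrite lee_fin ltW.
  - by move=> z _; rewrite lee_fin.
  - move=> i z [[_ /ltW H] _]; rewrite integral_cst//; exact: measurable_dyad.
have := le_trans lF osc.
rewrite [(c * l)%R]mulrC EFinM -muleA lee_pmul2l// ?lte_fin// => H.
by apply: le_trans H; apply: le_outer_measure.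
Qed.

(** The base level [t] of the good-lambda argument is the mean deviation of [f] on [P]. It is at
    most [M] at every point of [P], so the term [t^p mu P] is itself bounded by the integral of
    [M^p]. *)
Lemma dyadic_fefferman_stein (p : R) : 0 < p -> exists2 K : R, 0 < K &
  forall (k : nat) (x0 : 'rV[R]_n) (f : T -> R) (M : T -> \bar R),
  let P := dyad k x0 in
  mu.-integrable P (EFin \o f) -> measurable_fun P M ->
  (forall j x y, (k <= j)%N -> P x -> dyad j x y ->
    (dev mu (dyad j x) f (average (dyad j x) f) <= M y * mu (dyad j x))%E) ->
  (\int[mu]_(x in P) (`|f x - average P f| `^ p)%:E <= K%:E * \int[mu]_(x in P) (M x `^ p))%E.
Proof.
move=> p0; set A := 2 ^+ n + 1 : R.
have A1 : 1 < A by rewrite ltrDr exprn_gt0.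
have A0 : 0 < A by lra.
have q1 := powR_gt1 p0 A1; set q := A `^ p in q1.
(* The largest [c] with [q * c <= 1/2]. *)
pose c := 2^-1 / q.
have q0 : 0 < q by lra.
have c0 : 0 < c by rewrite divr_gt0.
pose K := (1 + 2 * q) + 2 * q * q * (q / (q - 1) / c `^ p).
have K'0 : 0 < 2 * q * q * (q / (q - 1) / c `^ p).
  by rewrite !mulr_gt0// ?invr_gt0 ?powR_gt0//; lra.
exists K => [|k x0 f M P If mM HM]; first by rewrite /K; lra.
set a := average P f.
have mP : measurable P by exact: measurable_dyad.
have muP : mu P = (vol k)%:E by rewrite mu_dyad.
have v0 := vol_gt0 k.
have mf : measurable_fun P f by have /measurable_EFinP := measurable_int _ If.
have mg : measurable_fun P (fun x => `|f x - a|).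
  by apply/measurable_EFinP; exact: measurable_dev.
have Ig : mu.-integrable P (EFin \o (fun x => f x - a)).
  by apply: integrable_shift => //; rewrite muP ltry.
have devfin : (dev mu P f a < +oo)%E by have /integrableP[_] := Ig.
have [r rE] : exists r, dev mu P f a = r%:E.
  by exists (fine (dev mu P f a)); rewrite fineK// ge0_fin_numE// dev_ge0.
have r0 : 0 <= r by rewrite -lee_fin -rE dev_ge0.
have rM y : P y -> ((r / vol k)%:E <= M y)%E.
  move=> Py; have := HM k y y (leqnn _) Py (dyad_refl _ _).
  rewrite (dyad_eq Py) -/P -/a rE muP; case: (M y) => [s| |].
  - by rewrite -EFinM !lee_fin ler_pdivrMr.
  - by rewrite leey.
  - by rewrite gt0_mulNye// leNgt ltNye.
have M0 y : P y -> (0 <= M y)%E.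
  by move=> /rM; apply: le_trans; rewrite lee_fin divr_ge0// ltW.
(* If the deviation vanishes there is no positive base level, but then [f = a] almost everywhere on
   [P]. *)
have [r00|rn0] := eqVneq r 0.
  have mfa : measurable_fun P (fun x => f x - a).
    by apply: measurable_funB; [exact: mf|exact: measurable_cst].
  rewrite (integral_powR_eq0 p0 mP mfa); last by rewrite -[LHS]/(dev mu P f a) rE r00.
  apply: mule_ge0; first by rewrite lee_fin /K; lra.
  by apply: integral_ge0 => x _; exact: poweR_ge0.
set t := r / vol k in rM.
have t0 : 0 < t by rewrite divr_gt0// lt_neqAle eq_sym rn0.
pose E l := stops (fun j D => [/\ (k <= j)%N, D `<=` P & (l%:E * mu D < dev mu D f a)%E]).
have devt l : t <= l -> (dev mu P f a <= l%:E * mu P)%E.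
  by move=> tl; rewrite rE muP -EFinM lee_fin -ler_pdivrMr.
have := @good_lambda_integral _ T R mu P (fun x => `|f x - a|) M E A c t (vol k) p mP muP mg.
move=> /(_ (fun x _ => normr_ge0 _) mM M0 (fun l => measurable_stops _)).
move=> /(_ _ p0 A1 c0 _ t0) HI.
apply: le_trans (HI _ _ _ _) _.
- by move=> l x [j [kj DP _]]; exact/DP/dyad_refl.
- by rewrite /c -/q mulrCA mulfV ?mulr1// gt_eqF.
- move=> l tl; have mL : measurable (P `&` [set x | l < `|f x - a|]).
    have := mg mP `]l, +oo[%classic (measurable_itv _).
    by congr (measurable (_ `&` _)); apply/seteqP; split => x /=; rewrite in_itv/= andbT.
  have mE := measurable_stops (fun j D => [/\ (k <= j)%N, D `<=` P & (l%:E * mu D < dev mu D f a)%E]).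
  (* Outside [E l] all dyadic means of [|f - a|] are at most [l], so by density [|f - a| > l] only
     on a null set there. *)
  apply: (le_measure_null mL mE).
  apply: (@dyadic_density _ _ P _ k (fun x => `|f x - a|%:E) l mP).
  - exact: measurableD.
  - by move=> x [[]].
  - exact: measurable_dev.
  - by move=> x _; rewrite lee_fin.
  - exact: ltW (lt_le_trans t0 tl).
  - by rewrite muP ltry.
  - by move=> x [[Px _] _]; rewrite (dyad_eq Px).
  - by move=> x [[_ ?] _]; rewrite lte_fin.
  - move=> x j [[Px _] nE] kj; rewrite leNgt; apply/negP => Hj; apply: nE.
    exists j; split => //; rewrite /P -(dyad_eq Px); exact: dyad_le.
- move=> l tl; apply: good_lambda => //; last exact: devt.
  exact: lt_le_trans tl.
have tM : ((t `^ p)%:E * mu P <= \int[mu]_(x in P) M x `^ p)%E.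
  apply: (@integral_ge_cst _ _ _ mu P (t `^ p)%:E (fun x => M x `^ p)%E mP).
    by rewrite lee_fin powR_ge0.
    exact: (measurableT_comp (measurable_poweR p) mM).
  by move=> x Px; rewrite -poweR_EFin le_poweR ?(ltW p0) ?lee_fin ?(ltW t0)//; exact: rM.
have I0 : (0 <= \int[mu]_(x in P) M x `^ p)%E.
  by apply: integral_ge0 => x _; exact: poweR_ge0.
have q2 : 0 <= 1 + 2 * q by lra.
rewrite /K EFinD ge0_muleDl ?lee_fin ?(ltW K'0)//.
apply: leeD; last exact: lexx.
by rewrite EFinM -muleA; apply: lee_wpmul2l => //; rewrite lee_fin.
Qed.

End local_sharp.

(** * Weighted estimates near the boundary *)

Section euclidean_norm.
Context {R : realType} {n : nat}.
Implicit Types (x y z : 'rV[R]_n) (E : set 'rV[R]_n).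

Lemma enorm_ge0 x : 0 <= enorm x. Proof. exact: sqrtr_ge0. Qed.

Lemma enorm_sqr x : enorm x ^+ 2 = \sum_(i < n) x 0 i ^+ 2.
Proof. by rewrite sqr_sqrtr// sumr_ge0// => i _; exact: sqr_ge0. Qed.

Lemma enorm0 : enorm (0 : 'rV[R]_n) = 0.
Proof. by rewrite /enorm big1 ?sqrtr0// => i _; rewrite mxE expr0n. Qed.

Lemma enormZ (a : R) x : enorm (a *: x) = `|a| * enorm x.
Proof.
rewrite /enorm (eq_bigr (fun i => a ^+ 2 * x 0 i ^+ 2)).
  by rewrite -mulr_sumr sqrtrM ?sqr_ge0// sqrtr_sqr.
by move=> i _; rewrite mxE exprMn.
Qed.

Lemma enormB x y : enorm (x - y) = enorm (y - x).
Proof. by rewrite -opprB -scaleN1r enormZ normrN1 mul1r. Qed.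

Lemma coord_le_enorm x i : `|x 0 i| <= enorm x.
Proof.
rewrite -(@ler_pXn2r _ 2)// ?nnegrE ?enorm_ge0// enorm_sqr real_normK ?num_real//.
by rewrite (bigD1 i)//= lerDl sumr_ge0// => j _; exact: sqr_ge0.
Qed.

Lemma enorm_le x (h : R) : 0 <= h -> (forall i, `|x 0 i| <= h) -> enorm x <= n%:R * h.
Proof.
move=> h0 xh; have nh : 0 <= n%:R * h by rewrite mulr_ge0.
rewrite -(@ler_pXn2r _ 2)// ?nnegrE ?enorm_ge0// enorm_sqr.
apply: (@le_trans _ _ (\sum_(i < n) h ^+ 2)).
  by apply: ler_sum => i _; rewrite -real_normK ?num_real// ler_pXn2r ?nnegrE.
rewrite sumr_const card_ord -[leLHS]mulr_natl exprMn ler_wpM2r ?sqr_ge0//.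
by rewrite -natrX ler_nat; case: (n) => // m; rewrite expnS leq_pmulr// expn1.
Qed.

(* Cauchy-Schwarz, by applying [2 a b <= s a ^ 2 + b ^ 2 / s] with [s = |y| / |x|] *)
Lemma enormD x y : enorm (x + y) <= enorm x + enorm y.
Proof.
have [x0|xn0] := eqVneq (enorm x) 0.
  have -> : x = 0; last by rewrite enorm0 !add0r.
  apply/matrixP => i j; rewrite (ord1 i) mxE; apply/eqP.
  by rewrite -normr_le0 -x0 coord_le_enorm.
have [y0|yn0] := eqVneq (enorm y) 0.
  have -> : y = 0; last by rewrite enorm0 !addr0.
  apply/matrixP => i j; rewrite (ord1 i) mxE; apply/eqP.
  by rewrite -normr_le0 -y0 coord_le_enorm.
have xp : 0 < enorm x by rewrite lt_neqAle eq_sym xn0 enorm_ge0.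
have yp : 0 < enorm y by rewrite lt_neqAle eq_sym yn0 enorm_ge0.
rewrite -(@ler_pXn2r _ 2)// ?nnegrE ?addr_ge0 ?enorm_ge0// sqrrD !enorm_sqr.
pose s := enorm y / enorm x.
have s0 : 0 < s by rewrite divr_gt0.
apply: (@le_trans _ _ (\sum_(i < n) (x 0 i ^+ 2 + (s * x 0 i ^+ 2 + y 0 i ^+ 2 / s) + y 0 i ^+ 2))).
  apply: ler_sum => i _; rewrite mxE sqrrD lerD2r lerD2l.
  rewrite -subr_ge0 (_ : _ - _ = (s * x 0 i - y 0 i) ^+ 2 / s).
    by rewrite divr_ge0 ?sqr_ge0// ltW.
  by field; rewrite gt_eqF.
rewrite !big_split/= -mulr_sumr -mulr_suml lerD2r lerD2l -!enorm_sqr.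
by rewrite le_eqVlt; apply/orP; left; apply/eqP; rewrite /s; field; rewrite !gt_eqF.
Qed.

Lemma enorm_tri x y z : enorm (x - z) <= enorm (x - y) + enorm (y - z).
Proof. by rewrite -[x in leLHS](subrK y) -addrA enormD. Qed.

Lemma set_dist_le x y E : E y -> set_dist x E <= enorm (x - y).
Proof.
move=> Ey; apply: ge_inf; last by exists y.
by exists 0 => _ [z _ <-]; exact: enorm_ge0.
Qed.

Lemma set_dist_ge x E r : E !=set0 -> (forall y, E y -> r <= enorm (x - y)) ->
  r <= set_dist x E.
Proof.
move=> [z Ez] H; apply: lb_le_inf; first by exists (enorm (x - z)); exists z.
by move=> _ [y Ey <-]; exact: H.
Qed.

Lemma set_dist_lt x E r : E !=set0 -> set_dist x E < r ->
  exists2 y, E y & enorm (x - y) < r.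
Proof.
move=> E0 dr; apply: contrapT => H; move: dr; apply/negP; rewrite -leNgt.
by apply: set_dist_ge => // y Ey; rewrite leNgt; apply/negP => xy; apply: H; exists y.
Qed.

Lemma set_dist_lip x y E : E !=set0 -> set_dist x E <= set_dist y E + enorm (x - y).
Proof.
move=> E0; rewrite -lerBlDr; apply: set_dist_ge => // z Ez; rewrite lerBlDr.
by apply: le_trans (set_dist_le _ Ez) _; rewrite [leRHS]addrC enorm_tri.
Qed.

Lemma enorm_cube c x (h : R) : cube c h x -> 0 <= h -> enorm (x - c) <= n%:R * h.
Proof. by move=> xc h0; apply: enorm_le => // i; rewrite !mxE ltW. Qed.

(** The boundary point sits at the supremum of the parameters whose points lie in [O]. It is a limit
    of points of [O]; it is not in [O], since openness would then give larger parameters. *)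
Lemma segment_boundary (O : set 'rV[R]_n) x y : open O -> O x -> ~ O y ->
  exists2 t : R, 0 <= t <= 1 & boundary O (x + t *: (y - x)).
Proof.
move=> oO Ox nOy; pose S : set R := [set t | 0 <= t <= 1 /\ O (x + t *: (y - x))].
have S0 : S 0 by split; [rewrite lexx ler01|rewrite scale0r addr0].
have Sub : ubound S 1 by move=> t [/andP[]].
have hS : has_sup S by split; [exists 0|exists 1].
have s0 : 0 <= sup S by apply: ub_le_sup => //; exists 1.
have s1 : sup S <= 1 by apply: ge_sup => //; exists 0.
have nS1 : ~ S 1 by move=> [_]; rewrite scale1r addrC subrK.
set z := x + sup S *: (y - x).
pose K := enorm (y - x) + 1.
have K0 : 0 < K by rewrite ltr_wpDl// enorm_ge0.
have near_z t h : 0 < h -> `|t - sup S| < h / K -> cube z h (x + t *: (y - x)).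
  move=> h0 ts i; rewrite !mxE.
  have -> : x 0 i + t * (y 0 i - x 0 i) - (x 0 i + sup S * (y 0 i - x 0 i)) =
     (t - sup S) * (y - x) 0 i by rewrite !mxE; ring.
  rewrite normrM; apply: (@le_lt_trans _ _ (`|t - sup S| * K)).
    by rewrite ler_wpM2l// ler_wpDr// coord_le_enorm.
  by rewrite -ltr_pdivlMr.
have zO : ~ O z.
  move=> Oz; have [h h0 hO] := open_cube oO Oz.
  have SS : S (sup S) by split => //; rewrite s0 s1.
  have sl : sup S < 1 by rewrite lt_neqAle s1 andbT; apply/eqP => E; apply: nS1; rewrite -E.
  pose t := Num.min 1 (sup S + h / K / 2).
  have hK : 0 < h / K by rewrite divr_gt0.
  have st : sup S < t by rewrite lt_min sl/=; lra.
  have : S t.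
    split; first by rewrite (le_trans s0 (ltW st)) ge_min lexx.
    apply/hO/near_z => //; rewrite gtr0_norm ?subr_gt0//.
    suff : t <= sup S + h / K / 2 by lra.
    by rewrite ge_min lexx orbT.
  by move=> /(ub_le_sup hS.2); rewrite leNgt st.
exists (sup S); first by rewrite s0 s1.
split; last by rewrite (_ : interior O = O)//; exact/interior_id.
move=> B /nbhs_ballP[h /= h0 hB].
have hK : 0 < h / K by rewrite divr_gt0.
have [t [t01 Ot] ts] := sup_adherent hK hS.
exists (x + t *: (y - x)); split => //.
have tsup : t <= sup S by apply: ub_le_sup => //; exact: hS.2.
apply: hB; split => // i j; rewrite (ord1 i) /ball/= distrC; apply: near_z => //.
rewrite ler0_norm ?subr_le0//; lra.
Qed.

Lemma boundary_out (O : set 'rV[R]_n) x : open O -> boundary O x -> ~ O x.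
Proof. by move=> oO [_]; rewrite (_ : interior O = O)//; exact/interior_id. Qed.

(** A segment leaving [O] meets the boundary no farther from [x] than [y] is. *)
Lemma eball_sub_open (O : set 'rV[R]_n) x y : open O -> O x ->
  enorm (y - x) < set_dist x (boundary O) -> O y.
Proof.
move=> oO Ox xy; apply: contrapT => nOy.
have [t /andP[t0 t1] bz] := segment_boundary oO Ox nOy.
have := set_dist_le x bz; rewrite opprD addNKr -scaleNr enormZ normrN ger0_norm// leNgt => /negP.
by apply; apply: le_lt_trans xy; rewrite ler_piMl// enorm_ge0.
Qed.

Lemma set_dist_boundary_gt0 (O : set 'rV[R]_n) x : open O -> O x -> boundary O !=set0 ->
  0 < set_dist x (boundary O).
Proof.
move=> oO Ox b0; have [h h0 hO] := open_cube oO Ox.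
apply: lt_le_trans h0 _; apply: set_dist_ge => // y By; rewrite leNgt; apply/negP => xy.
apply: (boundary_out oO By); apply: hO => i; apply: le_lt_trans xy.
by rewrite enormB; apply: le_trans (coord_le_enorm _ i); rewrite !mxE.
Qed.

Lemma bounded_setP (O : set 'rV[R]_n) : bounded_set O ->
  exists2 B : R, 0 < B & forall x, O x -> enorm x <= B.
Proof.
move=> [M [_ /(_ (`|M| + 1))]]; have MM : M < `|M| + 1.
  by rewrite (le_lt_trans (ler_norm M))// ltrDl.
move=> /(_ MM) H; exists (n%:R * (`|M| + 1) + 1).
  by rewrite ltr_wpDl// mulr_ge0// addr_ge0.
move=> x /H xM; rewrite ler_wpDr//; apply: enorm_le => [|i]; first by rewrite addr_ge0.
apply: le_trans xM; rewrite /Num.norm/= mx_normrE.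
exact: (le_bigmax _ (fun ij : 'I_1 * 'I_n => `|x ij.1 ij.2|) (0, i)).
Qed.

(** For [n > 0] a bounded set misses some point, and a segment to that point crosses the boundary.
    Without a boundary point, [set_dist] would be the infimum of the empty set. *)
Lemma boundary_nonempty (O : set 'rV[R]_n) : (0 < n)%N -> open O -> O !=set0 ->
  bounded_set O -> boundary O !=set0.
Proof.
move=> n0 oO [x Ox] /bounded_setP[B B0 OB].
have nOy : ~ O (const_mx (B + 1)).
  move=> /OB; have := coord_le_enorm (const_mx (B + 1)) (Ordinal n0); rewrite mxE.
  move=> /le_trans H /H; rewrite ger0_norm; lra.
by have [t _ bt] := segment_boundary oO Ox nOy; eexists; exact: bt.
Qed.

End euclidean_norm.

(** * Integrals over layers and Hoelder's inequality *)

Section abstract_integrals.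
Context d (T : measurableType d) (R : realType) (mu : {measure set T -> \bar R}).
Local Open Scope ereal_scope.

Lemma measurable_poweR_comp (D : set T) (u : T -> \bar R) (p : R) :
  measurable_fun D u -> measurable_fun D (fun x => u x `^ p).
Proof. by move=> mu_; exact: (measurableT_comp (measurable_poweR p) mu_). Qed.

Lemma measurable_powR_comp (D : set T) (u : T -> R) (p : R) :
  measurable_fun D u -> measurable_fun D (fun x => (u x `^ p)%:E).
Proof.
by move=> mu_; apply/measurable_EFinP; exact: (measurableT_comp (measurable_powR p) mu_).
Qed.

(** [g] is at most the sum of [u j] times the indicator of [L j], so the layers may overlap. Both
    integrals of powers of the distance over cones are estimated this way. *)
Lemma layered_integral (D : set T) (g : T -> \bar R) (L : nat -> set T)
    (u m : nat -> R) (K q : R) :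
  measurable D -> (forall j, measurable (L j)) ->
  measurable_fun D g -> (forall x, D x -> 0 <= g x) ->
  (forall x, D x -> exists j, L j x) ->
  (forall j, (0 <= u j)%R) ->
  (forall j x, D x -> L j x -> g x <= (u j)%:E) ->
  (forall j, mu (L j `&` D) <= (m j)%:E) ->
  (0 <= q < 1)%R -> (forall j, (u j * m j <= K * q ^+ j)%R) ->
  \int[mu]_(x in D) g x <= (K / (1 - q))%:E.
Proof.
move=> mD mL mg g0 cov u0 gu muL /andP[q0 q1] um.
have mI j : measurable_fun D (fun x => (u j)%:E * (\1_(L j) x)%:E).
  by apply: measurable_funeM; exact/measurable_EFinP/measurable_indic.
have I0 j x : 0 <= (u j)%:E * (\1_(L j) x)%:E by rewrite -EFinM lee_fin mulr_ge0.
apply: (@le_trans _ _ (\int[mu]_(x in D) \sum_(j <oo) ((u j)%:E * (\1_(L j) x)%:E))).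
  apply: ge0_le_integral => //.
  - by apply: ge0_emeasurable_sum => // j x _ _; exact: I0.
  move=> x Dx; have [j Ljx] := cov x Dx.
  apply: le_trans (gu j x Dx Ljx) _; apply: le_trans (nneseries_lim_ge j.+1 _); last by [].
  by rewrite big_nat_recr//= indicE mem_set// mule1 leeDr// sume_ge0.
rewrite integral_nneseries//.
apply: lime_le.
  by apply: is_cvg_nneseries => j _ _; apply: integral_ge0 => x _; exact: I0.
apply: nearW => N; apply: (@le_trans _ _ (\sum_(0 <= j < N) (K * q ^+ j)%:E)).
  apply: lee_sum => j _; rewrite ge0_integralZl_EFin//; last first.
    exact/measurable_EFinP/measurable_indic.
  rewrite integral_indic//; apply: (@le_trans _ _ ((u j)%:E * (m j)%:E)).
    by rewrite lee_wpmul2l// lee_fin.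
  by rewrite -EFinM lee_fin.
rewrite sumEFin lee_fin big_mkord -mulr_sumr.
have K0 : (0 <= K)%R.
  have := um 0%N; rewrite expr0 mulr1; apply: le_trans; rewrite mulr_ge0// -lee_fin.
  exact: le_trans (muL 0%N).
rewrite ler_wpM2l// -[leRHS]mul1r ler_pdivlMr ?subr_gt0//.
have qN : (0 <= q ^+ N)%R by rewrite exprn_ge0.
suff -> : ((\sum_(i < N) q ^+ i) * (1 - q) = 1 - q ^+ N)%R by lra.
by rewrite mulrC -[in LHS]opprB mulNr -subrX1 opprB.
Qed.

Let LnormEr (p : R) (h : T -> \bar R) :
  'N[mu]_p%:E[h] = (\int[mu]_x (`|h x| `^ p)) `^ p^-1.
Proof. by rewrite Lnorm.unlock. Qed.

(** [u] may be infinite: either the right side is +oo, or [u] is finite almost everywhere and can be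
    replaced by [fine \o u]. Raising to the power [p] puts the bound in the form needed for Schur's
    test. *)
Lemma hoelder_powR (D : set T) (u : T -> \bar R) (v : T -> R) (p q B : R) :
  measurable D -> measurable_fun D u -> measurable_fun D v ->
  (forall x, D x -> 0 <= u x) -> (forall x, D x -> (0 <= v x)%R) ->
  (0 < p)%R -> (0 < q)%R -> (p^-1 + q^-1 = 1)%R -> (0 < B)%R ->
  \int[mu]_(x in D) (v x `^ q)%:E <= B%:E ->
  (\int[mu]_(x in D) (u x * (v x)%:E)) `^ p <=
    (B `^ (p / q))%:E * \int[mu]_(x in D) (u x `^ p).
Proof.
move=> mD mu_ mv u0 v0 p0 q0 pq B0 vB.
have mup : measurable_fun D (fun x => u x `^ p) by exact: measurable_poweR_comp.
have [Ioo|Ioo] := eqVneq (\int[mu]_(x in D) (u x `^ p)) +oo.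
  by rewrite Ioo gt0_muley ?leey// lte_fin powR_gt0.
have Iup : mu.-integrable D (fun x => u x `^ p).
  apply/integrableP; split => //; under eq_integral do rewrite gee0_abs ?poweR_ge0//.
  by rewrite ltey.
have ufin : {ae mu, forall x, D x -> u x \is a fin_num}.
  apply: filterS (integrable_ae mD Iup) => x H Dx; have := H Dx.
  rewrite !ge0_fin_numE ?poweR_ge0 ?u0//; by apply: lty_poweRy; rewrite gt_eqF.
pose f : T -> R := (fine \o u) \_ D; pose g : T -> R := v \_ D.
have mfu : measurable_fun D (fine \o u) by exact: measurableT_comp.
have mf : measurable_fun setT f by apply/(measurable_restrictT _ mD).
have mg : measurable_fun setT g by apply/(measurable_restrictT _ mD).
have := hoelder mu mf mg p0 q0 pq.
rewrite Lnorm1.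
have -> : \int[mu]_x `|(EFin \o (f \* g)%R) x| = \int[mu]_(x in D) (u x * (v x)%:E).
  rewrite [LHS](_ : _ = \int[mu]_(x in D) ((fine (u x))%:E * (v x)%:E)); last first.
    rewrite [RHS]integral_mkcond; apply: eq_integral => x _.
    rewrite /= /f /g !patchE; case: ifPn => [/set_mem Dx|_]; last by rewrite mul0r normr0.
    by rewrite normrM !ger0_norm ?v0 ?fine_ge0 ?u0// EFinM.
  apply: ge0_ae_eq_integral => //.
  - apply: emeasurable_funM; exact/measurable_EFinP.
  - by apply: emeasurable_funM => //; exact/measurable_EFinP.
  - by move=> x Dx; rewrite -EFinM lee_fin mulr_ge0 ?v0 ?fine_ge0 ?u0.
  - by move=> x Dx; rewrite mule_ge0 ?u0// lee_fin v0.
  - by apply: filterS ufin => x H Dx; rewrite fineK ?H.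
have -> : 'N[mu]_p%:E[EFin \o f] = (\int[mu]_(x in D) (u x `^ p)) `^ p^-1.
  rewrite LnormEr; apply: (congr1 (poweR^~ _)).
  rewrite [LHS](_ : _ = \int[mu]_(x in D) ((fine (u x))%:E `^ p)); last first.
    rewrite [RHS]integral_mkcond; apply: eq_integral => x _.
    rewrite /= /f !patchE; case: ifPn => [/set_mem Dx|_]; last first.
      by rewrite normr0 powR0// gt_eqF.
    by rewrite ger0_norm ?fine_ge0 ?u0.
  apply: ge0_ae_eq_integral => //.
  - by apply: measurable_poweR_comp; exact/measurable_EFinP.
  - by move=> x _; exact: poweR_ge0.
  - by move=> x _; exact: poweR_ge0.
  - by apply: filterS ufin => x H Dx; rewrite fineK ?H.
have -> : 'N[mu]_q%:E[EFin \o g] = (\int[mu]_(x in D) (v x `^ q)%:E) `^ q^-1.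
  rewrite LnormEr; apply: (congr1 (poweR^~ _)).
  rewrite [RHS]integral_mkcond; apply: eq_integral => x _.
  rewrite /= /g !patchE; case: ifPn => [/set_mem Dx|_]; last first.
    by rewrite normr0 powR0// gt_eqF.
  by rewrite ger0_norm ?v0.
set I := \int[mu]_(x in D) (u x `^ p); set J := \int[mu]_(x in D) (v x `^ q)%:E.
set L := \int[mu]_(x in D) _ => LIJ.
have L0 : 0 <= L by apply: integral_ge0 => x Dx; rewrite mule_ge0 ?u0// lee_fin v0.
have I0 : 0 <= I by apply: integral_ge0 => x _; exact: poweR_ge0.
have J0 : 0 <= J by apply: integral_ge0 => x _; rewrite lee_fin powR_ge0.
apply: le_trans (le_poweR (ltW p0) L0 LIJ) _.
rewrite poweRM ?poweR_ge0// -!poweRrM mulVf ?gt_eqF// poweRe1// muleC.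
apply: lee_wpmul2r => //; rewrite -poweR_EFin [(q^-1 * p)%R]mulrC.
by apply: le_poweR => //; rewrite divr_ge0// ltW.
Qed.

End abstract_integrals.

(** * Schur's test *)

Section schur.
Context d (T : measurableType d) (R : realType)
  (mu : {sigma_finite_measure set T -> \bar R}).
Local Open Scope ereal_scope.

Definition kernel_op (O : set T) (N : set (T * T)) (a : T -> R) (g : T -> \bar R) (x : T) : \bar R :=
  \int[mu]_(z in O `&` xsection N x) ((a z)%:E * g z).

Variables (O : set T) (N : set (T * T)).
Hypotheses (mO : measurable O) (mN : measurable N).

Let mON x : measurable (O `&` xsection N x).
Proof. by apply: measurableI => //; exact: measurable_xsection. Qed.

Let kernel_mkcond (h : T -> \bar R) (x : T) :
  \int[mu]_(z in O `&` xsection N x) h z = \int[mu]_z ((h \_ O) z * (\1_N (x, z))%:E).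
Proof.
rewrite integral_mkcond; apply: eq_integral => z _.
rewrite !patchE in_setI indicE mem_xsection; case: (z \in O) => /=; last by rewrite mul0e.
by case: (_ \in N); rewrite ?mule1 ?mule0.
Qed.

Let measurable_kernel (h : T -> \bar R) : measurable_fun O h ->
  measurable_fun setT (fun xz : T * T => (h \_ O) xz.2 * (\1_N xz)%:E).
Proof.
move=> mh; apply: emeasurable_funM; last by apply/measurable_EFinP/measurable_indic.
by apply: measurableT_comp => //; exact/(measurable_restrictT _ mO).
Qed.

Lemma measurable_kernel_op (a : T -> R) (g : T -> \bar R) :
  measurable_fun O a -> measurable_fun O g ->
  (forall x, O x -> (0 <= a x)%R) -> (forall x, O x -> 0 <= g x) ->
  measurable_fun setT (kernel_op O N a g).
Proof.
move=> ma mg a0 g0; pose h z := (a z)%:E * g z.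
have mh : measurable_fun O h by apply: emeasurable_funM => //; exact/measurable_EFinP.
have := @measurable_fun_fubini_tonelli_F _ _ T T R mu (fun xz => (h \_ O) xz.2 * (\1_N xz)%:E).
rewrite (_ : fubini_F _ _ = kernel_op O N a g); last first.
  by apply/funext => x; rewrite /kernel_op kernel_mkcond.
apply; first exact: measurable_kernel.
move=> xz; apply: mule_ge0; last by rewrite lee_fin.
rewrite patchE; case: ifPn => // /set_mem Oz; rewrite /h mule_ge0 ?g0// lee_fin; exact: a0.
Qed.

Let kernel_swap (b : T -> R) (h : T -> \bar R) :
  measurable_fun O b -> measurable_fun O h ->
  (forall x, O x -> (0 <= b x)%R) -> (forall x, O x -> 0 <= h x) ->
  \int[mu]_(x in O) ((b x)%:E * \int[mu]_(z in O `&` xsection N x) h z) =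
  \int[mu]_(z in O) (h z * \int[mu]_(x in O `&` ysection N z) (b x)%:E).
Proof.
move=> mb mh b0 h0.
pose b' := (EFin \o b) \_ O; pose h' := h \_ O.
have b'0 x : 0 <= b' x.
  by rewrite /b' patchE; case: ifPn => // /set_mem Ox; rewrite lee_fin b0.
have h'0 x : 0 <= h' x.
  by rewrite /h' patchE; case: ifPn => // /set_mem Ox; rewrite h0.
have mb' : measurable_fun setT b'.
  by apply/(measurable_restrictT _ mO); exact/measurable_EFinP.
have mh' : measurable_fun setT h' by apply/(measurable_restrictT _ mO).
have mind : measurable_fun setT (fun xz : T * T => (\1_N xz)%:E : \bar R).
  exact/measurable_EFinP/measurable_indic.
pose F (xz : T * T) := b' xz.1 * (h' xz.2 * (\1_N xz)%:E).
have mF : measurable_fun setT F.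
  apply: emeasurable_funM; first exact: (measurableT_comp mb' measurable_fst).
  by apply: emeasurable_funM => //; exact: (measurableT_comp mh' measurable_snd).
have F0 xz : 0 <= F xz by rewrite /F !mule_ge0// lee_fin.
have := @fubini_tonelli _ _ T T R mu mu F mF F0.
rewrite [X in X = _ -> _](_ : _ = \int[mu]_(x in O) ((b x)%:E * \int[mu]_(z in O `&` xsection N x) h z)).
  move=> ->; rewrite [RHS]integral_mkcond; apply: eq_integral => z _.
  rewrite /F/= [RHS]patchE /h' [in LHS]patchE; case: ifPn => [Oz|Oz]; last first.
    by under eq_integral do rewrite mul0e mule0; rewrite integral0.
  under eq_integral do rewrite muleCA.
  rewrite ge0_integralZl ?h0//; last 3 first.
  - by apply: emeasurable_funM => //; exact: (measurableT_comp mind (pair2_measurable z)).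
  - by move=> x _; rewrite mule_ge0// lee_fin.
  - exact: set_mem.
  congr (_ * _); rewrite [RHS]integral_mkcond; apply: eq_integral => x _.
  rewrite /b' !patchE in_setI indicE mem_ysection; case: (x \in O) => /=; last by rewrite mul0e.
  by case: (_ \in N); rewrite ?mule1 ?mule0.
rewrite [RHS]integral_mkcond; apply: eq_integral => x _.
rewrite /F/= patchE; case: ifPn => [Ox|Ox]; last first.
  rewrite /b' patchE (negbTE Ox).
  by under eq_integral do rewrite mul0e; rewrite integral0.
rewrite ge0_integralZl//; last 2 first.
- by apply: emeasurable_funM => //; exact: (measurableT_comp mind (pair1_measurable x)).
- by move=> z _; rewrite mule_ge0// lee_fin.
by rewrite /b' patchE Ox kernel_mkcond.
Qed.

(** Hoelder's inequality in [z], with the first hypothesis, bounds the p-th power of the operator at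
    [x] by an integral over the section. Tonelli's theorem then exchanges the integrals, and the
    second hypothesis bounds the inner one; the powers of [phi] cancel. *)
Lemma schur_test (a w phi : T -> R) (g : T -> \bar R) (p q C1 C2 : R) :
  measurable_fun O a -> measurable_fun O w -> measurable_fun O phi -> measurable_fun O g ->
  (forall x, O x -> [/\ 0 < a x, 0 < w x & 0 < phi x]%R) -> (forall x, O x -> 0 <= g x) ->
  (0 < p)%R -> (0 < q)%R -> (p^-1 + q^-1 = 1)%R -> (0 < C1)%R -> (0 <= C2)%R ->
  (forall x, O x -> \int[mu]_(z in O `&` xsection N x) (a z * phi z `^ (- q))%:E <=
    (C1 * phi x `^ (- q))%:E) ->
  (forall z, O z -> \int[mu]_(x in O `&` ysection N z) (w x * phi x `^ (- p))%:E <=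
    (C2 * (w z * phi z `^ (- p) / a z))%:E) ->
  \int[mu]_(x in O) (kernel_op O N a g x `^ p * (w x)%:E) <=
    (C1 `^ (p / q) * C2)%:E * \int[mu]_(x in O) (g x `^ p * (w x)%:E).
Proof.
move=> ma mw mphi mg pos g0 p0 q0 pq C10 C20 H1 H2.
have a0 x : O x -> (0 <= a x)%R by move=> /pos[/ltW].
have w0 x : O x -> (0 <= w x)%R by move=> /pos[_ /ltW].
have mphip r : measurable_fun O (fun x => phi x `^ r)%R.
  exact: (measurableT_comp (measurable_powR r) mphi).
have map r : measurable_fun O (fun x => a x `^ r)%R.
  exact: (measurableT_comp (measurable_powR r) ma).
pose b x := (w x * phi x `^ (- p))%R.
pose h z := (a z * phi z `^ p)%:E * g z `^ p.
have mb : measurable_fun O b by exact: measurable_funM.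
have mgp : measurable_fun O (fun x => g x `^ p) by exact: measurable_poweR_comp.
have mh : measurable_fun O h.
  by apply: emeasurable_funM => //; apply/measurable_EFinP; exact: measurable_funM.
have b0 x : O x -> (0 <= b x)%R by move=> Ox; rewrite mulr_ge0 ?w0 ?powR_ge0.
have h0 x : O x -> 0 <= h x.
  by move=> Ox; rewrite mule_ge0 ?poweR_ge0// lee_fin mulr_ge0 ?a0 ?powR_ge0.
have mK := measurable_kernel_op ma mg a0 g0.
have mbK : measurable_fun O (fun x => (b x)%:E * \int[mu]_(z in O `&` xsection N x) h z).
  apply: emeasurable_funM; first exact/measurable_EFinP.
  have := @measurable_kernel_op (cst 1%R) h (measurable_cst _) mh (fun _ _ => ler01) h0.
  rewrite (_ : kernel_op _ _ _ _ = fun x => \int[mu]_(z in O `&` xsection N x) h z); last first.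
    by apply/funext => x; apply: eq_integral => z _; rewrite mul1e.
  exact: measurable_funS.
have bK0 x : O x -> 0 <= (b x)%:E * \int[mu]_(z in O `&` xsection N x) h z.
  by move=> Ox; rewrite mule_ge0 ?lee_fin ?b0//; apply: integral_ge0 => z [/h0].
apply: (@le_trans _ _ (\int[mu]_(x in O) ((C1 `^ (p / q))%:E *
    ((b x)%:E * \int[mu]_(z in O `&` xsection N x) h z)))).
  apply: ge0_le_integral => //.
  - by move=> x Ox; rewrite mule_ge0 ?poweR_ge0// lee_fin w0.
  - apply: emeasurable_funM; last exact/measurable_EFinP.
    by apply: measurable_poweR_comp; exact: measurable_funS mK.
  - exact: measurable_funeM.
  move=> x Ox; have [ax wx phix] := pos x Ox.
  have pq1 : (p / p = 1)%R by rewrite mulfV// gt_eqF.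
  have qq1 : (q / q = 1)%R by rewrite mulfV// gt_eqF.
  have Hk : kernel_op O N a g x `^ p <= ((C1 * phi x `^ (- q)) `^ (p / q))%:E *
      \int[mu]_(z in O `&` xsection N x) h z.
    (* The kernel is split as [a = (a^(1/p) phi) (a^(1/q) / phi)]. *)
    have -> : kernel_op O N a g x = \int[mu]_(z in O `&` xsection N x)
        (((a z `^ p^-1 * phi z)%:E * g z) * (a z `^ q^-1 / phi z)%:E).
      apply: eq_integral => z /set_mem[Oz _]; have [az _ phiz] := pos z Oz.
      rewrite muleAC -EFinM; congr (_%:E * _).
      rewrite mulrACA mulfV ?gt_eqF// mulr1 -powRD ?pq ?powRr1 ?ltW//.
      by rewrite oner_eq0.
    have -> : \int[mu]_(z in O `&` xsection N x) h z =
        \int[mu]_(z in O `&` xsection N x) (((a z `^ p^-1 * phi z)%:E * g z) `^ p).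
      apply: eq_integral => z /set_mem[Oz _]; have [az _ phiz] := pos z Oz.
      have aphi : (0 <= a z `^ p^-1 * phi z)%R by rewrite mulr_ge0 ?powR_ge0// ltW.
      rewrite poweRM ?g0//; congr (_ * _).
      by rewrite poweR_EFin powRM ?powR_ge0// ?(ltW phiz)// -powRrM mulVf ?gt_eqF// powRr1 ?ltW.
    apply: hoelder_powR => //.
    - apply: emeasurable_funM; last by apply: measurable_funS mg => // z [].
      apply/measurable_EFinP; apply: measurable_funM.
        by apply: measurable_funS (map _) => // z [].
      by apply: measurable_funS mphi => // z [].
    - apply: measurable_funM; first by apply: measurable_funS (map _) => // z [].
      have mV := mphip (-1)%R.
      apply: (@eq_measurable_fun _ _ _ _ _ (fun z => phi z `^ (-1))%R).
        by move=> z /set_mem[/pos[_ _ /ltW phiz] _]; rewrite powR_inv1.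
      by apply: measurable_funS mV => // z [].
    - move=> z [Oz _]; have [az _ phiz] := pos z Oz.
      by rewrite mule_ge0 ?g0// lee_fin mulr_ge0 ?powR_ge0// ltW.
    - move=> z [Oz _]; have [az _ phiz] := pos z Oz.
      by rewrite divr_ge0 ?powR_ge0// ltW.
    - by rewrite mulr_gt0// powR_gt0.
    apply: le_trans (H1 x Ox); rewrite le_eqVlt; apply/orP; left; apply/eqP.
    apply: eq_integral => z /set_mem[Oz _]; have [az _ phiz] := pos z Oz.
    rewrite powRM ?powR_ge0 ?invr_ge0 ?(ltW phiz)// -powRrM mulVf ?gt_eqF// powRr1 ?(ltW az)//.
    by rewrite -powR_inv1 ?(ltW phiz)// -powRrM mulN1r.
  have wx0 : 0 <= (w x)%:E by rewrite lee_fin ltW.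
  apply: le_trans (lee_wpmul2r wx0 Hk) _.
  rewrite powRM ?(ltW C10) ?powR_ge0// -powRrM.
  have -> : (- q * (p / q) = - p)%R by field; rewrite gt_eqF.
  by rewrite /b muleAC -EFinM muleA -EFinM mulrA mulrAC.
rewrite ge0_integralZl//; last by rewrite lee_fin powR_ge0.
rewrite EFinM -muleA; apply: lee_wpmul2l; first by rewrite lee_fin powR_ge0.
rewrite kernel_swap//.
have mgw : measurable_fun O (fun x => g x `^ p * (w x)%:E).
  by apply: emeasurable_funM => //; exact/measurable_EFinP.
have gw0 x : O x -> 0 <= g x `^ p * (w x)%:E.
  by move=> Ox; rewrite mule_ge0 ?poweR_ge0// lee_fin w0.
rewrite -(ge0_integralZl mu mO mgw gw0); last by rewrite lee_fin.
have int0 z : 0 <= \int[mu]_(x in O `&` ysection N z) (b x)%:E.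
  by apply: integral_ge0 => x [Ox _]; rewrite lee_fin b0.
apply: ge0_le_integral => //.
- by move=> z Oz; rewrite mule_ge0 ?h0.
- apply: emeasurable_funM => //.
  have mb' : measurable_fun setT ((EFin \o b) \_ O).
    by apply/(measurable_restrictT _ mO); exact/measurable_EFinP.
  have mind : measurable_fun setT (fun xz : T * T => (\1_N xz)%:E : \bar R).
    exact/measurable_EFinP/measurable_indic.
  have := @measurable_fun_fubini_tonelli_G _ _ T T R mu
    (fun xz => ((EFin \o b) \_ O) xz.1 * (\1_N xz)%:E).
  rewrite (_ : fubini_G _ _ = fun z => \int[mu]_(x in O `&` ysection N z) (b x)%:E); last first.
    apply/funext => z; rewrite [RHS]integral_mkcond; apply: eq_integral => x _.
    rewrite !patchE in_setI indicE mem_ysection; case: (x \in O) => /=; last by rewrite mul0e.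
    by case: (_ \in N); rewrite ?mule1 ?mule0.
  move=> H; apply: measurable_funS (H _ _) => //.
    by apply: emeasurable_funM => //; exact: (measurableT_comp mb' measurable_fst).
  move=> xz; apply: mule_ge0; last by rewrite lee_fin.
  by rewrite patchE; case: ifPn => // /set_mem Oz; rewrite lee_fin b0.
- exact: measurable_funeM.
move=> z Oz; have [az wz phiz] := pos z Oz.
apply: le_trans (lee_wpmul2l (h0 z Oz) (H2 z Oz)) _.
rewrite /h [leLHS]muleAC [leLHS]muleC [leRHS]muleCA -!EFinM.
have pz := powR_gt0 p phiz.
rewrite powRN (_ : a z * phi z `^ p * (C2 * (w z / phi z `^ p / a z)) = C2 * w z)%R//.
by field; rewrite !gt_eqF.
Qed.

End schur.

(** * Assouad exponents and the volume of tubes *)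

Section covering.
Context {R : realType} {n : nat}.
Local Notation T := (lebesgue_rV R n).
Local Notation mu := (mu_rV R n).
Implicit Types (x y z c : 'rV[R]_n) (E : set 'rV[R]_n).

Lemma eball_sub_cube x r : eball x r `<=` cube x r.
Proof.
move=> y xy i; apply: le_lt_trans xy.
by apply: le_trans (coord_le_enorm _ i); rewrite !mxE.
Qed.

Lemma mu_cover_le (A : set T) (s : seq 'rV[R]_n) (r : R) : 0 < r ->
  A `<=` \bigcup_(c in [set` s]) cube c r ->
  (mu A <= ((size s)%:R * (2 * r) ^+ n)%:E)%E.
Proof.
move=> r0 As; pose U (s : seq 'rV[R]_n) : set T := \big[setU/set0]_(c <- s) cube c r.
have AU : A `<=` U s.
  by move=> x /As[c /= cs cx]; rewrite /U -bigcup_seq; exists c.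
have mU t : measurable (U t).
  by apply: bigsetU_measurable => c _; exact: measurable_cube.
apply: (@le_trans _ _ (mu (U s))); first exact: le_outer_measure.
elim: (s) => [|c t IH]; first by rewrite /U big_nil measure0 mul0r.
rewrite [U _](_ : _ = cube c r `|` U t); last by rewrite /U big_cons.
apply: le_trans (measureU2 mu (measurable_cube c r) (mU t)) _.
have E1 : (mu (cube c r : set T) <= ((2 * r) ^+ n)%:E)%E by rewrite mu_cube.
apply: le_trans (leeD E1 IH) _.
rewrite -EFinD lee_fin (_ : (size (c :: t))%:R = (size t)%:R + 1 :> R); last by rewrite natr1.
by set v := (2 * r) ^+ n; rewrite mulrDl mul1r [leLHS]addrC.
Qed.

(** A grid covers the cube around [x], with a number of points per axis proportional to [rho / r].
    This makes the set of exponents nonempty, so that exponents close to its infimum exist. *)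
Lemma assouad_exponent_dim E : (0 < n)%N -> assouad_exponent E n%:R.
Proof.
move=> n0; split; first by rewrite ler0n.
have C0 : 0 < (2 * n%:R + 1 : R) ^+ n by rewrite exprn_gt0// ltr_wpDl// mulr_ge0.
exists ((2 * n%:R + 1) ^+ n) => // r rho /andP[r0 rr].
have rho0 : 0 < rho by exact: lt_trans rr.
have n0R : 0 < n%:R :> R by rewrite ltr0n.
apply: ge_ereal_sup => _ [x Ex <-].
(* With this mesh, coordinates closer than [s] give a Euclidean distance below [n * s = r]. *)
pose s := r / n%:R; have s0 : 0 < s by rewrite divr_gt0.
pose M := (Num.truncn (2 * rho / s)).+1.
pose cen (phi : {ffun 'I_n -> 'I_M}) : 'rV[R]_n := \row_i (x 0 i - rho + (phi i)%:R * s).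
apply: (@le_trans _ _ ((M ^ n)%N%:R)%:E).
  apply: ereal_inf_lbound; exists [seq cen phi | phi <- enum {: {ffun 'I_n -> 'I_M}}]; last first.
    by rewrite size_map -cardE card_ffun !card_ord.
  move=> y [xy _].
  have xyi i : 0 <= y 0 i - x 0 i + rho < 2 * rho.
    by have := eball_sub_cube xy i; rewrite ltr_norml; lra.
  have tlt i : (Num.truncn ((y 0 i - x 0 i + rho) / s)%R < M)%N.
    rewrite ltnS; apply: le_truncn; rewrite ler_pM2r ?invr_gt0//.
    by have := xyi i; lra.
  exists (cen [ffun i => Ordinal (tlt i)]).
    by apply/mapP; exists [ffun i => Ordinal (tlt i)]; rewrite ?mem_enum.
  have nh : n%:R * s = r by rewrite mulrC divfK// gt_eqF.
  rewrite /eball/= -nh enormB.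
  have H i : `|(cen [ffun i => Ordinal (tlt i)] - y) 0 i| < s.
    rewrite !mxE ffunE/=; have [y0 y1] := andP (xyi i).
    have ys0 : 0 <= (y 0 i - x 0 i + rho) / s by rewrite divr_ge0// ltW.
    have := truncn_itv ys0; set t := (Num.truncn _)%:R.
    rewrite ler_pdivlMr// ltr_pdivrMr// -natr1 mulrDl mul1r -/t ltr_norml.
    lra.
  (* [enorm_le] gives only a weak inequality; the maximum over finitely many coordinates keeps the
     strict one. *)
  pose m := \big[Num.max/0]_(i < n) `|(cen [ffun i => Ordinal (tlt i)] - y) 0 i|.
  apply: (@le_lt_trans _ _ (n%:R * m)).
    apply: enorm_le => [|i]; first exact: bigmax_ge_id.
    by apply: le_bigmax.
  by rewrite ltr_pM2l//; apply/bigmax_ltP; split => // i _; exact: H.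
have M1 : (M%:R : R) <= (2 * n%:R + 1) * (rho / r).
  have sE : 2 * rho / s = 2 * n%:R * (rho / r) by rewrite /s; field; rewrite !gt_eqF.
  have rr1 : 1 <= rho / r by rewrite ler_pdivlMr// mul1r ltW.
  rewrite (_ : _ * (rho / r) = 2 * n%:R * (rho / r) + rho / r); last by ring.
  rewrite /M -natr1; apply: lerD => //.
  by rewrite -sE truncn_le divr_ge0// ?mulr_ge0// ltW.
rewrite lee_fin natrX powR_mulrn ?divr_ge0 ?(ltW r0) ?(ltW rho0)// -exprMn.
by apply: lerXn2r => //; rewrite nnegrE ?ler0n// (le_trans _ M1).
Qed.

Lemma assouad_exponent_lt E (r : R) : (0 < n)%N -> assouad_dim E < r ->
  exists2 l, assouad_exponent E l & l < r.
Proof.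
move=> n0 Er; have hi : has_inf (assouad_exponent E).
  split; first by exists n%:R; exact: assouad_exponent_dim.
  by exists 0 => l [].
have e0 : 0 < r - assouad_dim E by rewrite subr_gt0.
have [l El] := inf_adherent e0 hi.
by rewrite /assouad_dim addrC subrK => lr; exists l.
Qed.

(** A point of the tube has a point of [E] within [r], which lies in the ball of radius
    [rho + r < 2 * rho] about [x]. Hence balls of radius [r] covering that part of [E] become, with
    doubled radius, a cover of the tube. *)
Lemma tube_measure E (l : R) : assouad_exponent E l ->
  exists2 C : R, 0 < C & forall x (r rho : R), E x -> 0 < r < rho ->
    (mu ([set y | enorm (y - x) < rho /\ set_dist y E < r]%R) <=
      (C * (rho / r) `^ l * r ^+ n)%:E)%E.
Proof.
move=> [l0 [C C0 HC]]; exists ((C * 2 `^ l + 1) * 4 ^+ n).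
  by rewrite mulr_gt0 ?exprn_gt0// addr_gt0// mulr_gt0// powR_gt0.
move=> x r rho Ex /andP[r0 rr].
have rho0 : 0 < rho by exact: lt_trans rr.
have E0 : E !=set0 by exists x.
have Hx : (covering_number r (eball x (2 * rho) `&` E) <= (C * (2 * rho / r) `^ l)%:E)%E.
  apply: le_trans (HC r (2 * rho) _); last by apply/andP; split=> //; lra.
  by apply: ereal_sup_ubound; exists x.
have rr1 : 1 <= rho / r by rewrite ler_pdivlMr// mul1r ltW.
(* The infimum defining the covering number is approached up to 1; this 1 is absorbed later because
   [rho / r >= 1]. *)
have [s [cs ss]] : exists s : seq 'rV[R]_n,
    eball x (2 * rho) `&` E `<=` \bigcup_(c in [set` s]) eball c r /\
    (size s)%:R <= C * (2 * rho / r) `^ l + 1.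
  apply: contrapT => H; have : (covering_number r (eball x (2 * rho) `&` E) >=
      (C * (2 * rho / r) `^ l + 1)%:E)%E.
    apply: le_ereal_inf_tmp => _ [s /= cs <-]; rewrite lee_fin leNgt; apply/negP => ss.
    by apply: H; exists s; split => //; exact: ltW.
  by move=> /le_trans/(_ Hx); rewrite lee_fin gerDl leNgt ltr01.
apply: (@le_trans _ _ ((size s)%:R * (2 * (2 * r)) ^+ n)%:E).
  apply: mu_cover_le; first by rewrite mulr_gt0.
  move=> y [yx yE]; have [b Eb yb] := set_dist_lt E0 yE.
  have [|c cs' cb] := cs b.
    split => //; rewrite /eball/=; apply: le_lt_trans (enorm_tri _ y _) _.
    by rewrite enormB; lra.
  exists c => //; apply: eball_sub_cube; rewrite /eball/=.
  by apply: le_lt_trans (enorm_tri _ b _) _; move: cb; rewrite /eball/=; lra.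
rewrite lee_fin mulrA exprMn [X in _ <= X](_ : _ =
   ((C * 2 `^ l + 1) * (rho / r) `^ l) * ((2 * 2) ^+ n * r ^+ n)); last first.
  by rewrite (_ : 2 * 2 = 4 :> R); [ring|ring].
rewrite ler_wpM2r// ?mulr_ge0 ?exprn_ge0 ?(ltW r0)//; apply: le_trans ss _.
rewrite -mulrA powRM// ?divr_ge0 ?(ltW r0) ?(ltW rho0)// mulrDl mul1r mulrA lerD2l.
by rewrite -[leLHS](congr1 (fun f => f l) (@powR1 R)) le_powR.
Qed.

End covering.

Section powers.
Context {R : realType}.
Implicit Types (x y t s e : R).

Lemma ge_powRN x y s : s <= 0 -> 0 < x -> x <= y -> y `^ s <= x `^ s.
Proof.
move=> s0 x0 xy; have y0 := lt_le_trans x0 xy.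
rewrite -[s]opprK !(powRN _ (- s)) lef_pV2 ?posrE ?powR_gt0//.
by apply: le_powR => //; [rewrite oppr_ge0|exact: ltW].
Qed.

Lemma powR_layer t y s : 0 < t -> t / 2 < y -> y <= t -> y `^ s <= 2 `^ `|s| * t `^ s.
Proof.
move=> t0 ty yt; have y0 : 0 < y by apply: le_lt_trans ty; rewrite divr_ge0// ltW.
have [s0|s0] := leP 0 s.
  apply: (@le_trans _ _ (t `^ s)); first by apply: le_powR => //; exact: ltW.
  rewrite ler_peMl ?powR_ge0// -[leLHS](powRr0 2); apply: ler_powR => //.
  by rewrite ler1n.
have t20 : 0 < t / 2 by rewrite divr_gt0.
apply: (le_trans (ge_powRN (ltW s0) t20 (ltW ty))).
rewrite powRM ?(ltW t0) ?invr_ge0// mulrC ler_wpM2r ?powR_ge0//.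
by rewrite -powR_inv1// -powRrM mulN1r ltr0_norm.
Qed.

Lemma powR_lt1 x e : 0 < x < 1 -> 0 < e -> x `^ e < 1.
Proof.
move=> /andP[x0 x1] e0; have := @gt0_ltr_powR _ _ e0 x 1.
by rewrite powR1 !nnegrE (ltW x0) ler01; apply.
Qed.

Lemma half_lt x y : 0 < x -> x < y -> x / 2 < y.
Proof. lra. Qed.

(** Value times volume for one boundary layer in [integral_ysection_cone]; what matters is the
    exponent [n + s - l] of [t]. *)
Lemma tube_exponents (n : nat) (c C t Q s l : R) : 0 < t -> 0 < Q ->
  (c * (t * Q) `^ s) * (C * (4 * Q / (2 * (t * Q))) `^ l * (2 * (t * Q)) ^+ n) =
  (c * C * 2 `^ l * 2 ^+ n) * Q `^ (n%:R + s) * t `^ (n%:R + s - l).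
Proof.
move=> t0 Q0; have tn : t != 0 by rewrite gt_eqF.
have Qn : Q != 0 by rewrite gt_eqF.
rewrite (_ : 4 * Q / (2 * (t * Q)) = 2 * t^-1); last by field; rewrite tn.
rewrite [(t * Q) `^ s]powRM ?(ltW t0) ?(ltW Q0)// [(2 * t^-1) `^ l]powRM ?invr_ge0 ?(ltW t0)//.
rewrite [(2 * (t * Q)) ^+ n]exprMn [(t * Q) ^+ n]exprMn.
have -> : t^-1 `^ l = t `^ (- l) by rewrite -powR_inv1 ?(ltW t0)// -powRrM mulN1r.
rewrite -(powR_mulrn n (ltW t0)) -(powR_mulrn n (ltW Q0)).
rewrite [Q `^ (_ + _)]powRD ?Qn ?implybT//.
rewrite [t `^ (_ - _)]powRD ?tn ?implybT// [t `^ (_ + _)]powRD ?tn ?implybT//.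
ring.
Qed.

(** The same bookkeeping for [integral_xsection_cone], where [t] is left with the exponent
    [- eta]. *)
Lemma cone_exponents (n : nat) (t r a eta : R) : 0 < t -> 0 < r -> 0 < a ->
  (t * r / a) `^ (- (n%:R + eta)) * (2 * (2 * (t * r))) ^+ n =
  a `^ (n%:R + eta) * 4 ^+ n * r `^ (- eta) * t `^ (- eta).
Proof.
move=> t0 r0 a0; have tr0 : 0 < t * r by rewrite mulr_gt0.
have trn : t * r != 0 by rewrite gt_eqF.
rewrite [(t * r / a) `^ _]powRM ?invr_ge0 ?(ltW tr0) ?(ltW a0)//.
have -> : a^-1 `^ (- (n%:R + eta)) = a `^ (n%:R + eta).
  by rewrite -powR_inv1 ?(ltW a0)// -powRrM mulN1r opprK.
rewrite mulrA (_ : 2 * 2 = 4 :> R); last ring.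
rewrite exprMn -(powR_mulrn n (ltW tr0)) opprD [(t * r) `^ (_ - _)]powRD ?trn ?implybT//.
rewrite [RHS](_ : _ = a `^ (n%:R + eta) * 4 ^+ n * (t * r) `^ (- eta)); last first.
  by rewrite [(t * r) `^ _]powRM ?(ltW t0) ?(ltW r0)//; ring.
have H : (t * r) `^ (- n%:R) * (t * r) `^ n%:R = 1.
  by rewrite -powRD ?addNr ?powRr0// trn implybT.
by rewrite -[RHS]mulr1 -[X in _ = _ * X]H; ring.
Qed.

End powers.

(** * Integrals of powers of the distance over cones *)

Section distance.
Context {R : realType} {n : nat} (O : set 'rV[R]_n).
Local Notation T := (lebesgue_rV R n).
Local Notation mu := (mu_rV R n).
Hypotheses (oO : open O) (bO : boundary O !=set0).
Implicit Types (x y z : 'rV[R]_n).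

Definition bdist x := set_dist x (boundary O).
Local Notation d := bdist.

Lemma bdist_gt0 x : O x -> 0 < d x.
Proof. by move=> Ox; exact: set_dist_boundary_gt0. Qed.

Lemma bdist_ge0 x : 0 <= d x.
Proof. by apply: set_dist_ge => // y _; exact: enorm_ge0. Qed.

Lemma bdist_lip x y : d x <= d y + enorm (x - y).
Proof. exact: set_dist_lip. Qed.

Lemma measurable_bdist : measurable_fun (setT : set T) (d : T -> R).
Proof.
apply: measurable_continuous => t; apply: cube_open => x /= tx.
have e0 : 0 < (d x - t) / (n%:R + 1) by rewrite divr_gt0 ?subr_gt0// ltr_wpDl.
exists ((d x - t) / (n%:R + 1)) => // y xy /=.
have H := enorm_cube xy (ltW e0).
have := bdist_lip x y; rewrite enormB.
have : n%:R * ((d x - t) / (n%:R + 1)) < d x - t.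
  by rewrite mulrA ltr_pdivrMr ?ltr_wpDl// mulrC ltr_pM2l ?subr_gt0// ltrDl.
lra.
Qed.

(** For fixed [z] the section is a ball about [z]; for fixed [x] it is the region that contains the
    John curve starting at [x]. *)
Definition cone (A : R) : set (T * T) := [set xz | enorm (xz.1 - xz.2 : 'rV[R]_n) <= A * d xz.2].

Lemma measurable_cone A : 0 <= A -> measurable (cone A).
Proof.
move=> A0; pose h (xz : T * T) : R := (A * d xz.2) ^+ 2 - \sum_(i < n) (xz.1 0 i - xz.2 0 i) ^+ 2.
have mh : measurable_fun setT h.
  have m1 (i : 'I_n) : measurable_fun setT (fun xz : T * T => xz.1 0 i : R).
    exact: (measurableT_comp (measurable_coord i) measurable_fst).
  have m2 (i : 'I_n) : measurable_fun setT (fun xz : T * T => xz.2 0 i : R).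
    exact: (measurableT_comp (measurable_coord i) measurable_snd).
  have md : measurable_fun setT (fun xz : T * T => d xz.2).
    exact: (measurableT_comp measurable_bdist measurable_snd).
  apply: measurable_funB.
    apply: (measurable_funX 2); apply: measurable_funM => //.
  apply: measurable_sum => i; apply: measurable_funX; exact: measurable_funB.
rewrite (_ : cone A = setT `&` h @^-1` `[0, +oo[); first by apply: mh.
rewrite setTI; apply/seteqP; split => -[x z]/=; rewrite in_itv/= andbT subr_ge0.
  move=> H; rewrite (eq_bigr (fun i => (x - z : 'rV[R]_n) 0 i ^+ 2)); last by move=> i _; rewrite !mxE.
  by rewrite -enorm_sqr ler_pXn2r// nnegrE ?enorm_ge0// mulr_ge0// bdist_ge0.
rewrite (eq_bigr (fun i => (x - z : 'rV[R]_n) 0 i ^+ 2)); last by move=> i _; rewrite !mxE.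
by rewrite -enorm_sqr ler_pXn2r// nnegrE ?enorm_ge0// mulr_ge0// bdist_ge0.
Qed.

Let mO : measurable (O : set T) := measurable_open oO.

Let md D : measurable_fun (D : set T) (d : T -> R).
Proof. exact: measurable_funS measurable_bdist. Qed.

Lemma xsection_cone A x : xsection (cone A) x = [set z | enorm (x - z) <= A * d z].
Proof. by apply/seteqP; split => z; rewrite /xsection/= inE. Qed.

Lemma ysection_cone A z : ysection (cone A) z = [set x | enorm (x - z) <= A * d z].
Proof. by apply/seteqP; split => x; rewrite /ysection/= inE. Qed.

Lemma measurable_layer (a b : R) : measurable ([set y | a < d y <= b] : set T).
Proof.
rewrite (_ : [set y | _] = setT `&` d @^-1` `]a, b]); first by apply: measurable_bdist.
by rewrite setTI; apply/seteqP; split => y /=; rewrite in_itv.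
Qed.

(** On the ball about [z], [d] is at most [(A + 1) * d z]. The layer where [d] is about [2^-j] times
    this bound lies in a tube around the boundary, and value times volume decays like [2^-j] to the
    power [n + s - l], which is positive. *)
Lemma integral_ysection_cone (l s A : R) : assouad_exponent (boundary O) l ->
  l < n%:R + s -> 0 <= A ->
  exists2 C : R, 0 < C & forall z, O z ->
   (\int[mu]_(y in O `&` ysection (cone A) z) (d y `^ s)%:E <= (C * d z `^ (n%:R + s))%:E)%E.
Proof.
move=> El ls A0; have [C1 C10 HC1] := tube_measure El.
pose e := n%:R + s - l; have e0 : 0 < e by rewrite subr_gt0.
pose q := (2^-1 : R) `^ e.
have q1 : q < 1 by apply: powR_lt1 => //; lra.
have q0 : 0 < q by rewrite powR_gt0.
pose K0 := 2 `^ `|s| * C1 * 2 `^ l * 2 ^+ n.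
have K00 : 0 < K0 by rewrite /K0 !mulr_gt0 ?powR_gt0// exprn_gt0.
have A1 : 0 < A + 1 by lra.
exists (K0 * (A + 1) `^ (n%:R + s) / (1 - q)).
  by rewrite divr_gt0 ?subr_gt0// mulr_gt0// powR_gt0.
move=> z Oz; have r0 := bdist_gt0 Oz; set r := d z in r0 *.
set R' := (A + 1) * r; have R0 : 0 < R' by rewrite mulr_gt0.
(* A nearly closest boundary point serves as the center of the tubes; the ball of radius [4 * R']
   about it contains the ball about [z]. *)
have [x Ex zx] : exists2 x, boundary O x & enorm (z - x) < 2 * r.
  by apply: set_dist_lt => //; rewrite -/(d z) -/r; lra.
pose t j : R := 2^-1 ^+ j.
have t0 j : 0 < t j by rewrite exprn_gt0.
have t1 j : t j <= 1 by apply: exprn_ile1; lra.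
have mD : measurable (O `&` ysection (cone A) z : set T).
  by apply: measurableI => //; apply: measurable_ysection; exact: measurable_cone.
have -> : (K0 * (A + 1) `^ (n%:R + s) / (1 - q) * r `^ (n%:R + s))%:E =
    (K0 * R' `^ (n%:R + s) / (1 - q))%:E.
  by congr EFin; rewrite /R' powRM ?(ltW A1) ?(ltW r0)//; ring.
apply: (@layered_integral _ T R mu _ _ (fun j => [set y | t j * R' / 2 < d y <= t j * R'])
  (fun j => 2 `^ `|s| * (t j * R') `^ s)
  (fun j => C1 * (4 * R' / (2 * (t j * R'))) `^ l * (2 * (t j * R')) ^+ n) _ q mD).
- by move=> j; exact: measurable_layer.
- by apply: measurable_powR_comp; exact: md.
- by move=> y _; rewrite lee_fin powR_ge0.
- move=> y [Oy]; rewrite ysection_cone/= => yz.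
  have dy0 := bdist_gt0 Oy.
  have dyR : d y <= R' by rewrite /R' mulrDl mul1r addrC; apply: le_trans (bdist_lip y z) _; rewrite lerD2l.
  (* The least such [j] also gives [d y <= t j * R']: by minimality if [j > 0], by [dyR] if
     [j = 0]. *)
  have ex : exists j, t j * R' / 2 < d y.
    exists (Num.bound (R' / d y)).
    set b := Num.bound _; have B : R' / d y < 2 ^+ b.
      apply: (lt_trans (archi_boundP _)); first by rewrite divr_ge0// ltW.
      by rewrite -natrX ltr_nat ltn_expl.
    have : t b * R' < d y by rewrite /t exprVn mulrC ltr_pdivrMr ?exprn_gt0// mulrC -ltr_pdivrMr.
    by apply: half_lt; rewrite mulr_gt0.
  have [j jy min_j] := ex_minnP ex; exists j; rewrite /= jy/=.
  case: j jy min_j => [|j] jy min_j; first by rewrite /t expr0 mul1r.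
  rewrite leNgt; apply/negP => H.
  have /min_j : t j * R' / 2 < d y by apply: le_lt_trans H; rewrite /t exprS; lra.
  by rewrite ltnn.
- by move=> j; rewrite mulr_ge0 ?powR_ge0.
- move=> j y _ /andP[y1 y2]; rewrite lee_fin; apply: powR_layer => //.
  by rewrite mulr_gt0.
- move=> j; apply: le_trans (HC1 x (2 * (t j * R')) (4 * R') Ex _); last first.
    have := t0 j; have := t1 j => ? ?; apply/andP; split; first by rewrite !mulr_gt0.
    by rewrite mulrA ltr_pM2r//; lra.
  apply: le_outer_measure => y [/andP[_ dy] [Oy]]; rewrite ysection_cone/= => yz; split.
    apply: le_lt_trans (enorm_tri _ z _) _; rewrite /R'.
    have : A * r >= 0 by rewrite mulr_ge0// ltW.
    move: yz; rewrite -/r; lra.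
  apply: le_lt_trans dy _; rewrite ltr_pMl ?mulr_gt0//; lra.
- by rewrite (ltW q0) q1.
- move=> j; set tj := t j; have tj0 : 0 < tj by exact: t0.
  rewrite [leRHS](_ : _ = K0 * R' `^ (n%:R + s) * tj `^ e); last first.
    by rewrite /q /tj /t -powR_expr// invr_ge0.
  by rewrite tube_exponents.
Qed.

(** The layers are those with [|x - z|] about [2^j * d x]. There [d z] is at least
    [2^j * d x / (2 A)], so the volume of a cube about [x] suffices and [eta > 0] makes the sum
    converge. *)
Lemma integral_xsection_cone (eta A : R) : 0 < eta -> 1 <= A ->
  exists2 C : R, 0 < C & forall x, O x ->
   (\int[mu]_(z in O `&` xsection (cone A) x) (d z `^ (- (n%:R + eta)))%:E <=
    (C * d x `^ (- eta))%:E)%E.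
Proof.
move=> eta0 A1; pose q := (2^-1 : R) `^ eta.
have q1 : q < 1 by apply: powR_lt1 => //; lra.
have q0 : 0 < q by rewrite powR_gt0.
have A20 : 0 < 2 * A by lra.
pose K0 := (2 * A) `^ (n%:R + eta) * 4 ^+ n.
have K00 : 0 < K0 by rewrite /K0 mulr_gt0 ?powR_gt0// exprn_gt0.
exists (K0 / (1 - q)); first by rewrite divr_gt0 ?subr_gt0.
move=> x Ox; have r0 := bdist_gt0 Ox; set r := d x in r0 *.
have -> : (K0 / (1 - q) * r `^ (- eta))%:E = (K0 * r `^ (- eta) / (1 - q))%:E.
  by congr EFin; ring.
have mD : measurable (O `&` xsection (cone A) x : set T).
  apply: measurableI => //; apply: measurable_xsection; apply: measurable_cone; lra.
pose t j : R := 2 ^+ j.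
have t0 j : 0 < t j by rewrite exprn_gt0.
have mL j : measurable (cube x (2 * (t j * r)) `&` [set z | t j * r <= 2 * A * d z] : set T).
  apply: measurableI; first exact: measurable_cube.
  rewrite (_ : [set z | _] = setT `&` d @^-1` `[t j * r / (2 * A), +oo[).
    by apply: measurable_bdist.
  by rewrite setTI; apply/seteqP; split => z /=; rewrite in_itv/= andbT ler_pdivrMr// [d z * _]mulrC.
apply: (@layered_integral _ T R mu _ _
  (fun j => cube x (2 * (t j * r)) `&` [set z | t j * r <= 2 * A * d z])
  (fun j => (t j * r / (2 * A)) `^ (- (n%:R + eta)))
  (fun j => (2 * (2 * (t j * r))) ^+ n) _ q mD mL).
- by apply: measurable_powR_comp; exact: md.
- by move=> y _; rewrite lee_fin powR_ge0.
- move=> z [Oz]; rewrite xsection_cone/= => xz.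
  have ex : exists j, enorm (x - z) <= t j * r.
    exists (Num.bound (enorm (x - z) / r)).
    set b := Num.bound _; have B : enorm (x - z) / r < 2 ^+ b.
      apply: (lt_trans (archi_boundP _)); first by rewrite divr_ge0 ?enorm_ge0// ltW.
      by rewrite -natrX ltr_nat ltn_expl.
    by rewrite -ler_pdivrMr// ltW.
  have [j xzj min_j] := ex_minnP ex; exists j; split.
    move=> i; apply: (@le_lt_trans _ _ (t j * r)); last by rewrite ltr_pMl ?mulr_gt0//; lra.
    apply: le_trans xzj; rewrite enormB; apply: le_trans (coord_le_enorm _ i).
    by rewrite !mxE.
  have dz0 := bdist_gt0 Oz; rewrite /=.
  (* For [j = 0] the bound comes from [d x <= d z + |x - z|]; for larger [j], from minimality,
     [2^(j-1) * r < |x - z| <= A * d z]. *)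
  case: j xzj min_j => [|j] xzj min_j.
    rewrite /t expr0 mul1r; apply: le_trans (bdist_lip x z) _.
    have : d z <= A * d z by rewrite ler_peMl// ltW.
    lra.
  have : t j * r < enorm (x - z) by rewrite ltNge; apply/negP => /min_j; rewrite ltnn.
  rewrite /t exprS; lra.
- by move=> j; rewrite powR_ge0.
- move=> j z [Oz _] [_ /= H]; rewrite lee_fin; apply: ge_powRN.
  + by rewrite oppr_le0 addr_ge0// ltW.
  + by rewrite divr_gt0// mulr_gt0.
  + by rewrite ler_pdivrMr// [d z * _]mulrC.
- move=> j; rewrite -(mu_cube x); last by rewrite !mulr_gt0.
  by apply: le_outer_measure => z [[]].
- by rewrite (ltW q0) q1.
- move=> j; set tj := t j; have tj0 : 0 < tj by exact: t0.
  have tr0 : 0 < tj * r by rewrite mulr_gt0.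
  have -> : q ^+ j = tj `^ (- eta).
    rewrite /q -powR_expr ?invr_ge0// exprVn -/tj -powR_inv1 ?(ltW tj0)//.
    by rewrite -powRrM mulN1r.
  by rewrite cone_exponents.
Qed.

End distance.

Section hardy.
Context {R : realType} {n : nat} (O : set 'rV[R]_n).
Local Notation T := (lebesgue_rV R n).
Local Notation mu := (mu_rV R n).
Hypotheses (oO : open O) (bO : boundary O !=set0).
Local Notation d := (bdist O).

Definition cone_op (A : R) : (T -> \bar R) -> T -> \bar R :=
  kernel_op (@leb_rV R n) O (cone O A) (fun z => d z `^ (- n%:R)).

Lemma measurable_dist_powR (r : R) (D : set T) :
  measurable_fun D (fun x : T => d x `^ r : R).
Proof.
apply: (measurableT_comp (measurable_powR r)).
exact: measurable_funS (measurable_bdist bO).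
Qed.

Lemma measurable_cone_op (A : R) (g : T -> \bar R) : 0 <= A ->
  measurable_fun (O : set T) g -> (forall x, O x -> (0 <= g x)%E) ->
  measurable_fun setT (cone_op A g).
Proof.
move=> A0 mg g0; have a0 x : O x -> 0 <= d x `^ (- n%:R) by move=> _; exact: powR_ge0.
apply: measurable_kernel_op.
- exact: measurable_open.
- exact: measurable_cone.
- exact: measurable_dist_powR.
- exact: mg.
- exact: a0.
- exact: g0.
Qed.

Lemma cone_op_ge0 (A : R) (g : T -> \bar R) x :
  (forall x, O x -> (0 <= g x)%E) -> (0 <= cone_op A g x)%E.
Proof.
by move=> g0; apply: integral_ge0 => z [Oz _]; rewrite mule_ge0 ?g0// lee_fin powR_ge0.
Qed.

(* Schur's test with the test function [d ^ e], where [e] is small enough that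
   [d ^ (gam - e * p)] still satisfies the Assouad integrability condition. *)
Lemma cone_op_bounded (l gam p A : R) : assouad_exponent (boundary O) l ->
  l < n%:R + gam -> 1 < p -> 1 <= A ->
  exists2 C : R, 0 < C & forall g : T -> \bar R,
    measurable_fun (O : set T) g -> (forall x, O x -> 0 <= g x)%E ->
    (\int[mu]_(x in O) (cone_op A g x `^ p * (d x `^ gam)%:E) <=
     C%:E * \int[mu]_(x in O) (g x `^ p * (d x `^ gam)%:E))%E.
Proof.
move=> El lg p1 A1; have A0 : 0 <= A by exact: le_trans A1.
have p0 : 0 < p by exact: lt_trans p1.
pose q := p / (p - 1).
have pm1 : 0 < p - 1 by rewrite subr_gt0.
have q0 : 0 < q by rewrite divr_gt0.
have pq : p^-1 + q^-1 = 1 by rewrite /q; field; rewrite !gt_eqF.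
(* The factor [d^(- e p)] then uses up exactly half of the gap [n + gam - l]. *)
pose e := (n%:R + gam - l) / (2 * p).
have e0 : 0 < e by rewrite divr_gt0 ?mulr_gt0// subr_gt0.
have ep : e * p = (n%:R + gam - l) / 2 by rewrite /e; field; rewrite gt_eqF.
have lep : l < n%:R + (gam - e * p) by rewrite ep; lra.
have [C2 C20 H2] := integral_ysection_cone oO bO El lep A0.
have eq0 : 0 < e * q by rewrite mulr_gt0.
have [C1 C10 H1] := integral_xsection_cone oO bO eq0 A1.
exists (C1 `^ (p / q) * C2); first by rewrite mulr_gt0// powR_gt0.
move=> g mg g0.
rewrite -!integral_leb_rV.
apply: (@schur_test _ T R (@leb_rV R n) O (cone O A) (measurable_open oO)
  (measurable_cone bO A0) (fun z => d z `^ (- n%:R)) (fun z => d z `^ gam)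
  (fun z => d z `^ e) g p q C1 C2 (@measurable_dist_powR (- n%:R) O) (@measurable_dist_powR gam O)
  (@measurable_dist_powR e O) mg _ g0 p0 q0 pq C10 (ltW C20)).
- by move=> x Ox; split; apply: powR_gt0; exact: bdist_gt0.
- move=> x Ox; apply: (@le_trans _ _ (C1 * d x `^ (- (e * q)))%:E).
    apply: le_trans (H1 x Ox); rewrite le_eqVlt; apply/orP; left; apply/eqP.
    apply: eq_integral => z /set_mem[Oz _].
    rewrite -powRrM mulrN -powRD -?opprD//.
    by rewrite (gt_eqF (bdist_gt0 oO bO Oz)) implybT.
  by rewrite -powRrM mulrN.
- move=> z Oz; have dz : d z != 0 by rewrite (gt_eqF (bdist_gt0 oO bO Oz)).
  have -> : d z `^ gam * (d z `^ e) `^ (- p) / d z `^ (- n%:R) = d z `^ (n%:R + (gam - e * p)).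
    by rewrite -powRrM mulrN -powRN opprK -!powRD ?dz ?implybT// addrC.
  apply: le_trans (H2 z Oz); rewrite le_eqVlt; apply/orP; left; apply/eqP.
  apply: eq_integral => x /set_mem[Ox _].
  rewrite -powRrM mulrN -powRD//.
  by rewrite (gt_eqF (bdist_gt0 oO bO Ox)) implybT.
Qed.

End hardy.

(** * Averages along John curves *)

Section chains.
Context {R : realType} {n : nat}.
Implicit Types (x z : 'rV[R]_n) (y : nat -> 'rV[R]_n).

Definition chain (step : 'rV[R]_n -> 'rV[R]_n -> Prop) (P : 'rV[R]_n -> Prop) x z m
    (y : nat -> 'rV[R]_n) :=
  [/\ y 0%N = x, y m = z, (forall k, (k < m)%N -> step (y k) (y k.+1)) &
      forall k, (k <= m)%N -> P (y k)].

Lemma chain_extend step P x z z' m y : chain step P x z m y -> step z z' -> P z' ->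
  exists y', chain step P x z' m.+1 y'.
Proof.
move=> [y0 ym ys yP] zz' Pz'; exists (fun k => if (k <= m)%N then y k else z'); split.
- by [].
- by rewrite ltnn.
- move=> k; rewrite ltnS; case: ltngtP => // [km _|-> _]; last by rewrite ym.
  exact: ys.
- by move=> k _; case: ifP => // /yP.
Qed.

Lemma chain_cut step P x z m y k j : chain step P x z m y -> (k.+2 <= j <= m)%N ->
  step (y k) (y j) -> exists m' y', (m' < m)%N /\ chain step P x z m' y'.
Proof.
move=> [y0 ym ys yP] /andP[kj jm] kjs; pose e := (j - k.+1)%N.
exists (m - e)%N, (fun i => if (i <= k)%N then y i else y (i + e)%N); split.
  by rewrite /e; lia.
split.
- by [].
- rewrite ifF; last by rewrite /e; lia.
  by rewrite -ym; congr y; rewrite /e; lia.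
- move=> i im; have [ik|ki] := ltnP i k.
    by rewrite (ltnW ik) ; apply: ys; lia.
  have [ik|ik] := leqP i k.
    have -> : i = k by lia.
    by rewrite (_ : (k.+1 + e)%N = j)//; rewrite /e; lia.
  by apply: ys; move: im; rewrite /e; lia.
- by move=> i im; case: ifPn => ik; apply: yP; rewrite /e in im *; lia.
Qed.

(* Cutting short a chain with a step from [y k] to [y j] decreases its length. *)
Lemma minimal_chain step P x z : (exists m y, chain step P x z m y) ->
  exists m y, chain step P x z m y /\
    forall k j, (k.+2 <= j <= m)%N -> ~ step (y k) (y j).
Proof.
move=> [m0 [y0 H0]]; have ex : exists m, `[< exists y, chain step P x z m y >].
  by exists m0; apply/asboolP; exists y0.
have [m /asboolP[y Hy] min_m] := ex_minnP ex.
exists m, y; split => // k j kj ks.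
have [m' [y' [m'm Hy']]] := chain_cut Hy kj ks.
have /min_m : `[< exists y, chain step P x z m' y >] by apply/asboolP; exists y'.
by rewrite leqNgt m'm.
Qed.

Lemma arc_length_le (L : R) (g : R -> 'rV[R]_n) t : arc_length_curve L g ->
  0 <= t <= L -> enorm (g t - g 0) <= t.
Proof.
move=> [_ Hg] /[dup] tL /andP[t0 _]; have [->|tn0] := eqVneq t 0.
  by rewrite subrr enorm0.
have t1 : 0 < t by rewrite lt_neqAle eq_sym tn0.
rewrite -lee_fin -(Hg t tL); apply: ereal_sup_ubound; exists [:: t].
  by split => //=; rewrite ?t1 ?eqxx.
by rewrite /evariation /= big_nat1.
Qed.

Lemma within_continuous_enorm (L : R) (g : R -> 'rV[R]_n) t (h : R) :
  {within `[0, L], continuous g} -> 0 <= t <= L -> 0 < h ->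
  exists2 e, 0 < e & forall s, 0 <= s <= L -> `|s - t| < e -> enorm (g s - g t) < h.
Proof.
move=> cg tL h0.
have hn : 0 < h / (n%:R + 1) by rewrite divr_gt0// ltr_wpDl.
have tI : `[0, L]%classic t by rewrite /= in_itv.
have /subspace_continuousP/(_ t tI)/(_ (ball (g t) (h / (n%:R + 1)))) := cg.
move=> /(_ (nbhsx_ballx _ _ hn))/nbhs_ballP[e /= e0 He]; exists e => // s sL st.
have [_ gs] : ball (g t) (h / (n%:R + 1)) (g s).
  by apply: He; rewrite /ball/= ?in_itv//= distrC.
apply: (@le_lt_trans _ _ (n%:R * (h / (n%:R + 1)))).
  apply: enorm_le => [|i]; first exact: ltW.
  by rewrite !mxE distrC; have := gs 0 i; rewrite /ball/= => /ltW.
by rewrite mulrA ltr_pdivrMr ?ltr_wpDl// mulrC ltr_pM2l// ltrDl.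
Qed.

Section john_chains.
Variable O : set 'rV[R]_n.
Hypotheses (oO : open O) (bO : boundary O !=set0).
Local Notation d := (bdist O).

Let jump (rho : R) (v z : 'rV[R]_n) : Prop := enorm (z - v) <= rho * d v.

(** Continuous induction: let [u] be the supremum of the parameters that a chain can reach. As
    [d (g u) > 0], one more step leads from a reachable parameter close to [u] to every parameter
    near [u], hence [u = L] and [L] is reachable. *)
Lemma curve_chain (L rho : R) (g : R -> 'rV[R]_n) (P : 'rV[R]_n -> Prop) :
  0 <= L -> 0 < rho -> rho <= 1 -> {within `[0, L], continuous g} ->
  (forall t, 0 <= t <= L -> O (g t) /\ P (g t)) ->
  exists m y, chain (jump rho) P (g 0) (g L) m y.
Proof.
move=> L0 rho0 rho1 cg gP.
pose step := jump rho; rewrite -/step.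
pose S : set R := [set t | 0 <= t <= L /\ exists m y, chain step P (g 0) (g t) m y].
have S0 : S 0.
  split; first by rewrite lexx.
  exists 0%N, (fun=> g 0); split => // k _.
  by have [] := gP 0; rewrite ?lexx.
have Sub : ubound S L by move=> t [/andP[]].
have hS : has_sup S by split; [exists 0|exists L].
have s0 : 0 <= sup S by apply: ub_le_sup => //; exists L.
have sL : sup S <= L by apply: ge_sup => //; exists 0.
set u := sup S in s0 sL *.
have uL : 0 <= u <= L by rewrite s0.
have du : 0 < d (g u) by apply: bdist_gt0 => //; have [] := gP u uL.
(* Two points of the curve this close to [g u] differ by at most half of [rho * d (g u)], while the
   step allowed at either of them is at least three quarters of it. *)
have r0 : 0 < rho * d (g u) / 4 by rewrite divr_gt0// mulr_gt0.
have [e e0 He] := within_continuous_enorm cg uL r0.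
have [t St ut] := sup_adherent e0 hS.
have tu : t <= u by apply: ub_le_sup => //; exact: hS.2.
have tue : `|t - u| < e by rewrite ler0_norm ?subr_le0//; rewrite -/u in ut; lra.
have [tL [m [y Hy]]] := St.
have Hs s : 0 <= s <= L -> `|s - u| < e -> S s.
  move=> sL' su; split => //; have [Os Ps] := gP s sL'.
  have [y' Hy'] : exists y', chain step P (g 0) (g s) m.+1 y'; last by exists m.+1, y'.
  apply: chain_extend Hy _ Ps; rewrite /step /jump.
  have h1 := He s sL' su; have h2 := He t tL tue.
  have h3 := bdist_lip bO (g u) (g t).
  have h4 := enorm_tri (g s) (g u) (g t).
  have h5 : rho * d (g u) <= rho * d (g t) + rho * enorm (g u - g t) by rewrite -mulrDr ler_wpM2l// ltW.
  have h6 : rho * enorm (g u - g t) <= enorm (g u - g t) by rewrite ler_piMl// enorm_ge0.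
  rewrite enormB in h2; move: h1 h2 h4 h5 h6 r0; clear; lra.
have [_ //] : S L.
apply: (Hs); first by rewrite L0 lexx.
have [uL'|Lu] := ltP u L; last first.
  have -> : u = L by apply/eqP; rewrite eq_le sL.
  by rewrite subrr normr0.
exfalso; pose s := Num.min L (u + e / 2).
have us : u < s by rewrite lt_min uL'/=; move: e0; clear; lra.
have : S s.
  have se : s <= u + e / 2 by rewrite ge_min lexx orbT.
  apply: Hs; first by rewrite (le_trans s0 (ltW us)) ge_min lexx.
  rewrite gtr0_norm ?subr_gt0//; move: se e0; clear; lra.
by move=> /(ub_le_sup hS.2); rewrite -/u leNgt us.
Qed.

(** With [A0 = b0 / a0]: a curve point at arc length [t] is within [t] of [x], and
    [t = (L / a0) (a0 / L) t <= A0 * d]. The last clause is minimality, which forbids shortcuts. *)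
Lemma john_chain : john_domain O -> exists A0 : R, 1 <= A0 /\
  exists2 x0, O x0 & forall x (rho : R), O x -> 0 < rho -> rho <= 1 ->
  exists m y, [/\ y 0%N = x, y m = x0,
    (forall k, (k < m)%N -> enorm (y k.+1 - y k) <= rho * d (y k)),
    (forall k, (k <= m)%N -> O (y k) /\ enorm (x - y k) <= A0 * d (y k)) &
    forall k j, (k.+2 <= j <= m)%N -> rho * d (y k) < enorm (y j - y k)].
Proof.
move=> [_ [a0 [b0 [a00 ab [x0 Ox0 HJ]]]]].
have A1 : 1 <= b0 / a0 by rewrite ler_pdivlMr// mul1r.
exists (b0 / a0); split => //; exists x0 => // x rho Ox rho0 rho1.
pose P z := O z /\ enorm (x - z) <= b0 / a0 * d z.
suff [m [y [[y0 ym ys yP] Hs]]] : exists m y,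
    chain (jump rho) P x x0 m y /\
    forall k j, (k.+2 <= j <= m)%N -> ~ enorm (y j - y k) <= rho * d (y k).
  by exists m, y; split => // k j /Hs/negP; rewrite -ltNge.
(* No curve is given for [x = x0]; the chain of length 0 serves. *)
apply: minimal_chain; have [xE|xx0] := eqVneq x x0.
  exists 0%N, (fun=> x0); split => // k _; split => //.
  by rewrite xE subrr enorm0 mulr_ge0 ?bdist_ge0//; apply: le_trans A1.
have [L [g [/andP[L0 Lb] Hg [g0 gL] gO gd]]] := HJ x Ox xx0.
rewrite -g0 -gL; apply: curve_chain => //; first by case: Hg.
move=> t tL; split; first exact: gO.
split; first exact: gO.
rewrite enormB -g0; apply: le_trans (arc_length_le Hg tL) _; move: (tL) => /andP[t0 tL'].
have dt := gd t tL; rewrite -/(d (g t)) in dt.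
(* For [L = 0] the quotient [a0 / L] is 0 by convention and bounds nothing, but then [t = 0]. *)
have [LE0|Ln0] := eqVneq L 0.
  have -> : t = 0 by apply/eqP; rewrite eq_le t0 -LE0 tL'.
  by rewrite mulr_ge0 ?bdist_ge0//; apply: le_trans A1.
have Lp : 0 < L by rewrite lt_neqAle eq_sym Ln0.
apply: (@le_trans _ _ (L / a0 * d (g t))).
  rewrite [leLHS](_ : t = L / a0 * (a0 / L * t)); last by field; rewrite !gt_eqF.
  by rewrite ler_wpM2l// divr_ge0// ltW.
by rewrite ler_wpM2r ?bdist_ge0// ler_pM2r ?invr_gt0.
Qed.

End john_chains.
End chains.

Section sparse_sum.
Context d (T : measurableType d) (R : realType) (mu : {measure set T -> \bar R}).
Local Open Scope ereal_scope.

(* The sets of even index are disjoint, and so are those of odd index. *)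
Lemma sum_integral_sparse (K : nat -> set T) (G : set T) (g : T -> \bar R) m :
  measurable G -> (forall k, measurable (K k)) ->
  (forall k, (k < m)%N -> K k `<=` G) ->
  (forall k j, (k.+2 <= j < m)%N -> K k `&` K j = set0) ->
  measurable_fun G g -> (forall x, G x -> 0 <= g x) ->
  \sum_(k < m) \int[mu]_(x in K k) g x <= 2%:E * \int[mu]_(x in G) g x.
Proof.
move=> mG mK KG Kdis mg g0.
pose s (b : bool) := [seq k <- iota 0 m | odd k == b].
have sP b k : k \in s b -> (k < m)%N /\ odd k = b.
  by rewrite mem_filter mem_iota add0n => /andP[/eqP-> /andP[_ ->]].
have H b : \sum_(k <- s b) \int[mu]_(x in K k) g x <= \int[mu]_(x in G) g x.
  have UG : \big[setU/set0]_(k <- s b) K k `<=` G.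
    by rewrite -bigcup_seq => x [k /= /sP[km _] Kx]; exact: (KG k).
  rewrite -ge0_integral_bigsetU//.
  - apply: ge0_subset_integral => //.
    by apply: bigsetU_measurable => k _; exact: mK.
  - by rewrite filter_uniq// iota_uniq.
  - apply/trivIsetP => i j /= /sP[im ib] /sP[jm jb] ij.
    wlog lij : i j im jm ib jb ij / (i < j)%N.
      move=> W; case: (ltngtP i j) => [h|h|h]; [exact: W| |by move: ij; rewrite h eqxx].
      by rewrite setIC; apply: W => //; rewrite eq_sym.
    apply: Kdis; rewrite jm andbT ltn_neqAle lij andbT; apply/eqP => E.
    by move: jb; rewrite -E /= ib; case: (b).
  - exact: measurable_funS mg.
  - by move=> x /UG; exact: g0.
rewrite -(big_mkord xpredT (fun k => \int[mu]_(x in K k) g x)) (bigID (fun k => odd k)) /=.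
have -> : (2%:E = 1%:E + 1%:E :> \bar R) by rewrite -EFinD.
rewrite ge0_muleDl ?lee_fin ?ler01// mul1e.
apply: leeD.
  by have := H true; rewrite /s big_filter /index_iota subn0; under eq_bigl do rewrite eqb_id.
by have := H false; rewrite /s big_filter /index_iota subn0; under eq_bigl do rewrite eqbF_neg.
Qed.

End sparse_sum.

(** * Mean oscillation and the restricted sharp function *)

Section oscillation.
Context {R : realType} {n : nat}.
Local Notation T := (lebesgue_rV R n).
Local Notation mu := (mu_rV R n).
Implicit Types (x y z c : 'rV[R]_n) (f : T -> R).

(** The mean over [Q] of [|f - f_K|] is at most [V / v] times its mean over [K]. If [f] is not
    integrable on [K], the right side is +oo. *)
Lemma average_sub (Q K : set T) f (v V : R) : measurable Q -> measurable K ->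
  Q `<=` K -> mu Q = v%:E -> mu K = V%:E -> 0 < v -> 0 < V ->
  (`|average Q f - average K f|%:E <= (V / v)%:E * mean_osc K f)%E.
Proof.
move=> mQ mK QK muQ muK v0 V0; have Vv : 0 < V / v by rewrite divr_gt0.
have [If|nIf] := pselect (mu.-integrable K (EFin \o f)); last first.
  rewrite /mean_osc asboolF// gt0_muley ?lte_fin//; exact: leey.
have mf : measurable_fun K f by have /measurable_EFinP := measurable_int _ If.
have IQ : mu.-integrable Q (EFin \o f) by exact: integrableS If.
have := le_trans (average_dev (average K f) mQ muQ v0 IQ)
  (le_dev_sub mu (average K f) mQ mK mf QK).
rewrite -(mean_osc_dev muK V0 If) => H.
have vi0 : (0 <= v^-1%:E)%E by rewrite lee_fin invr_ge0 ltW.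
have := lee_wpmul2l vi0 H.
by rewrite muleA -!EFinM [v^-1 * V]mulrC mulrCA mulVf ?gt_eqF// mulr1.
Qed.

Lemma mean_osc_ge0 (K : set T) f : (0 <= mean_osc K f)%E.
Proof.
rewrite /mean_osc; case: asboolP => _; last exact: leey.
apply: mule_ge0; last by apply: integral_ge0 => y _; rewrite lee_fin.
by rewrite lee_fin invr_ge0 fine_ge0// lebesgue_outer_ge0.
Qed.

End oscillation.

Section sharp_function.
Context {R : realType} {n : nat} (O : set 'rV[R]_n) (sigma : R) (f : 'rV[R]_n -> R).
Local Notation T := (lebesgue_rV R n).
Local Notation mu := (mu_rV R n).
Hypotheses (oO : open O) (sigma1 : 1 <= sigma).
Implicit Types (x y z c : 'rV[R]_n).
Local Notation M := (sharp_max_res O sigma f : T -> \bar R).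

Lemma mean_osc_le_sharp c (h : R) x : 0 < h -> cube c h x ->
  cube c (sigma * h) `<=` O -> (mean_osc (cube c h) f <= M x)%E.
Proof.
move=> h0 xc cO; have Ox : O x.
  apply: cO => i; apply: lt_le_trans (xc i) _; rewrite ler_peMl//; exact: ltW.
rewrite /sharp_max_res mem_set//; apply: ereal_sup_ubound.
by exists (c, h).
Qed.

Lemma sharp_ge0 x : (0 <= M x)%E.
Proof.
rewrite /sharp_max_res; case: ifPn => // /set_mem Ox.
have [h h0 hO] := open_cube oO Ox.
have s0 : 0 < sigma by exact: lt_le_trans sigma1.
apply: le_trans (mean_osc_ge0 (cube x (h / sigma)) f) _; apply: ereal_sup_ubound.
exists (x, h / sigma) => //=; split => //; first by rewrite divr_gt0.
  by move=> i; rewrite subrr normr0 divr_gt0.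
by rewrite mulrCA mulfV ?mulr1// gt_eqF.
Qed.

(** Lower semicontinuity: a cube witnessing a value above [r] at [x] is open and is admissible at
    each of its points. *)
Lemma measurable_sharp : measurable_fun (O : set T) M.
Proof.
apply: (measurability _ (ErealGenOInfty.measurableE R)) => // _ [_ [r ->] <-].
apply: measurable_open; apply: cube_open => x [Ox]; rewrite /= in_itv/= andbT.
rewrite /sharp_max_res mem_set// => /ereal_sup_gt[_ [[c h] /= [h0 xc cO] <-] rosc].
have [h' h'0 h'O] := open_cube (@cube_is_open _ _ c h) xc.
have cO' : cube c h `<=` O.
  move=> y yc; apply: cO => i; apply: lt_le_trans (yc i) _; rewrite ler_peMl//; exact: ltW.
exists h' => // y /h'O yc; split; first exact: cO'.
rewrite /= in_itv/= andbT; apply: lt_le_trans rosc _.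
have := mean_osc_le_sharp h0 yc cO; apply: le_trans; exact: lexx.
Qed.

End sharp_function.

Section telescope.
Context {R : realType}.

Lemma abs_telescope (F : nat -> R) (b : nat -> \bar R) m :
  (forall k, (k < m)%N -> (`|F k.+1 - F k|%:E <= b k)%E) ->
  (`|F m - F 0%N|%:E <= \sum_(k < m) b k)%E.
Proof.
elim: m => [|m IH] H; first by rewrite big_ord0 subrr normr0.
rewrite big_ord_recr/=.
apply: le_trans (leeD (IH _) (H m (ltnSn m))); last by move=> k km; apply: H; exact: ltnW.
rewrite -EFinD lee_fin [leRHS]addrC.
by rewrite (_ : F m.+1 - F 0%N = (F m.+1 - F m) + (F m - F 0%N)) ?ler_normD//; ring.
Qed.

Lemma abs_sub_le (x y z : R) (a b : \bar R) :
  (`|x - z|%:E <= a -> `|y - z|%:E <= b -> `|x - y|%:E <= a + b)%E.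
Proof.
move=> xz yz; apply: le_trans (leeD xz yz); rewrite -EFinD lee_fin [`|y - z|]distrC.
by rewrite (_ : x - y = (x - z) + (z - y)) ?ler_normD//; ring.
Qed.

End telescope.

(** * Jumps of averages along a chain *)

Section chain_bound.
Context {R : realType} {n : nat} (O : set 'rV[R]_n) (sigma : R) (f : 'rV[R]_n -> R).
Local Notation T := (lebesgue_rV R n).
Local Notation mu := (mu_rV R n).
Hypotheses (n0 : (0 < n)%N) (oO : open O) (bO : boundary O !=set0) (sigma1 : 1 <= sigma).
Implicit Types (x y z : 'rV[R]_n).
Local Notation M := (sharp_max_res O sigma f : T -> \bar R).
Local Notation d := (bdist O).

(* In units of [scale y = d y / sigma], the averages along a chain are taken over
   cubes of half-side [cdil], whose doubles stay in [O] after dilation by [sigma];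
   non-consecutive points are more than [cjump] apart, so that the cubes of
   half-side [csmall] around them are disjoint. *)
Definition cdil : R := (4 * n%:R)^-1.
Definition cjump : R := cdil / 2.
Definition csmall : R := cdil / (8 * n%:R).
Definition scale y : R := d y / sigma.

Let N1 : 1 <= n%:R :> R. Proof. by rewrite ler1n. Qed.

Let s0 : 0 < sigma. Proof. exact: lt_le_trans sigma1. Qed.

Lemma cdil_gt0 : 0 < cdil. Proof. by rewrite invr_gt0 mulr_gt0// ltr0n. Qed.

Let Nc : n%:R * cdil = 4^-1.
Proof. by rewrite /cdil; field; rewrite pnatr_eq0 -lt0n. Qed.

Let c4 : cdil <= 4^-1.
Proof. by rewrite -Nc ler_peMl// ltW// cdil_gt0. Qed.

Lemma csmall_gt0 : 0 < csmall.
Proof. by rewrite divr_gt0 ?cdil_gt0// mulr_gt0// ltr0n. Qed.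

Let Ns : n%:R * csmall = cdil / 8.
Proof. by rewrite /csmall; field; rewrite pnatr_eq0 -lt0n. Qed.

Let s8 : csmall <= cdil / 8.
Proof. by rewrite -Ns ler_peMl// ltW// csmall_gt0. Qed.

Lemma scale_gt0 y : O y -> 0 < scale y.
Proof. by move=> Oy; rewrite divr_gt0// bdist_gt0. Qed.

Lemma scale_le y : scale y <= d y.
Proof. by rewrite ler_pdivrMr// ler_peMr// bdist_ge0. Qed.

(** As [sigma * scale y = d y], the dilated cube has Euclidean radius at most
    [n * 2 * cdil * d y = d y / 2]. *)
Lemma dilated_cube_sub y : O y -> cube y (sigma * (2 * cdil * scale y)) `<=` O.
Proof.
move=> Oy z yz; have dy := bdist_gt0 oO bO Oy; apply: (eball_sub_open oO Oy).
have E : sigma * (2 * cdil * scale y) = 2 * cdil * d y.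
  by rewrite /scale; field; rewrite gt_eqF.
rewrite E in yz; have h0 : 0 <= 2 * cdil * d y.
  by rewrite !mulr_ge0 ?(ltW cdil_gt0) ?(ltW dy).
apply: le_lt_trans (enorm_cube yz h0) _; rewrite -/(d y).
have -> : n%:R * (2 * cdil * d y) = 2 * (n%:R * cdil) * d y by ring.
rewrite Nc; move: dy; lra.
Qed.

Lemma small_cube y z : O y -> cube y (csmall * scale y) z ->
  [/\ O z, enorm (z - y) <= cdil / 8 * scale y, d y / 2 <= d z & d z <= 2 * d y].
Proof.
move=> Oy yz; have dy := bdist_gt0 oO bO Oy; have t0 := scale_gt0 Oy.
have h0 : 0 <= csmall * scale y by rewrite mulr_ge0 ?(ltW csmall_gt0) ?(ltW t0).
have zy := enorm_cube yz h0; rewrite mulrA Ns in zy.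
have tr := scale_le y; have c0 := cdil_gt0.
have zy2 : enorm (z - y) <= d y / 32.
  apply: le_trans zy _; apply: (@le_trans _ _ (4^-1 / 8 * scale y)).
    by rewrite ler_wpM2r ?(ltW t0)// ler_pM2r.
  by move: tr; lra.
have l1 := bdist_lip bO z y; have l2 := bdist_lip bO y z; rewrite enormB in l2.
split => //.
- apply: (eball_sub_open oO Oy); apply: le_lt_trans zy2 _; rewrite -/(d y).
  by move: dy; lra.
- move: zy2 l2 dy; lra.
- move: zy2 l1 dy; lra.
Qed.

Lemma sharp_ge_osc y z : O y -> cube y (2 * cdil * scale y) z ->
  (mean_osc (cube y (2 * cdil * scale y)) f <= M z)%E.
Proof.
move=> Oy yz; apply: (mean_osc_le_sharp f sigma1) => //; last exact: dilated_cube_sub.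
exact: (mulr_gt0 (mulr_gt0 (ltr0n _ 2) cdil_gt0) (scale_gt0 Oy)).
Qed.

Lemma le_cube y (h h' : R) : h <= h' -> cube y h `<=` cube y h'.
Proof. by move=> hh z yz i; exact: lt_le_trans (yz i) hh. Qed.

(** [scale] is Lipschitz with constant [1 / sigma <= 1], so the scales at [y] and [y'] differ by
    less than a factor 2. Hence both cubes lie in the doubled cube at [y] and have at least [4^-n]
    of its volume. *)
Lemma jump_average y y' : O y -> O y' -> enorm (y' - y) <= cjump * scale y ->
  (`|average (cube y' (cdil * scale y')) f - average (cube y (cdil * scale y)) f|%:E <=
   (2 * 4 ^+ n)%:E * mean_osc (cube y (2 * cdil * scale y)) f)%E.
Proof.
move=> Oy Oy' yy'; have t0 := scale_gt0 Oy; have t0' := scale_gt0 Oy'; have c0 := cdil_gt0.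
set t := scale y in t0 yy' *; set t' := scale y' in t0' *.
have j0 : 0 < cjump by rewrite divr_gt0.
have js : cjump * t / sigma <= cjump * t.
  by rewrite ler_pdivrMr// ler_peMr// mulr_ge0 ?(ltW j0) ?(ltW t0).
have l1 : t' <= t + enorm (y' - y) / sigma.
  by rewrite /t' /t /scale -mulrDl ler_pM2r ?invr_gt0// bdist_lip.
have l2 : t <= t' + enorm (y' - y) / sigma.
  by rewrite /t' /t /scale -mulrDl ler_pM2r ?invr_gt0// enormB bdist_lip.
have l3 : enorm (y' - y) / sigma <= cjump * t.
  by apply: le_trans js; rewrite ler_pM2r ?invr_gt0.
have ct0 : 0 < cdil * t by exact: mulr_gt0.
have ct0' : 0 < cdil * t' by exact: mulr_gt0.
have c2t : 0 < 2 * cdil * t by rewrite -mulrA; exact: mulr_gt0.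
have jt : cjump * t <= t / 8.
  by rewrite /cjump [leRHS]mulrC ler_wpM2r ?(ltW t0)//; move: c4; lra.
have Ksub : cube y (cdil * t) `<=` cube y (2 * cdil * t).
  by apply: le_cube; rewrite ler_wpM2r ?(ltW t0)//; move: c0; lra.
have tt : t / 2 <= t' by move: l2 l3 jt t0; lra.
have tt2 : t' <= 5 / 4 * t by move: l1 l3 jt t0; lra.
have Ksub' : cube y' (cdil * t') `<=` cube y (2 * cdil * t).
  move=> z yz i; rewrite (_ : z 0 i - y 0 i = (z 0 i - y' 0 i) + (y' - y) 0 i); last by rewrite !mxE; ring.
  apply: le_lt_trans (ler_normD _ _) _.
  have h1 := yz i; have h2 := coord_le_enorm (y' - y) i.
  have h3 : cdil * t' <= cdil * (5 / 4 * t) by rewrite ler_pM2l.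
  have h4 : cdil * t > 0 by rewrite mulr_gt0.
  have h5 : cjump * t = cdil * t / 2 by rewrite /cjump; ring.
  rewrite h5 in yy'.
  move: h1 h2 h3 h4 yy'; lra.
have mc := @measurable_cube R n.
have V0 : 0 < (2 * (2 * cdil * t)) ^+ n by apply: exprn_gt0; exact: mulr_gt0.
have v0 : 0 < (2 * (cdil * t)) ^+ n by apply: exprn_gt0; exact: mulr_gt0.
have v0' : 0 < (2 * (cdil * t')) ^+ n by apply: exprn_gt0; exact: mulr_gt0.
have A1 := average_sub f (mc _ _) (mc _ _) Ksub (mu_cube y ct0) (mu_cube y c2t) v0 V0.
have A2 := average_sub f (mc _ _) (mc _ _) Ksub' (mu_cube y' ct0') (mu_cube y c2t) v0' V0.
have r1 : (2 * (2 * cdil * t)) ^+ n / (2 * (cdil * t)) ^+ n <= 4 ^+ n.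
  rewrite -exprVn -exprMn; apply: lerXn2r; rewrite ?nnegrE//.
    by apply/ltW/divr_gt0; exact: mulr_gt0.
  rewrite (_ : 2 * (2 * cdil * t) / (2 * (cdil * t)) = 2) ?ler_nat//.
  by field; rewrite !gt_eqF.
have r2 : (2 * (2 * cdil * t)) ^+ n / (2 * (cdil * t')) ^+ n <= 4 ^+ n.
  rewrite -exprVn -exprMn; apply: lerXn2r; rewrite ?nnegrE//.
    by apply/ltW/divr_gt0; exact: mulr_gt0.
  have D0 : 0 < 2 * (cdil * t') by exact: mulr_gt0.
  rewrite (ler_pdivrMr _ _ D0).
  have : cdil * (t / 2) <= cdil * t' by rewrite ler_pM2l.
  by lra.
set X := average _ f in A2 *; set Y := average _ f in A1 *.
set Z := average _ f in A1 A2.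
set osc := mean_osc _ f in A1 A2 *.
have o0 : (0 <= osc)%E by exact: mean_osc_ge0.
have E : ((2 * 4 ^+ n)%:E * osc = (4 ^+ n)%:E * osc + (4 ^+ n)%:E * osc)%E.
  rewrite -ge0_muleDl ?lee_fin ?exprn_ge0// -EFinD; congr (_%:E * _)%E; ring.
rewrite E; apply: (@abs_sub_le _ X Y Z).
  by apply: le_trans A2 _; apply: lee_wpmul2r => //; rewrite lee_fin.
by apply: le_trans A1 _; apply: lee_wpmul2r => //; rewrite lee_fin.
Qed.

(** The factor [sigma^n] originates here: [M] is at least the oscillation on the small cube, whose
    volume [(2 * csmall * d y / sigma)^n] is compared with [(2 * d y)^n], an upper bound for the
    n-th power of [d] on it. *)
Lemma osc_le_integral y : O y ->
  (mean_osc (cube y (2 * cdil * scale y)) f <= ((sigma / csmall) ^+ n)%:E *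
    \int[mu]_(z in cube y (csmall * scale y)) ((d z `^ (- n%:R))%:E * M z))%E.
Proof.
move=> Oy; have t0 := scale_gt0 Oy; have dy := bdist_gt0 oO bO Oy.
set osc := mean_osc _ f; have o0 : (0 <= osc)%E by exact: mean_osc_ge0.
have st0 : 0 < csmall * scale y by rewrite mulr_gt0 ?csmall_gt0.
have mK : measurable (cube y (csmall * scale y) : set T) by exact: measurable_cube.
have KO : cube y (csmall * scale y) `<=` O by move=> z /(small_cube Oy)[].
have mg : measurable_fun (cube y (csmall * scale y) : set T) (fun z : T => ((d z `^ (- n%:R))%:E * M z)%E).
  have mM := @measurable_sharp R n O sigma f sigma1.
  apply: emeasurable_funM; last first.
    apply: measurable_funS mM; [exact: measurable_open|exact: KO].
  by apply/measurable_EFinP; exact: measurable_dist_powR.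
have c0 : (0 <= ((2 * d y) `^ (- n%:R))%:E * osc)%E by rewrite mule_ge0// lee_fin powR_ge0.
have := integral_ge_cst mu mK c0 mg.
rewrite mu_cube// => /(_ _)/wrap[].
  move=> z Kz; have [Oz _ _ dz] := small_cube Oy Kz.
  apply: lee_pmul => //; first by rewrite lee_fin powR_ge0.
    have n00 : - n%:R <= 0 :> R by rewrite oppr_le0.
    by rewrite lee_fin; exact: (ge_powRN n00 (bdist_gt0 oO bO Oz) dz).
  apply: sharp_ge_osc => //; apply: le_cube Kz.
  rewrite ler_wpM2r ?(ltW t0)//; move: s8 cdil_gt0; lra.
move=> H; have w0 : (0 <= ((sigma / csmall) ^+ n)%:E)%E.
  by rewrite lee_fin exprn_ge0// divr_ge0 ?(ltW s0) ?(ltW csmall_gt0).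
apply: le_trans (lee_wpmul2l w0 H); rewrite muleAC muleA -!EFinM.
suff -> : (sigma / csmall) ^+ n * ((2 * d y) `^ (- n%:R) * (2 * (csmall * scale y)) ^+ n) = 1.
  by rewrite mul1e.
rewrite powRN powR_mulrn ?mulr_ge0 ?(ltW dy)// -exprVn -!exprMn.
rewrite [X in X ^+ n](_ : _ = 1) ?expr1n// /scale.
by field; rewrite !gt_eqF ?csmall_gt0.
Qed.

End chain_bound.

Section john_averages.
Context {R : realType} {n : nat} (O : set 'rV[R]_n).
Local Notation T := (lebesgue_rV R n).
Local Notation mu := (mu_rV R n).
Hypotheses (n0 : (0 < n)%N) (oO : open O) (bO : boundary O !=set0).
Implicit Types (x y z : 'rV[R]_n) (f : 'rV[R]_n -> R) (sigma : R).
Local Notation d := (bdist O).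
Local Notation cdil := (@cdil R n).
Local Notation cjump := (@cjump R n).
Local Notation csmall := (@csmall R n).

Definition Kcube sigma y : set 'rV[R]_n := cube y (cdil * scale O sigma y).

Let c0 : 0 < cdil. Proof. exact: cdil_gt0. Qed.

Let c4 : cdil <= 4^-1.
Proof.
rewrite /cdil lef_pV2 ?posrE ?mulr_gt0 ?ltr0n//.
by rewrite ler_peMr// ler1n.
Qed.

(** A common point would give [|y' - y| <= cdil / 8 * (t + t')] for the scales [t], [t']. This
    forces [t' <= 2 * t], hence [|y' - y| <= 3/8 * cdil * t], less than [cjump * t]. *)
Lemma small_cubes_disjoint sigma y y' : 1 <= sigma -> O y -> O y' ->
  cjump * scale O sigma y < enorm (y' - y) ->
  cube y (csmall * scale O sigma y) `&` cube y' (csmall * scale O sigma y') = set0.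
Proof.
move=> s1 Oy Oy' far; have s0 : 0 < sigma by exact: lt_le_trans s1.
apply/seteqP; split => // z [zy zy'].
have [_ h1 _ _] := small_cube n0 oO bO s1 Oy zy.
have [_ h2 _ _] := small_cube n0 oO bO s1 Oy' zy'.
have t0 := scale_gt0 oO bO s1 Oy; have t0' := scale_gt0 oO bO s1 Oy'.
have tri := enorm_tri y' z y; rewrite (enormB y' z) in tri.
have lip : d y' <= d y + enorm (y' - y) by exact: bdist_lip.
have tle : scale O sigma y' <= scale O sigma y + enorm (y' - y).
  rewrite /scale; apply: (@le_trans _ _ ((d y + enorm (y' - y)) / sigma)).
    by rewrite ler_pM2r ?invr_gt0.
  by rewrite mulrDl lerD2l ler_pdivrMr// ler_peMr ?enorm_ge0.
have e1 : enorm (y' - y) <= cdil / 8 * scale O sigma y + cdil / 8 * scale O sigma y'.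
  apply: le_trans tri _; rewrite addrC; exact: lerD.
set t := scale O sigma y in t0 h1 far tle e1; set t' := scale O sigma y' in t0' tle e1 h2.
set e := enorm (y' - y) in far tle e1.
have ct0 : 0 < cdil * t by exact: mulr_gt0.
have ct0' : 0 < cdil * t' by exact: mulr_gt0.
have ct1 : cdil * t <= t / 4 by rewrite [t / 4]mulrC; exact: (ler_wpM2r (ltW t0) c4).
have ct1' : cdil * t' <= t' / 4 by rewrite [t' / 4]mulrC; exact: (ler_wpM2r (ltW t0') c4).
have e2 : e <= cdil * t / 8 + cdil * t' / 8 by move: e1; lra.
have far2 : cdil * t / 2 < e by move: far; rewrite /cjump; lra.
have tt : t' <= 2 * t by move: e2 ct1 ct1' tle; lra.
have ctt : cdil * t' <= 2 * (cdil * t) by rewrite (mulrCA 2 cdil t); exact: (ler_wpM2l (ltW c0) tt).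
by move: e2 far2 ctt ct0; lra.
Qed.

Lemma john_average_bound : john_domain O -> exists A C : R,
  [/\ 1 <= A, 0 < C & exists2 x0, O x0 &
    forall sigma f x, 1 <= sigma -> O x ->
    (`|average (Kcube sigma x) f - average (Kcube sigma x0) f|%:E <=
     (C * sigma ^+ n)%:E * cone_op O A (sharp_max_res O sigma f) x)%E].
Proof.
move=> JO; have [A0 [A01 [x0 Ox0 HC]]] := john_chain oO bO JO.
(* A point [z] of the small cube at [y k] is within [(A0 + 1) * d (y k)] of [x], and
   [d (y k) <= 2 * d z]. *)
pose A : R := 2 * (A0 + 1).
have A1 : 1 <= A by rewrite /A; lra.
have cs0 : 0 < csmall by exact: csmall_gt0.
exists A, (2 * (2 * 4 ^+ n) * csmall^-1 ^+ n); split => //.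
  by rewrite !mulr_gt0 ?exprn_gt0 ?invr_gt0.
exists x0 => // sigma f x s1 Ox; have s0 : 0 < sigma by exact: lt_le_trans s1.
have rho0 : 0 < cjump / sigma by rewrite !divr_gt0.
have rho1 : cjump / sigma <= 1.
  rewrite ler_pdivrMr// mul1r; apply: le_trans s1; rewrite /cjump.
  by move: c4; lra.
have rhoE z : cjump / sigma * d z = cjump * scale O sigma z by rewrite /scale; ring.
have [m [y [y0 ym Hs HO Hf]]] := HC x _ Ox rho0 rho1.
pose M : T -> \bar R := sharp_max_res O sigma f.
pose g (z : T) := ((d z `^ (- n%:R))%:E * M z)%E.
pose K k : set T := cube (y k) (csmall * scale O sigma (y k)).
have M0 z : (0 <= M z)%E by exact: sharp_ge0.
have g0 z : (0 <= g z)%E by rewrite mule_ge0// lee_fin powR_ge0.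
pose G : set T := O `&` xsection (cone O A) x.
have mG : measurable G.
  by apply: measurableI; [exact: measurable_open|apply: measurable_xsection; apply: (measurable_cone bO (le_trans ler01 A1))].
have mg : measurable_fun G g.
  apply: emeasurable_funM.
    by apply/measurable_EFinP; exact: measurable_dist_powR.
  apply: measurable_funS (@measurable_sharp R n O sigma f s1); first exact: measurable_open.
  by move=> z [].
have KG k : (k < m)%N -> K k `<=` G.
  move=> km z Kz; have [Oy xy] := HO k (ltnW km).
  have [Oz h1 h2 _] := small_cube n0 oO bO s1 Oy Kz; split => //.
  rewrite xsection_cone/=.
  have tri := enorm_tri x (y k) z; rewrite (enormB (y k) z) in tri.
  have sl := scale_le bO s1 (y k).
  have t0 := scale_gt0 oO bO s1 Oy.
  have h3 : cdil / 8 * scale O sigma (y k) <= d (y k).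
    apply: le_trans sl; rewrite ler_piMl ?(ltW t0)//; move: c4; lra.
  have h4 : (A0 + 1) * (d (y k) / 2) <= (A0 + 1) * d z.
    by rewrite ler_wpM2l//; move: A01; lra.
  have := le_trans tri (lerD xy h1).
  by rewrite /A; move: h3 h4; lra.
have Kd k j : (k.+2 <= j < m)%N -> K k `&` K j = set0.
  move=> /andP[kj jm]; apply: small_cubes_disjoint => //.
  - by have [] := HO k (ltnW (ltn_trans (ltnW kj) jm)).
  - by have [] := HO j (ltnW jm).
  - by rewrite -rhoE; apply: Hf; rewrite kj ltnW.
have mK k : measurable (K k) by exact: measurable_cube.
have S := @sum_integral_sparse _ T R mu K G g m mG mK KG Kd mg (fun z _ => g0 z).
pose F k := average (Kcube sigma (y k)) f.
pose b : R := 2 * 4 ^+ n * (sigma / csmall) ^+ n.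
have b0 : 0 <= b.
  apply: mulr_ge0; first by rewrite mulr_ge0 ?exprn_ge0.
  apply: exprn_ge0; exact: (divr_ge0 (ltW s0) (ltW cs0)).
have step k : (k < m)%N -> (`|F k.+1 - F k|%:E <= b%:E * \int[mu]_(z in K k) g z)%E.
  move=> km; have [Oy _] := HO k (ltnW km); have [Oy' _] := HO k.+1 km.
  have near : enorm (y k.+1 - y k) <= cjump * scale O sigma (y k) by rewrite -rhoE; exact: Hs.
  apply: le_trans (jump_average f n0 oO bO s1 Oy Oy' near) _.
  rewrite /b (EFinM (2 * 4 ^+ n)) -muleA; apply: lee_wpmul2l; first by rewrite lee_fin mulr_ge0 ?exprn_ge0.
  exact: (osc_le_integral f n0 oO bO s1 Oy).
have Fm : F m = average (Kcube sigma x0) f by congr (average (Kcube sigma _) f).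
have F0 : F 0%N = average (Kcube sigma x) f by congr (average (Kcube sigma _) f).
have H := abs_telescope step; rewrite (distrC (F m)) Fm F0 in H.
apply: le_trans H _; rewrite -ge0_sume_distrr; last first.
  by move=> i _; apply: integral_ge0.
apply: le_trans (lee_wpmul2l _ S) _; first by rewrite lee_fin.
rewrite muleA -EFinM.
rewrite (_ : b * 2 = 2 * (2 * 4 ^+ n) * csmall^-1 ^+ n * sigma ^+ n).
  exact: lexx.
by rewrite /b exprMn; ring.
Qed.

End john_averages.

(** * Whitney cubes and the weighted estimate *)

Section mean_removal.
Context {R : realType}.
Local Open Scope ereal_scope.

Lemma poweRD_le (p : R) (a b : \bar R) : (0 < p)%R -> 0 <= a -> 0 <= b ->
  (a + b) `^ p <= (2 `^ p)%:E * (a `^ p + b `^ p).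
Proof.
move=> p0 a0 b0; wlog ab : a b a0 b0 / a <= b => [H|].
  have [|/ltW] := leP a b; first exact: H.
  by rewrite addeC [_ `^ _ + _]addeC; exact: H.
have b20 : 0 <= 2%:E * b by rewrite mule_ge0.
apply: (@le_trans _ _ ((2%:E * b) `^ p)).
  apply: le_poweR; [exact: ltW|exact: adde_ge0|].
  have -> : (2%:E = 1%:E + 1%:E :> \bar R) by rewrite -EFinD.
  by rewrite ge0_muleDl ?lee_fin// mul1e leeD2r.
rewrite poweRM// poweR_EFin; apply: lee_wpmul2l; first by rewrite lee_fin powR_ge0.
by rewrite leeDr// poweR_ge0.
Qed.

Context d (T : measurableType d) (mu : {measure set T -> \bar R}).

(* [c \int w = \int (c - f) w], and Hoelder's inequality bounds the right side. *)
Lemma remove_constant (O : set T) (w f : T -> R) (p W c : R) :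
  measurable O -> measurable_fun O f -> measurable_fun O w ->
  (forall x, O x -> 0 < w x)%R -> (1 < p)%R -> (0 < W)%R ->
  \int[mu]_(x in O) (w x)%:E = W%:E ->
  \int[mu]_(x in O) (f x * w x)%:E = 0 ->
  \int[mu]_(x in O) (`|f x| `^ p * w x)%:E < +oo ->
  \int[mu]_(x in O) (`|f x| `^ p * w x)%:E <=
  (2 `^ p * 2)%:E * \int[mu]_(x in O) (`|f x - c| `^ p * w x)%:E.
Proof.
move=> mO mf mw w0 p1 W0 IW fw0 fp.
have p0 : (0 < p)%R by exact: lt_trans p1.
have w0' x : O x -> (0 <= w x)%R by move=> /w0/ltW.
have mpw (g : T -> R) : measurable_fun O g -> measurable_fun O (fun x => (`|g x| `^ p * w x)%:E).
  move=> mg; apply/measurable_EFinP; apply: measurable_funM => //.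
  by apply: (measurableT_comp (measurable_powR p)); exact: measurableT_comp.
have mfc : measurable_fun O (fun x => f x - c)%R by exact: measurable_funB.
set S := \int[mu]_(x in O) (`|f x - c| `^ p * w x)%:E.
have S0 : 0 <= S by apply: integral_ge0 => x Ox; rewrite lee_fin mulr_ge0 ?powR_ge0 ?w0'.
have Iw : mu.-integrable O (EFin \o w).
  apply/integrableP; split; first exact/measurable_EFinP.
  under eq_integral => x /set_mem Ox do rewrite /= ger0_norm ?w0'//.
  by rewrite IW ltry.
have Ifp : mu.-integrable O (fun x => (`|f x| `^ p * w x)%:E).
  apply/integrableP; split; first exact: mpw.
  under eq_integral => x /set_mem Ox do rewrite gee0_abs ?lee_fin ?mulr_ge0 ?powR_ge0 ?w0'//.
  by [].
(* From [|f| <= 1 + |f|^p] and the finite mass of [w]; this allows the integral of [(c - f) w] to be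
   split. *)
have Ifw : mu.-integrable O (fun x => (f x * w x)%:E).
  apply: (@le_integrable _ _ _ mu O mO _ (fun x => (w x)%:E + (`|f x| `^ p * w x)%:E)).
  - by apply/measurable_EFinP; exact: measurable_funM.
  - move=> x Ox; rewrite -EFinD !abse_EFin lee_fin normrM (ger0_norm (w0' _ Ox)) [leRHS]ger0_norm; last first.
      by rewrite addr_ge0 ?mulr_ge0 ?powR_ge0 ?w0'.
    rewrite -[X in (_ <= X + _)%R]mul1r -mulrDl ler_wpM2r ?w0'//.
    have [f1|f1] := leP `|f x|%R 1%R; first by rewrite (le_trans f1)// lerDl powR_ge0.
    apply: (@le_trans _ _ (`|f x| `^ p)%R); last by rewrite lerDr.
    by rewrite -[leLHS]powRr1// ler_powR// ltW.
  - exact: integrableD.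
have Ic : mu.-integrable O (fun x => (c * w x)%:E).
  by have := integrableZl mO c Iw; under eq_fun do rewrite -EFinM.
have cW : (c * W)%:E = \int[mu]_(x in O) ((c - f x) * w x)%:E.
  transitivity (\int[mu]_(x in O) ((c * w x)%:E - (f x * w x)%:E)); last first.
    by apply: eq_integral => x _; rewrite -EFinB mulrBl.
  rewrite integralB// fw0 sube0 EFinM -IW.
  have <- := integralZl mO Iw c.
  by apply: eq_integral => x _; rewrite EFinM.
pose q := (p / (p - 1))%R.
have pm1 : (0 < p - 1)%R by rewrite subr_gt0.
have q0 : (0 < q)%R by rewrite divr_gt0.
have pq : (p^-1 + q^-1 = 1)%R by rewrite /q; field; rewrite !gt_eqF.
(* The weight is shared between the factors as [w = w^(1/p) w^(1/q)]. *)
pose u x := (`|f x - c| * w x `^ p^-1)%:E.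
pose v x := (w x `^ q^-1)%R.
have wi r : measurable_fun O (fun x => w x `^ r)%R by exact: (measurableT_comp (measurable_powR r)).
have u_ge0 x : O x -> 0 <= u x by move=> _; rewrite lee_fin mulr_ge0 ?powR_ge0.
have HH : (\int[mu]_(x in O) (u x * (v x)%:E)) `^ p <=
    (W `^ (p / q))%:E * \int[mu]_(x in O) (u x `^ p).
  apply: (hoelder_powR mO) => //.
  - by apply/measurable_EFinP; apply: measurable_funM => //; exact: measurableT_comp.
  - exact: wi.
  - by move=> x _; exact: powR_ge0.
  - rewrite -IW le_eqVlt; apply/orP; left; apply/eqP; apply: eq_integral => x /set_mem Ox.
    by rewrite /v -powRrM mulVf ?gt_eqF// powRr1// w0'.
have E1 : \int[mu]_(x in O) (u x * (v x)%:E) = \int[mu]_(x in O) (`|f x - c| * w x)%:E.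
  apply: eq_integral => x /set_mem Ox; rewrite -EFinM -mulrA /v -powRD ?pq ?powRr1 ?w0'//.
  by rewrite oner_eq0.
have E2 : \int[mu]_(x in O) (u x `^ p) = S.
  apply: eq_integral => x /set_mem Ox; rewrite poweR_EFin powRM ?powR_ge0//.
  by rewrite -powRrM mulVf ?gt_eqF// powRr1// w0'.
rewrite E1 E2 in HH.
have H1 : (`|c| * W)%:E <= \int[mu]_(x in O) (`|f x - c| * w x)%:E.
  have -> : (`|c| * W)%:E = `|(c * W)%:E| by rewrite abse_EFin normrM (gtr0_norm W0).
  rewrite cW; apply: le_trans (le_abse_integral mu mO _) _.
    apply/measurable_EFinP; apply: measurable_funM => //; exact: measurable_funB.
  rewrite le_eqVlt; apply/orP; left; apply/eqP; apply: eq_integral => x /set_mem Ox.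
  by rewrite abse_EFin normrM (ger0_norm (w0' _ Ox)) distrC.
have H2 : (`|c| `^ p * W)%:E <= S.
  have cW0 : 0 <= (`|c| * W)%:E by rewrite lee_fin mulr_ge0 ?(ltW W0).
  have := le_trans (le_poweR (ltW p0) cW0 H1) HH.
  rewrite poweR_EFin powRM ?(ltW W0)//.
  have -> : (p / q = p - 1)%R by rewrite /q; field; rewrite !gt_eqF.
  have -> : (W `^ p = W `^ (p - 1) * W)%R.
    rewrite -{3}(powRr1 (ltW W0)) -powRD; first by rewrite subrK.
    by rewrite (gt_eqF W0) implybT.
  rewrite mulrCA EFinM lee_pmul2l//.
  by rewrite lte_fin powR_gt0.
have mfcp := mpw _ mfc.
have mcp : measurable_fun O (fun x => (`|c| `^ p * w x)%:E).
  by apply/measurable_EFinP; exact: measurable_funM.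
have msum := emeasurable_funD mfcp mcp.
have fp0 (g : T -> R) x : O x -> 0 <= (`|g x| `^ p * w x)%:E.
  by move=> Ox; rewrite lee_fin mulr_ge0 ?powR_ge0 ?w0'.
have cp0 x : O x -> 0 <= (`|c| `^ p * w x)%:E by exact: (fp0 (cst c)).
have fcp0 x : O x -> 0 <= (`|f x - c| `^ p * w x)%:E by exact: (fp0 (fun x => f x - c)%R).
have sum0 x : O x -> 0 <= (`|f x - c| `^ p * w x)%:E + (`|c| `^ p * w x)%:E.
  by move=> Ox; rewrite adde_ge0 ?cp0 ?fcp0.
have P0 : 0 <= (2 `^ p)%:E by rewrite lee_fin powR_ge0.
apply: (@le_trans _ _ ((2 `^ p)%:E * \int[mu]_(x in O) ((`|f x - c| `^ p * w x)%:E + (`|c| `^ p * w x)%:E))).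
  have <- := ge0_integralZl mu mO msum sum0 P0.
  apply: ge0_le_integral => //; [exact: (fp0 f)|exact: mpw|exact: measurable_funeM|].
  move=> x Ox; rewrite -EFinD -EFinM lee_fin -mulrDl mulrA ler_wpM2r ?w0'//.
  have fc : (`|f x| <= `|f x - c| + `|c|)%R by rewrite -{1}[f x](subrK c) ler_normD.
  apply: (le_trans (le_powR (ltW p0) (normr_ge0 _) fc)).
  by have := @poweRD_le p `|f x - c|%:E `|c|%:E p0; rewrite !lee_fin => /(_ (normr_ge0 _) (normr_ge0 _)).
rewrite (ge0_integralD mu mO fcp0 mfcp cp0 mcp).
rewrite EFinM -muleA; apply: lee_wpmul2l; first by rewrite lee_fin powR_ge0.
have -> : 2%:E * S = S + S by rewrite (_ : 2%:E = 1%:E + 1%:E) ?EFinD// ge0_muleDl ?lee_fin// mul1e.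
apply: leeD; first exact: lexx.
suff <- : (`|c| `^ p * W)%:E = \int[mu]_(x in O) (`|c| `^ p * w x)%:E by [].
rewrite EFinM -IW.
have <- := integralZl mO Iw (`|c| `^ p).
by apply: eq_integral => x _; rewrite EFinM.
Qed.

End mean_removal.

Section weighted_local.
Context {R : realType} d (T : measurableType d) (mu : {measure set T -> \bar R}).
Local Open Scope ereal_scope.

(** On [D] the weight is within a factor [a] of the constant [v], so passing to the unweighted
    inequality for [f - b] and back costs [a * a]. Replacing [b] by [c] costs [B * H] pointwise; [H]
    is later [M] plus the cone operator applied to [M]. *)
Lemma weighted_transfer (D : set T) (f w : T -> R) (M H : T -> \bar R) (p a b c B K v : R) :
  measurable D -> measurable_fun D f -> measurable_fun D w ->
  measurable_fun D M -> measurable_fun D H ->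
  (0 <= v)%R -> (0 < p)%R -> (0 <= a)%R -> (0 <= B)%R -> (0 <= K)%R ->
  (forall y, D y -> [/\ 0 <= w y, w y <= a * v & v <= a * w y]%R) ->
  (forall y, D y -> 0 <= M y /\ M y <= H y) ->
  (forall y, D y -> `|f y - c|%:E <= `|f y - b|%:E + B%:E * H y) ->
  \int[mu]_(y in D) (`|f y - b| `^ p)%:E <= K%:E * \int[mu]_(y in D) (M y `^ p) ->
  \int[mu]_(y in D) (`|f y - c| `^ p * w y)%:E <=
  (2 `^ p * (a * a * K + B `^ p))%:E * \int[mu]_(y in D) (H y `^ p * (w y)%:E).
Proof.
move=> mD mf mw mM mH v0 p0 a0 B0 K0 wv MH fH fM.
pose u y : R := (`|f y - b| `^ p)%R.
have mfb : measurable_fun D (fun y => (u y)%:E).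
  apply: measurable_powR_comp; apply: measurableT_comp => //; exact: measurable_funB.
have mHw : measurable_fun D (fun y => H y `^ p * (w y)%:E).
  by apply: emeasurable_funM; [exact: measurable_poweR_comp|exact/measurable_EFinP].
have mMp : measurable_fun D (fun y => M y `^ p) by exact: measurable_poweR_comp.
have H0 y : D y -> 0 <= H y by move=> /MH[M0 /(le_trans M0)].
have Hw0 y : D y -> 0 <= H y `^ p * (w y)%:E.
  by move=> /wv[w0 _ _]; rewrite mule_ge0 ?poweR_ge0.
have u0 y : D y -> 0 <= (u y)%:E by move=> _; rewrite lee_fin powR_ge0.
pose k1 : R := (2 `^ p * (a * v))%R; pose k2 : R := (2 `^ p * B `^ p)%R.
have k10 : 0 <= k1%:E by rewrite lee_fin !mulr_ge0 ?powR_ge0.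
have k20 : 0 <= k2%:E by rewrite lee_fin mulr_ge0 ?powR_ge0.
set I := \int[mu]_(y in D) (H y `^ p * (w y)%:E).
have vM : v%:E * \int[mu]_(y in D) (M y `^ p) <= a%:E * I.
  rewrite -!ge0_integralZl ?lee_fin//; last by move=> y _; exact: poweR_ge0.
  apply: ge0_le_integral => //.
  - by move=> y Dy; rewrite mule_ge0 ?poweR_ge0.
  - exact: measurable_funeM.
  - exact: measurable_funeM.
  move=> y Dy; have [w0 _ vw] := wv _ Dy; have [M0 lMH] := MH _ Dy.
  rewrite muleCA -EFinM [leRHS]muleC; apply: lee_pmul.
  - by rewrite lee_fin.
  - exact: poweR_ge0.
  - by rewrite lee_fin.
  - exact: le_poweR (ltW p0) M0 lMH.
apply: (@le_trans _ _ (\int[mu]_(y in D) (k1%:E * (u y)%:E + k2%:E * (H y `^ p * (w y)%:E)))).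
  apply: ge0_le_integral => //.
  - by move=> y /wv[w0 _ _]; rewrite lee_fin mulr_ge0 ?powR_ge0.
  - apply/measurable_EFinP; apply: measurable_funM => //.
    by apply: (measurableT_comp (measurable_powR p)); apply: measurableT_comp => //; exact: measurable_funB.
  - by apply: emeasurable_funD; exact: measurable_funeM.
  move=> y Dy; have [w0 wv1 _] := wv _ Dy.
  have BH : 0 <= B%:E * H y by rewrite mule_ge0 ?H0.
  have n0 : 0 <= `|f y - c|%:E by rewrite lee_fin.
  have n1 : 0 <= `|f y - b|%:E by rewrite lee_fin.
  have := le_trans (le_poweR (ltW p0) n0 (fH y Dy)) (poweRD_le p0 n1 BH).
  rewrite !poweR_EFin poweRM ?lee_fin ?H0// poweR_EFin -/(u y) => P1.
  have w0' : 0 <= (w y)%:E by rewrite lee_fin.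
  rewrite EFinM; apply: le_trans (lee_wpmul2r w0' P1) _.
  rewrite -muleA ge0_muleDl ?mule_ge0 ?poweR_ge0 ?u0 ?lee_fin ?powR_ge0//.
  rewrite ge0_muleDr ?mule_ge0 ?poweR_ge0 ?u0 ?lee_fin ?powR_ge0//.
  apply: leeD; last by rewrite /k2 EFinM !muleA.
  rewrite -!EFinM lee_fin /k1 -mulrA ler_wpM2l ?powR_ge0// mulrC ler_wpM2r ?powR_ge0//.
rewrite ge0_integralD//; last 4 first.
- by move=> y Dy; rewrite mule_ge0 ?u0.
- exact: measurable_funeM.
- by move=> y Dy; rewrite mule_ge0 ?Hw0.
- exact: measurable_funeM.
rewrite (ge0_integralZl mu mD mfb u0 k10) (ge0_integralZl mu mD mHw Hw0 k20) -/I.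
have I0 : 0 <= I by exact: integral_ge0.
have aaK : (0 <= a * a * K)%R by rewrite !mulr_ge0.
rewrite mulrDr EFinD ge0_muleDl ?lee_fin ?mulr_ge0 ?powR_ge0//.
apply: leeD => //.
apply: (le_trans (lee_wpmul2l k10 fM)).
rewrite (_ : k1 = (2 `^ p * a) * v)%R; last by rewrite /k1 mulrA.
have aK0 : 0 <= (2 `^ p * a * K)%:E by rewrite lee_fin !mulr_ge0 ?powR_ge0.
set J := \int[mu]_(y in D) (M y `^ p) in vM *.
have e1 : (2 `^ p * a * v)%:E * (K%:E * J) = (2 `^ p * a * K)%:E * (v%:E * J).
  by rewrite !muleA -!EFinM mulrAC.
have e2 : (2 `^ p * (a * a * K))%:E * I = (2 `^ p * a * K)%:E * (a%:E * I).
  by rewrite muleA -EFinM -!mulrA (mulrC K).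
by rewrite e1 e2; exact: lee_wpmul2l.
Qed.

End weighted_local.

(** * Whitney cubes at scale d / sigma *)

Section whitney.
Context {R : realType} {n : nat} (O : set 'rV[R]_n).
Local Notation T := (lebesgue_rV R n).
Local Notation mu := (mu_rV R n).
Hypotheses (n0 : (0 < n)%N) (oO : open O) (bO : boundary O !=set0).
Implicit Types (x y z : 'rV[R]_n) (f : 'rV[R]_n -> R) (sigma : R).
Local Notation d := (bdist O).
Local Notation cdil := (@cdil R n).

(** Required at every point of [D], so that any of its points can be the center of an admissible
    cube containing [D]. *)
Definition whitney sigma j (D : set T) : Prop :=
  forall y, D y -> O y /\ 2 ^- j <= cdil * scale O sigma y.

Let c0 : 0 < cdil. Proof. exact: cdil_gt0. Qed.

Let Nc : n%:R * cdil = 4^-1.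
Proof. by rewrite /cdil; field; rewrite pnatr_eq0 -lt0n. Qed.

Let N1 : 1 <= n%:R :> R. Proof. by rewrite ler1n. Qed.

Lemma side_gt0 j : 0 < 2 ^- j :> R.
Proof. by rewrite invr_gt0 exprn_gt0. Qed.

Lemma dyad_sub_cube j x y : dyad j x y -> dyad j x `<=` cube y (2 ^- j).
Proof. by move=> xy z; rewrite -(dyad_eq xy) => yz i; exact: dyad_dist. Qed.

Lemma dyad_enorm j x y z : dyad j x y -> dyad j x z -> enorm (z - y) <= n%:R * 2 ^- j.
Proof.
by move=> xy /(dyad_sub_cube xy) yz; apply: enorm_cube yz _; exact: ltW (side_gt0 j).
Qed.

Lemma scale_lip sigma y z : 1 <= sigma -> scale O sigma y <= scale O sigma z + enorm (y - z).
Proof.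
move=> s1; have s0 : 0 < sigma by exact: lt_le_trans s1.
rewrite /scale; apply: (@le_trans _ _ ((d z + enorm (y - z)) / sigma)).
  by rewrite ler_pM2r ?invr_gt0// bdist_lip.
by rewrite mulrDl lerD2l ler_pdivrMr// ler_peMr ?enorm_ge0.
Qed.

(** Points of a Whitney cube are at distance at most [n * 2^-j <= d y / 4] from each other. *)
Lemma whitney_doubling sigma j x y z : 1 <= sigma -> whitney sigma j (dyad j x) ->
  dyad j x y -> dyad j x z -> d y / 2 < d z /\ d z <= 2 * d y.
Proof.
move=> s1 W xy xz; have [Oy hy] := W _ xy.
have e := dyad_enorm xy xz.
have l1 := bdist_lip bO z y; have l2 := bdist_lip bO y z; rewrite (enormB y z) in l2.
have sl := scale_le bO s1 y; have dy := bdist_gt0 oO bO Oy.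
have h1 : n%:R * 2 ^- j <= d y / 4.
  apply: (@le_trans _ _ (n%:R * (cdil * scale O sigma y))).
    by apply: ler_wpM2l hy; exact: le_trans N1.
  rewrite mulrA Nc mulrC; apply: ler_wpM2r => //.
by split; move: e l1 l2 h1 dy; lra.
Qed.

Lemma stops_whitney sigma : 1 <= sigma -> stops (whitney sigma) = O.
Proof.
move=> s1; apply/seteqP; split => x; first by move=> [j /(_ x (dyad_refl j x))[]].
move=> Ox; have t0 := scale_gt0 oO bO s1 Ox; have sl := scale_le bO s1 x.
set t := scale O sigma x in t0 sl.
have [j jh] : exists j, 2 ^- j < cdil * t / 2.
  have h0 : 0 < cdil * t / 2 by rewrite divr_gt0// mulr_gt0.
  exists (Num.bound (cdil * t / 2)^-1); rewrite invf_plt ?posrE ?exprn_gt0//.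
  apply: (lt_trans (archi_boundP _)); first by rewrite invr_ge0 ltW.
  by rewrite -natrX ltr_nat ltn_expl.
exists j => y xy; have e := dyad_enorm (dyad_refl j x) xy.
have e2 : n%:R * 2 ^- j <= t / 8.
  apply: (@le_trans _ _ (n%:R * (cdil * t / 2))).
    by apply: ler_wpM2l; [exact: le_trans N1|exact: ltW].
  have -> : n%:R * (cdil * t / 2) = n%:R * cdil * t / 2 by ring.
  by rewrite Nc; move: t0; lra.
split.
  apply: (eball_sub_open oO Ox); apply: le_lt_trans (le_trans e e2) _.
  by apply: lt_le_trans sl; move: t0; lra.
have := scale_lip x y s1; rewrite -/t enormB => l.
have l' : t / 2 <= scale O sigma y by move: l e e2 t0; lra.
apply: le_trans (ltW jh) _; rewrite -(mulrA cdil t); apply: ler_wpM2l l'; exact: ltW.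
Qed.

(** Maximality bounds the side from below, because the parent violates the stopping rule. *)
Lemma whitney_size : bounded_set O -> O !=set0 -> exists2 c1 : R, 0 < c1 &
  forall sigma j x y, 1 <= sigma -> first_stop (whitney sigma) j x -> dyad j x y ->
  c1 * scale O sigma y <= 2 ^- j.
Proof.
move=> /bounded_setP[B B0 HB] [x0 Ox0].
pose Dm := d x0 + 2 * B; have d0 := bdist_gt0 oO bO Ox0.
have Dm0 : 0 < Dm by rewrite /Dm; lra.
exists (Num.min (cdil / 4) Dm^-1); first by rewrite lt_min divr_gt0//= invr_gt0.
move=> sigma j x y s1 Fx xy; have [[W Hmin] Oy] : first_stop (whitney sigma) j y /\ O y.
  have Fy := first_stop_dyad Fx xy; split=> //.
  by have [/(_ y (dyad_refl j y))[]] := Fy.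
have t0 := scale_gt0 oO bO s1 Oy; have sl := scale_le bO s1 y.
(* A cube of level 0 has no parent among the candidates; its side is 1, and [scale] is bounded since
   [O] is. *)
case: j => [|j] in Fx xy W Hmin *.
  rewrite expr0 invr1; apply: (@le_trans _ _ (Dm^-1 * scale O sigma y)).
    by apply: ler_wpM2r; [exact: ltW|rewrite ge_min lexx orbT].
  rewrite mulrC ler_pdivrMr// mul1r; apply: le_trans sl _.
  have nx : enorm (- x0) = enorm x0 by rewrite -(sub0r x0) enormB subr0.
  have l := bdist_lip bO y x0; have b3 := enormD y (- x0); rewrite nx in b3.
  by have := HB _ Oy; have := HB _ Ox0; move: l b3; rewrite /Dm; lra.
apply: (@le_trans _ _ (cdil / 4 * scale O sigma y)).
  by apply: ler_wpM2r; [exact: ltW|rewrite ge_min lexx].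
(* A point [y'] of the parent is outside [O], so that [d y <= |y' - y|], or has a small scale;
   either way [scale] at [y] is at most a multiple of the side. *)
have /existsNP[y' /not_implyP[yy' /not_andP NW]] := Hmin j (ltnSn j).
have e := dyad_enorm (dyad_refl j y) yy'.
have hj : 2 ^- j = 2 * 2 ^- j.+1 :> R by rewrite exprS invfM mulrA mulfV ?mul1r.
have h0 := side_gt0 j.+1; rewrite hj in e NW.
set h := 2 ^- j.+1 in h0 e NW *.
have cn : cdil * (n%:R * (2 * h)) = h / 2.
  have -> : cdil * (n%:R * (2 * h)) = n%:R * cdil * (2 * h) by ring.
  by rewrite Nc; field.
have ce : cdil * enorm (y' - y) <= h / 2 by rewrite -cn; apply: ler_wpM2l e; exact: ltW.
suff : cdil * scale O sigma y <= 4 * h by move: h0; lra.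
case: NW => [NO|/negP]; last first.
  rewrite -ltNge => lt; have l := ler_wpM2l (ltW c0) (scale_lip y y' s1).
  by rewrite mulrDr enormB in l; move: l ce lt h0; lra.
have dy : d y <= enorm (y' - y).
  rewrite leNgt; apply/negP => lt; apply: NO; exact: (eball_sub_open oO Oy).
have := ler_wpM2l (ltW c0) (le_trans sl dy).
by move: ce h0; lra.
Qed.

Lemma whitney_cube_sub sigma j x y (h : R) : 1 <= sigma -> whitney sigma j (dyad j x) ->
  dyad j x y -> h <= 2 ^- j -> cube y (sigma * h) `<=` O.
Proof.
move=> s1 W xy hj; have [Oy hy] := W _ xy.
have t0 := scale_gt0 oO bO s1 Oy.
apply: subset_trans (dilated_cube_sub n0 oO bO s1 Oy); apply: le_cube.
apply: ler_wpM2l; first by apply/ltW; exact: lt_le_trans s1.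
apply: le_trans hj (le_trans hy _); rewrite -mulrA.
by have := mulr_gt0 c0 t0; lra.
Qed.

End whitney.

Section deviation_average.
Context {R : realType} {n : nat}.
Local Notation T := (lebesgue_rV R n).
Local Notation mu := (mu_rV R n).

Lemma dev_average_sub (Q K : set T) (f : T -> R) (v V : R) :
  measurable Q -> measurable K -> Q `<=` K -> mu Q = v%:E -> mu K = V%:E ->
  0 < v -> 0 < V -> mu.-integrable Q (EFin \o f) ->
  (dev mu Q f (average Q f) <= (2 * V)%:E * mean_osc K f)%E.
Proof.
move=> mQ mK QK muQ muK v0 V0 IQ.
have [If|nIf] := pselect (mu.-integrable K (EFin \o f)); last first.
  rewrite /mean_osc asboolF// gt0_muley ?leey// lte_fin; exact: mulr_gt0.
have mf : measurable_fun K f by have /measurable_EFinP := measurable_int _ If.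
have mfQ : measurable_fun Q f by exact: measurable_funS mf.
have S := dev_shift mu (average Q f) (average K f) mQ mfQ.
have A := average_dev (average K f) mQ muQ v0 IQ.
have L := le_dev_sub mu (average K f) mQ mK mf QK.
have E : ((2 * V)%:E * mean_osc K f = dev mu K f (average K f) + dev mu K f (average K f))%E.
  rewrite EFinM -muleA (mean_osc_dev muK V0 If).
  have -> : (2%:E = 1%:E + 1%:E :> \bar R)%E by rewrite -EFinD.
  by rewrite ge0_muleDl ?lee_fin// mul1e.
rewrite E; apply: (le_trans S); apply: leeD; first exact: L.
apply: le_trans L; apply: le_trans A; rewrite EFinM muQ; exact: lexx.
Qed.

End deviation_average.

Section whitney_estimates.
Context {R : realType} {n : nat} (O : set 'rV[R]_n).
Local Notation T := (lebesgue_rV R n).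
Local Notation mu := (mu_rV R n).
Hypotheses (n0 : (0 < n)%N) (oO : open O) (bO : boundary O !=set0).
Implicit Types (x y z : 'rV[R]_n) (f : T -> R) (sigma : R).
Local Notation d := (bdist O).
Local Notation cdil := (@cdil R n).

Let c0 : 0 < cdil. Proof. exact: cdil_gt0. Qed.

(** The dyadic cube lies in the cube of half-side [2^-i] about [y], which has [2^n] times its volume
    and is admissible for [M y]. Changing the mean costs another factor 2. *)
Lemma dyad_dev_sharp sigma f j x i z y : 1 <= sigma ->
  whitney O sigma j (dyad j x) -> mu.-integrable (dyad j x) (EFin \o f) ->
  (j <= i)%N -> dyad j x z -> dyad i z y ->
  (dev mu (dyad i z) f (average (dyad i z) f) <=
   (2 ^+ n.+1)%:E * sharp_max_res O sigma f y * mu (dyad i z))%E.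
Proof.
move=> s1 W If ji xz zy; have hi := @side_gt0 R i.
have zsub : dyad i z `<=` dyad j x by rewrite -(dyad_eq xz); exact: dyad_le.
have Iz : mu.-integrable (dyad i z) (EFin \o f).
  by apply: integrableS If => //; exact: measurable_dyad.
have hji : 2 ^- i <= 2 ^- j :> R.
  by rewrite lef_pV2 ?posrE ?exprn_gt0// ler_weXn2l// ler1n.
have KO := whitney_cube_sub n0 oO bO s1 W (zsub _ zy) hji.
have v0 : 0 < (2 ^- i) ^+ n :> R by exact: exprn_gt0.
have V0 : 0 < (2 * 2 ^- i) ^+ n :> R by apply: exprn_gt0; exact: mulr_gt0.
have H := dev_average_sub (measurable_dyad i z) (measurable_cube y (2 ^- i))
  (dyad_sub_cube zy) (mu_dyad i z) (mu_cube y hi) v0 V0 Iz.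
apply: le_trans H _.
have yy : cube y (2 ^- i) y by move=> k; rewrite subrr normr0.
have M0 := mean_osc_le_sharp f s1 hi yy KO.
rewrite muleAC (mu_dyad i z) -EFinM exprMn mulrA -exprS.
apply: lee_wpmul2l => //; rewrite lee_fin mulr_ge0 ?exprn_ge0//; exact: ltW.
Qed.

Lemma whitney_fefferman_stein (p : R) : 0 < p -> exists2 K : R, 0 < K &
  forall sigma f j x, 1 <= sigma -> measurable_fun (O : set T) f ->
  whitney O sigma j (dyad j x) ->
  (\int[mu]_(y in dyad j x) (`|f y - average (dyad j x) f| `^ p)%:E <=
   K%:E * \int[mu]_(y in dyad j x) (sharp_max_res O sigma f y `^ p))%E.
Proof.
move=> p0; have [K K0 HK] := @dyadic_fefferman_stein R n p p0.
pose a : R := 2 ^+ n.+1; have a0 : 0 < a by exact: exprn_gt0.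
exists (K * a `^ p); first by rewrite mulr_gt0 ?powR_gt0.
move=> sigma f j x s1 mf W.
have DO : dyad j x `<=` O by move=> y /W[].
pose M : T -> \bar R := sharp_max_res O sigma f.
have M0 z : (0 <= M z)%E by exact: sharp_ge0.
have mD : measurable (dyad j x : set T) by exact: measurable_dyad.
have mM : measurable_fun (dyad j x : set T) M.
  apply: measurable_funS (@measurable_sharp R n O sigma f s1) => //; exact: measurable_open.
have mMp : measurable_fun (dyad j x : set T) (fun y => M y `^ p)%E by exact: measurable_poweR_comp.
(* If [f] is not integrable on the dyadic cube, it is not integrable on the larger cube about any
   [y] in it, so [M] is +oo there and the right side is infinite. *)
have [If|nIf] := pselect (mu.-integrable (dyad j x) (EFin \o f)); last first.
  have Moo y : dyad j x y -> M y = +oo%E.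
    move=> xy; have hj := @side_gt0 R j.
    have yy : cube y (2 ^- j) y by move=> k; rewrite subrr normr0.
    have KO := whitney_cube_sub n0 oO bO s1 W xy (lexx _).
    have := mean_osc_le_sharp f s1 hj yy KO; rewrite /mean_osc asboolF ?leye_eq; first by move/eqP.
    move=> IK; apply: nIf; apply: integrableS IK => //; [exact: measurable_cube|exact: dyad_sub_cube].
  have := @integral_ge_cst _ T R mu (dyad j x) +oo%E (fun y => M y `^ p)%E mD (leey _) mMp.
  rewrite mu_dyad gt0_mulye ?lte_fin ?exprn_gt0// => /(_ _)/wrap[].
    by move=> y /Moo ->; rewrite poweRyr// gt_eqF.
  rewrite leye_eq => /eqP ->; rewrite gt0_muley ?leey// lte_fin mulr_gt0 ?powR_gt0//.
have := HK j x f (fun y => a%:E * M y)%E If (measurable_funeM _ mM) _.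
move=> /(_ _)/wrap[]; first by move=> i z y ji xz zy; exact: (dyad_dev_sharp s1 W If ji xz zy).
move=> H; apply: le_trans H _.
rewrite EFinM -muleA; apply: lee_wpmul2l; first by rewrite lee_fin ltW.
rewrite -ge0_integralZl//; last 2 first.
- by move=> y _; exact: poweR_ge0.
- by rewrite lee_fin powR_ge0.
rewrite le_eqVlt; apply/orP; left; apply/eqP; apply: eq_integral => y _.
by rewrite poweRM ?lee_fin ?(ltW a0)// poweR_EFin.
Qed.

End whitney_estimates.

Section weighted_sums.
Context {R : realType} d (T : measurableType d) (mu : {measure set T -> \bar R}).
Local Open Scope ereal_scope.

Lemma abs_sub_le3 (z b k c : R) (u v : \bar R) :
  `|b - k|%:E <= u -> `|k - c|%:E <= v -> `|z - c|%:E <= `|z - b|%:E + (u + v).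
Proof.
move=> bk kc; apply: le_trans (leeD (lexx _) (leeD bk kc)); rewrite -!EFinD lee_fin.
have -> : (z - c = (z - b) + ((b - k) + (k - c)))%R by ring.
by rewrite (le_trans (ler_normD _ _))// lerD2l ler_normD.
Qed.

Lemma measurable_weighted_powR (D : set T) (f w : T -> R) (c p : R) :
  measurable_fun D f -> measurable_fun D w ->
  measurable_fun D (fun y => (`|f y - c| `^ p * w y)%:E).
Proof.
move=> mf mw; apply/measurable_EFinP; apply: measurable_funM => //.
apply: (measurableT_comp (measurable_powR p)); apply: measurableT_comp => //.
exact: measurable_funB.
Qed.

Lemma powR_comparable (a b s : R) : (0 < a -> 0 < b -> b <= 2 * a -> a <= 2 * b ->
  b `^ s <= 2 `^ `|s| * a `^ s)%R.
Proof.
move=> a0 b0 ba ab; have [s0|s0] := leP 0%R s.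
  rewrite (ger0_norm s0) -powRM ?(ltW a0)//; apply: le_powR => //; exact: ltW.
have a20 : (0 < a / 2)%R by rewrite divr_gt0.
have -> : (2 `^ `|s| * a `^ s = (a / 2) `^ s)%R.
  have E : (a `^ s = (a / 2) `^ s * 2 `^ s)%R by rewrite -powRM ?(ltW a20)// divfK.
  by rewrite (ltr0_norm s0) powRN E mulrCA mulVf ?mulr1// gt_eqF// powR_gt0.
apply: ge_powRN => //; [exact: ltW|by rewrite ler_pdivrMr// mulrC].
Qed.

Lemma integral_poweRD_le (D : set T) (M N : T -> \bar R) (w : T -> R) (p : R) :
  measurable D -> measurable_fun D M -> measurable_fun D N -> measurable_fun D w ->
  (forall y, D y -> 0 <= M y) -> (forall y, D y -> 0 <= N y) -> (forall y, D y -> 0 <= w y)%R ->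
  (0 < p)%R ->
  \int[mu]_(y in D) ((M y + N y) `^ p * (w y)%:E) <= (2 `^ p)%:E *
   (\int[mu]_(y in D) (M y `^ p * (w y)%:E) + \int[mu]_(y in D) (N y `^ p * (w y)%:E)).
Proof.
move=> mD mM mN mw M0 N0 w0 p0.
have mpw (g : T -> \bar R) : measurable_fun D g -> measurable_fun D (fun y => g y `^ p * (w y)%:E).
  by move=> mg; apply: emeasurable_funM; [exact: measurable_poweR_comp|exact/measurable_EFinP].
have pw0 (g : T -> \bar R) y : D y -> 0 <= g y `^ p * (w y)%:E.
  by move=> Dy; rewrite mule_ge0 ?poweR_ge0// lee_fin w0.
have P0 : 0 <= (2 `^ p)%:E by rewrite lee_fin powR_ge0.
have := mpw _ mM; have := mpw _ mN => mNp mMp.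
rewrite -(ge0_integralD mu mD (pw0 M) mMp (pw0 N) mNp).
have s0 y : D y -> 0 <= M y `^ p * (w y)%:E + N y `^ p * (w y)%:E.
  by move=> Dy; rewrite adde_ge0 ?pw0.
have mS := emeasurable_funD mMp mNp.
rewrite -(ge0_integralZl mu mD mS s0 P0).
apply: ge0_le_integral => //; [exact: pw0|apply: mpw; exact: emeasurable_funD|exact: measurable_funeM|].
move=> y Dy; rewrite -ge0_muleDl ?poweR_ge0// muleA.
by apply: lee_wpmul2r; [rewrite lee_fin w0|apply: poweRD_le; rewrite ?M0 ?N0].
Qed.

End weighted_sums.

Section oscillation_bound.
Context {R : realType} {n : nat} (O : set 'rV[R]_n).
Local Notation T := (lebesgue_rV R n).
Local Notation mu := (mu_rV R n).
Hypotheses (n0 : (0 < n)%N) (oO : open O) (bO : boundary O !=set0).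
Implicit Types (x y z : 'rV[R]_n) (f : T -> R) (sigma : R).
Local Notation d := (bdist O).
Local Notation cdil := (@cdil R n).

Let c0 : 0 < cdil. Proof. exact: cdil_gt0. Qed.

Lemma stops_compare_on (Q : nat -> set T -> Prop) (S : set T) (g1 g2 : T -> \bar R) :
  stops Q = S -> measurable_fun S g1 -> measurable_fun S g2 ->
  (forall x, S x -> 0 <= g1 x)%E -> (forall x, S x -> 0 <= g2 x)%E ->
  (forall j x, first_stop Q j x ->
    \int[mu]_(y in dyad j x) g1 y <= \int[mu]_(y in dyad j x) g2 y)%E ->
  (\int[mu]_(x in S) g1 x <= \int[mu]_(x in S) g2 x)%E.
Proof. by move=> <-; exact: stops_compare. Qed.

(** The Whitney cube and [Kcube] at [y] both lie in the doubled cube at [y]; the lower bound on the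
    side controls the volume ratio. *)
Lemma whitney_average sigma f j x y (c1 : R) : 1 <= sigma -> 0 < c1 ->
  whitney O sigma j (dyad j x) -> dyad j x y -> c1 * scale O sigma y <= 2 ^- j ->
  (`|average (dyad j x) f - average (Kcube O sigma y) f|%:E <=
   ((4 * cdil / c1) ^+ n + 2 ^+ n)%:E * sharp_max_res O sigma f y)%E.
Proof.
move=> s1 c10 W xy hc; have [Oy hy] := W _ xy.
have t0 := scale_gt0 oO bO s1 Oy; have h0 := @side_gt0 R j.
have Mosc : (mean_osc (cube y (2 * cdil * scale O sigma y)) f <= sharp_max_res O sigma f y)%E.
  apply: sharp_ge_osc => // i; rewrite subrr normr0.
  by rewrite -mulrA; apply: mulr_gt0 => //; exact: mulr_gt0.
have o0 := mean_osc_ge0 (cube y (2 * cdil * scale O sigma y)) f.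
set t := scale O sigma y in hc hy t0 Mosc o0 *; set osc := mean_osc _ f in Mosc o0.
set h := 2 ^- j in hc hy h0.
have ct0 : 0 < cdil * t by exact: mulr_gt0.
have c2t : 0 < 2 * cdil * t by rewrite -mulrA; exact: mulr_gt0.
have V0 : 0 < (2 * (2 * cdil * t)) ^+ n by apply: exprn_gt0; exact: mulr_gt0.
have v0 : 0 < (2 * (cdil * t)) ^+ n by apply: exprn_gt0; exact: mulr_gt0.
have vh0 : 0 < h ^+ n by exact: exprn_gt0.
have Dsub : dyad j x `<=` cube y (2 * cdil * t).
  apply: subset_trans (dyad_sub_cube xy) _; apply: le_cube.
  by move: hy ct0; rewrite -/h; lra.
have Ksub : cube y (cdil * t) `<=` cube y (2 * cdil * t).
  by apply: le_cube; move: ct0; lra.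
have A1 := average_sub f (measurable_dyad j x) (measurable_cube y _) Dsub (mu_dyad j x)
  (mu_cube y c2t) vh0 V0.
have A2 := average_sub f (measurable_cube y _) (measurable_cube y _) Ksub (mu_cube y ct0)
  (mu_cube y c2t) v0 V0.
have r1 : (2 * (2 * cdil * t)) ^+ n / h ^+ n <= (4 * cdil / c1) ^+ n.
  rewrite -exprVn -exprMn; apply: lerXn2r; rewrite ?nnegrE.
  - by apply/ltW/divr_gt0 => //; exact: mulr_gt0.
  - by apply/ltW/divr_gt0 => //; exact: mulr_gt0.
  rewrite (ler_pdivrMr _ _ h0) [leRHS]mulrAC (ler_pdivlMr _ _ c10).
  have c40 : 0 <= 4 * cdil by apply: mulr_ge0 => //; exact: ltW.
  by have := ler_wpM2l c40 hc; lra.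
have r2 : (2 * (2 * cdil * t)) ^+ n / (2 * (cdil * t)) ^+ n = 2 ^+ n.
  rewrite -exprVn -exprMn; congr (_ ^+ n).
  by field; rewrite !gt_eqF.
have M0 : (0 <= sharp_max_res O sigma f y)%E by exact: le_trans Mosc.
rewrite EFinD ge0_muleDl ?lee_fin ?exprn_ge0 ?divr_ge0 ?mulr_ge0 ?(ltW c0) ?(ltW c10)//.
apply: (@abs_sub_le _ _ _ (average (cube y (2 * cdil * t)) f)).
  apply: le_trans A1 _; apply: lee_pmul.
  - by rewrite lee_fin; apply/ltW/divr_gt0.
  - exact: o0.
  - by rewrite lee_fin.
  - exact: Mosc.
apply: le_trans A2 _; rewrite r2; exact: lee_wpmul2l.
Qed.

(** On a Whitney cube [D], [|f - c|] is split through the mean on [D] and the mean on [Kcube] at the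
    point. The number [c] depends on [sigma] and [f], the constant [C] on neither. *)
Lemma oscillation_bound (l gam p : R) : john_domain O ->
  assouad_exponent (boundary O) l -> l < n%:R + gam -> 1 < p ->
  exists2 C : R, 0 < C & forall sigma f, 1 <= sigma ->
  measurable_fun (O : set T) f -> exists c : R,
  (\int[mu]_(y in O) (`|f y - c| `^ p * d y `^ gam)%:E <=
   (C * (sigma ^+ n) `^ p)%:E *
   \int[mu]_(y in O) (sharp_max_res O sigma f y `^ p * (d y `^ gam)%:E))%E.
Proof.
move=> JO El lg p1; have p0 : 0 < p by exact: lt_trans p1.
have [[_ _ ne bd] _] := JO.
have [A [Cj [A1 Cj0 [x0 Ox0 HJ]]]] := john_average_bound n0 oO bO JO.
have [c1 c10 Hc1] := whitney_size n0 oO bO bd ne.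
have [K K0 HK] := whitney_fefferman_stein n0 oO bO p0.
have [Ct Ct0 HT] := cone_op_bounded oO bO El lg p1 A1.
pose C1 : R := (4 * cdil / c1) ^+ n + 2 ^+ n.
have C10 : 0 < C1 by rewrite addr_gt0 ?exprn_gt0// divr_gt0// mulr_gt0.
pose a : R := 2 `^ `|gam|; have a0 : 0 < a by rewrite powR_gt0.
pose C4 : R := 2 `^ p * (a * a * K + (C1 + Cj) `^ p).
have CC0 : 0 < C1 + Cj by exact: addr_gt0.
have aaK0 : 0 < a * a * K by exact: mulr_gt0 (mulr_gt0 a0 a0) K0.
have C40 : 0 < C4 by exact: mulr_gt0 (powR_gt0 _ (ltr0n _ 2)) (addr_gt0 aaK0 (powR_gt0 _ CC0)).
exists (C4 * (2 `^ p * (1 + Ct))).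
  exact: mulr_gt0 C40 (mulr_gt0 (powR_gt0 _ (ltr0n _ 2)) (addr_gt0 ltr01 Ct0)).
move=> sigma f s1 mf; have s0 : 0 < sigma by exact: lt_le_trans s1.
have sn1 : 1 <= sigma ^+ n by rewrite exprn_ege1.
have sn0 : 0 < sigma ^+ n by exact: exprn_gt0.
exists (average (Kcube O sigma x0) f).
set c := average _ f.
pose M : T -> \bar R := sharp_max_res O sigma f.
have M0 y : (0 <= M y)%E by exact: sharp_ge0.
pose N : T -> \bar R := cone_op O A M.
have N0 y : (0 <= N y)%E by exact: cone_op_ge0.
pose w (y : T) : R := d y `^ gam.
have mO : measurable (O : set T) by exact: measurable_open.
have mM : measurable_fun (O : set T) M by exact: (@measurable_sharp R n O sigma f s1).
have A0 : 0 <= A by exact: le_trans A1.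
have mN : measurable_fun (O : set T) N.
  apply: measurable_funTS; apply: measurable_cone_op => //.
have mw : measurable_fun (O : set T) w by exact: measurable_dist_powR.
have w0 y : 0 <= w y by exact: powR_ge0.
have mH : measurable_fun (O : set T) (fun y => M y + N y)%E by exact: emeasurable_funD.
(* As [sigma ^+ n >= 1], this one factor dominates both the local constant [C1] and the chain
   constant [Cj * sigma ^+ n]. *)
pose B : R := (C1 + Cj) * sigma ^+ n.
have B0 : 0 <= B by exact: mulr_ge0 (ltW CC0) (ltW sn0).
pose I1 : \bar R := (\int[mu]_(y in O) ((M y + N y) `^ p * (w y)%:E))%E.
have mpw (g : T -> \bar R) : measurable_fun (O : set T) g ->
    measurable_fun (O : set T) (fun y => g y `^ p * (w y)%:E)%E.
  by move=> mg; apply: emeasurable_funM; [exact: measurable_poweR_comp|exact/measurable_EFinP].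
have C4' : (0 <= (C4 * (sigma ^+ n) `^ p)%:E)%E.
  by rewrite lee_fin mulr_ge0 ?powR_ge0 ?(ltW C40).
have leC1B : C1 <= B.
  rewrite /B mulrDl; apply: (@le_trans _ _ (C1 * sigma ^+ n)); first by rewrite ler_peMr// ltW.
  by rewrite lerDl; exact: mulr_ge0 (ltW Cj0) (ltW sn0).
have leCjB : Cj * sigma ^+ n <= B.
  by rewrite /B mulrDl lerDr; exact: mulr_ge0 (ltW C10) (ltW sn0).
have local_bound : (\int[mu]_(y in O) (`|f y - c| `^ p * w y)%:E <=
    (C4 * (sigma ^+ n) `^ p)%:E * I1)%E.
  have mHp := mpw _ mH.
  have Hp0 y : O y -> (0 <= (M y + N y) `^ p * (w y)%:E)%E.
    by move=> _; rewrite mule_ge0 ?poweR_ge0// lee_fin w0.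
  rewrite /I1 -(ge0_integralZl mu mO mHp Hp0 C4').
  have SW := stops_whitney n0 oO bO s1.
  have mg1 := measurable_weighted_powR c p mf mw.
  have mg2 := measurable_funeM (C4 * (sigma ^+ n) `^ p)%:E mHp.
  have p1' y : O y -> (0 <= (`|f y - c| `^ p * w y)%:E)%E.
    by move=> _; rewrite lee_fin; exact: mulr_ge0 (powR_ge0 _ _) (w0 y).
  have p2 y : O y -> (0 <= (C4 * (sigma ^+ n) `^ p)%:E * ((M y + N y) `^ p * (w y)%:E))%E.
    by move=> Oy; exact: mule_ge0 C4' (Hp0 y Oy).
  apply: (stops_compare_on SW mg1 mg2 p1' p2).
  move=> j x Fx; have [W _] := Fx.
  have DO : dyad j x `<=` O by move=> y /W[].
  have mD : measurable (dyad j x : set T) by exact: measurable_dyad.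
  rewrite (ge0_integralZl mu mD (measurable_funS mO DO mHp) (fun y Dy => Hp0 y (DO y Dy)) C4').
  have Ox : O x by exact: DO (dyad_refl j x).
  have := @weighted_transfer R _ T mu (dyad j x) f w M (fun y => M y + N y)%E p a
    (average (dyad j x) f) c B K (w x) mD (measurable_funS mO DO mf) (measurable_funS mO DO mw)
    (measurable_funS mO DO mM) (measurable_funS mO DO mH) (w0 x) p0 (ltW a0) B0 (ltW K0).
  move=> /(_ _ _ _ _)/wrap[].
  - move=> y xy; have [Oy _] := W _ xy.
    have [h1 h2] := whitney_doubling n0 oO bO s1 W (dyad_refl j x) xy.
    have [h3 h4] := whitney_doubling n0 oO bO s1 W xy (dyad_refl j x).
    have dx := bdist_gt0 oO bO Ox; have dy := bdist_gt0 oO bO Oy.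
    by split; [exact: w0|exact: powR_comparable|exact: powR_comparable].
  - by move=> y _; split; [exact: M0|rewrite leeDl].
  - move=> y xy; have [Oy _] := W _ xy.
    have E1 := whitney_average f s1 c10 W xy (Hc1 _ _ _ _ s1 Fx xy).
    have E2 := HJ sigma f y s1 Oy.
    have BM : (C1%:E * M y <= B%:E * M y)%E.
      by apply: lee_wpmul2r => //; rewrite lee_fin; exact: leC1B.
    have BN : ((Cj * sigma ^+ n)%:E * N y <= B%:E * N y)%E.
      by apply: lee_wpmul2r => //; rewrite lee_fin; exact: leCjB.
    rewrite (ge0_muleDr _ (M0 y) (N0 y)).
    exact: abs_sub_le3 (le_trans E1 BM) (le_trans E2 BN).
  - exact: HK.
  move=> H; apply: le_trans H _; apply: lee_wpmul2r.
    by apply: integral_ge0 => y _; rewrite mule_ge0 ?poweR_ge0// lee_fin w0.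
  rewrite lee_fin /C4 -(mulrA (2 `^ p)); apply: ler_wpM2l; first exact: powR_ge0.
  rewrite /B powRM ?(ltW sn0)//; last exact: ltW.
  rewrite mulrDl lerD2r ler_peMr//; first exact: ltW.
  by have := le_powR (ltW p0) ler01 sn1; rewrite powR1.
apply: (le_trans local_bound).
have S : (I1 <= (2 `^ p * (1 + Ct))%:E * \int[mu]_(y in O) (M y `^ p * (w y)%:E))%E.
  have := @integral_poweRD_le R _ T mu O M N w p mO mM mN mw (fun y _ => M0 y) (fun y _ => N0 y)
    (fun y _ => w0 y) p0.
  move=> H; apply: (le_trans H); rewrite EFinM -muleA; apply: lee_wpmul2l.
    by rewrite lee_fin powR_ge0.
  rewrite EFinD ge0_muleDl ?lee_fin ?(ltW Ct0)// mul1e; apply: leeD; first exact: lexx.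
  exact: (HT M mM (fun y _ => M0 y)).
apply: le_trans (lee_wpmul2l C4' S) _.
rewrite muleA -EFinM.
rewrite (_ : C4 * (sigma ^+ n) `^ p * (2 `^ p * (1 + Ct)) = C4 * (2 `^ p * (1 + Ct)) * (sigma ^+ n) `^ p).
  exact: lexx.
by rewrite mulrAC.
Qed.

End oscillation_bound.

Section weight_mass.
Context {R : realType} {n : nat} (O : set 'rV[R]_n).
Local Notation T := (lebesgue_rV R n).
Local Notation mu := (mu_rV R n).
Hypotheses (n0 : (0 < n)%N) (oO : open O) (bO : boundary O !=set0).
Local Notation d := (bdist O).

(** For [A = 2 * B / d x0] the section of the cone at [x0] contains all of [O], so the mass is
    finite by [integral_ysection_cone]. It is positive already on a Whitney cube around [x0], taken
    with [sigma = 1]. *)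
Lemma weight_mass (l gam : R) : bounded_set O -> O !=set0 ->
  assouad_exponent (boundary O) l -> l < n%:R + gam ->
  exists2 W : R, 0 < W & (\int[mu]_(y in O) (d y `^ gam)%:E = W%:E)%E.
Proof.
move=> /bounded_setP[B B0 HB] [x0 Ox0] El lg.
have d0 := bdist_gt0 oO bO Ox0.
have A0 : 0 <= 2 * B / d x0 by rewrite divr_ge0 ?mulr_ge0 ?ltW.
have [C C0 HC] := integral_ysection_cone oO bO El lg A0.
have OE : O `&` ysection (cone O (2 * B / d x0)) x0 = O.
  apply/setIidPl => y Oy; rewrite ysection_cone/= divfK ?gt_eqF//.
  have nx : enorm (- x0) = enorm x0 by rewrite -(sub0r x0) enormB subr0.
  have b3 := enormD y (- x0); rewrite nx in b3.
  by have := HB _ Oy; have := HB _ Ox0; move: b3; lra.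
have := HC _ Ox0; rewrite OE; set I := (\int[mu]_(y in O) _)%E => IC.
have w0 (y : T) : O y -> (0 <= (d y `^ gam)%:E)%E by rewrite lee_fin powR_ge0.
have mO : measurable (O : set T) by exact: measurable_open.
have mw D : measurable_fun (D : set T) (fun y : T => (d y `^ gam)%:E).
  by apply/measurable_EFinP; exact: measurable_dist_powR.
have I0 : (0 < I)%E.
  have : stops (whitney O 1) x0 by rewrite (stops_whitney n0 oO bO (lexx 1)).
  move=> [j W]; have DO : dyad j x0 `<=` O by move=> y /W[].
  have mD : measurable (dyad j x0 : set T) by exact: measurable_dyad.
  pose v := d x0 `^ gam / 2 `^ `|gam|.
  have v0 : 0 < v by rewrite divr_gt0 ?powR_gt0.
  apply: (@lt_le_trans _ _ (\int[mu]_(y in dyad j x0) (d y `^ gam)%:E)%E); last first.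
    exact: ge0_subset_integral.
  have := @integral_ge_cst _ T R mu (dyad j x0) v%:E _ mD _ (mw _).
  rewrite lee_fin (ltW v0) mu_dyad -EFinM => /(_ isT)/(_ _)/wrap[].
    move=> y xy; have [Oy _] := W _ xy.
    have [h1 h2] := whitney_doubling n0 oO bO (lexx 1) W xy (dyad_refl j x0).
    have [h3 h4] := whitney_doubling n0 oO bO (lexx 1) W (dyad_refl j x0) xy.
    rewrite lee_fin /v ler_pdivrMr ?powR_gt0// mulrC.
    by apply: powR_comparable => //; exact: bdist_gt0.
  by apply: lt_le_trans; rewrite lte_fin mulr_gt0// exprn_gt0// side_gt0.
have Ifin : I \is a fin_num.
  by rewrite ge0_fin_numE; [exact: le_lt_trans IC (ltry _)|exact: ltW].
exists (fine I); last by rewrite fineK.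
by rewrite fine_gt0// I0/= ltey_eq Ifin.
Qed.

End weight_mass.

Theorem theorem5p9 (R : realType) (n : nat) (p beta : R)
    (Omega : set 'rV[R]_n) :
  (2 <= n)%N -> 1 < p -> john_domain Omega ->
  - (n%:R - assouad_dim (boundary Omega)) < beta * p ->
  exists2 C : R, 0 < C &
    forall (sigma : R) (f : 'rV[R]_n -> R),
      1 <= sigma ->
      in_wLp Omega (dist_weight Omega (beta * p)) p f ->
      (\int[mu_rV R n]_(x in Omega)
          (f x * dist_weight Omega (beta * p) x)%:E = 0)%E ->
      (wLnorm Omega (dist_weight Omega (beta * p)) p (EFin \o f) <=
       (C * sigma ^+ n)%:E *
       wLnorm Omega (dist_weight Omega (beta * p)) p
         (sharp_max_res Omega sigma f))%E.
Proof.
move=> n2 p1 JO dimO; have n0 : (0 < n)%N by exact: ltnW.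
have p0 : 0 < p by exact: lt_trans p1.
have [[oO _ ne bd] _] := JO.
have bO : boundary Omega !=set0 by exact: boundary_nonempty.
have dl : assouad_dim (boundary Omega) < n%:R + beta * p by move: dimO; lra.
(* The infimum defining the dimension may not be attained; an exponent still below [n + beta * p] is
   enough. *)
have [l El lg] := assouad_exponent_lt n0 dl.
have [W W0 IW] := weight_mass n0 oO bO bd ne El lg.
have [C C0 HC] := oscillation_bound n0 oO bO JO El lg p1.
pose w : 'rV[R]_n -> R := dist_weight Omega (beta * p).
have k0 : 0 < 2 `^ p * 2 :> R by rewrite mulr_gt0 ?powR_gt0.
exists ((2 `^ p * 2 * C) `^ p^-1); first exact: powR_gt0 (mulr_gt0 k0 C0).
move=> sigma f s1 [mf fp] fw0.
have sn0 : 0 < sigma ^+ n by apply: exprn_gt0; exact: lt_le_trans s1.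
set M := sharp_max_res Omega sigma f.
have mO : measurable (Omega : set (lebesgue_rV R n)) by exact: measurable_open.
have M0 x : (0 <= M x)%E by exact: sharp_ge0.
have w0 x : Omega x -> 0 < w x by move=> Ox; rewrite powR_gt0// bdist_gt0.
have Lf : (wLnorm Omega w p (EFin \o f) =
    (\int[mu_rV R n]_(x in Omega) (`|f x| `^ p * w x)%:E) `^ p^-1)%E by [].
have LM : (wLnorm Omega w p M =
    (\int[mu_rV R n]_(x in Omega) (M x `^ p * (w x)%:E)) `^ p^-1)%E.
  by congr (_ `^ _)%E; apply: eq_integral => x _; rewrite gee0_abs.
have pinv : p^-1 != 0 by rewrite invr_eq0 gt_eqF.
have Ifin : (\int[mu_rV R n]_(x in Omega) (`|f x| `^ p * w x)%:E < +oo)%E.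
  rewrite ltey; apply/eqP => Ioo; move: fp; rewrite Lf Ioo poweRyr//.
have [c Hc] := HC sigma f s1 mf.
have mw : measurable_fun (Omega : set (lebesgue_rV R n)) w by exact: measurable_dist_powR.
have H := remove_constant c mO mf mw w0 p1 W0 IW fw0 Ifin.
set J := (\int[mu_rV R n]_(x in Omega) (M x `^ p * (w x)%:E))%E in LM Hc.
have J0 : (0 <= J)%E.
  by apply: integral_ge0 => x Ox; apply: mule_ge0; [exact: poweR_ge0|rewrite lee_fin; exact: ltW (w0 x Ox)].
have H2 : (\int[mu_rV R n]_(x in Omega) (`|f x| `^ p * w x)%:E <=
    (2 `^ p * 2 * C * (sigma ^+ n) `^ p)%:E * J)%E.
  apply: le_trans H _; rewrite -(mulrA (2 `^ p * 2)) (EFinM (2 `^ p * 2) (C * _)) -muleA.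
  apply: lee_wpmul2l; [by rewrite lee_fin ltW|exact: Hc].
rewrite -/w Lf LM.
have I0 : (0 <= \int[mu_rV R n]_(x in Omega) (`|f x| `^ p * w x)%:E)%E.
  by apply: integral_ge0 => x Ox; rewrite lee_fin; exact: mulr_ge0 (powR_ge0 _ _) (ltW (w0 x Ox)).
have pi0 : 0 <= p^-1 by rewrite invr_ge0 ltW.
apply: (le_trans (le_poweR pi0 I0 H2)).
have kC0 : 0 < 2 `^ p * 2 * C by exact: mulr_gt0.
have q0 : 0 <= (sigma ^+ n) `^ p by exact: powR_ge0.
rewrite poweRM ?lee_fin//; last by apply: mulr_ge0 => //; exact: ltW.
rewrite poweR_EFin powRM ?(ltW kC0)//.
(* The p-th root turns the p-th power of [sigma ^+ n] back into the factor of the statement. *)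
by rewrite -(powRrM (sigma ^+ n)) mulfV ?gt_eqF// powRr1 ?(ltW sn0).
Qed.
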